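(* Let $B=(B_t)_{t\ge 0}$ be a standard one-dimensional Brownian motion and let $\Gamma=\{(t,B_t): t\in[0,1]\}\subseteq\mathbb{C}$ be the graph of $B|_{[0,1]}$. Then almost surely $\Gamma$ is $W^{1,\infty}$-removable.
   Context: $\mathbb{C}$ is identified with $\mathbb{R}^2$. For $D\subseteq\mathbb{C}$ open, the Sobolev space $W^{1,\infty}(D)$ consists of the functions $f\colon D\to\mathbb{R}$ with $f\in L^\infty(D)$ whose derivative exists in the weak sense and is in $L^\infty(D)$. For a domain $D\subseteq\mathbb{C}$, a compact set $K\subseteq D$ is $W^{1,\infty}$-removable inside $D$ if any continuous function $f\colon D\to\mathbb{R}$ which is in $W^{1,\infty}(D\setminus K)$ (i.e. whose restriction to $D\setminus K$ is in $W^{1,\infty}(D\setminus K)$) is in $W^{1,\infty}(D)$. A compact $K\subseteq\mathbb{C}$ is called $W^{1,\infty}$-removable if it is $W^{1,\infty}$-removable inside $\mathbb{C}$. (It is known that $K$ is $W^{1,\infty}$-removable inside one domain containing $K$ if and only if it is so inside any other domain containing $K$.) *)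

(* Defs.v *)
From HB Require Import structures.
From mathcomp Require Import all_boot all_order all_algebra.
From mathcomp Require Import all_classical all_reals all_analysis.

Set Implicit Arguments.
Unset Strict Implicit.
Unset Printing Implicit Defensive.

Import Order.TTheory GRing.Theory Num.Theory.
Import numFieldNormedType.Exports.

Local Open Scope classical_set_scope.
Local Open Scope ring_scope.

(* The complex plane is the product R * R. The norm the library puts on it is
   the sup norm, which has the Euclidean topology. *)
Notation plane_measure R := (@lebesgue_measure R \x @lebesgue_measure R)%E.

Section Plane.
Context {R : realType}.
Local Notation mu := (plane_measure R).

(* All iterated directional derivatives are differentiable, hence continuous. *)
Definition smooth (phi : R * R -> R) : Prop :=
  forall (vs : seq (R * R)) (z : R * R),
    differentiable (foldr (fun v g => 'D_v g) phi vs) z.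

(* The space C_c^oo(D); its elements are extended by 0 outside D. *)
Definition test_function (D : set (R * R)) (phi : R * R -> R) : Prop :=
  [/\ smooth phi, compact (closure [set z | phi z != 0])
    & closure [set z | phi z != 0] `<=` D].

(* A function on D is a total function of which only the values on D matter. *)
Definition Linfty (D : set (R * R)) (f : R * R -> R) : Prop :=
  measurable_fun D f /\ finite_norm mu +oo (f \_ D).

Definition weak_derivative (D : set (R * R)) (v : R * R)
    (f g : R * R -> R) : Prop :=
  forall phi, test_function D phi ->
    (\int[mu]_(z in D) (f z * 'D_v phi z) =
     - \int[mu]_(z in D) (g z * phi z))%R.

Definition W1infty (D : set (R * R)) (f : R * R -> R) : Prop :=
  [/\ Linfty D f,
      exists2 g, Linfty D g & weak_derivative D (1, 0) f g
    & exists2 g, Linfty D g & weak_derivative D (0, 1) f g].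

Definition W1infty_removable_inside (D K : set (R * R)) : Prop :=
  [/\ compact K, K `<=` D &
    forall f : R * R -> R, {within D, continuous f} ->
      W1infty (D `\` K) f -> W1infty D f].

Definition W1infty_removable (K : set (R * R)) : Prop :=
  W1infty_removable_inside setT K.

End Plane.

Section Brownian.
Context {d : measure_display} {T : measurableType d} {R : realType}.
Variable P : probability T R.

Definition mutually_independent (n : nat) (X : 'I_n -> T -> R) : Prop :=
  forall A : 'I_n -> set R, (forall i, measurable (A i)) ->
    (P (\bigcap_i (X i @^-1` A i)) = \prod_(i < n) P (X i @^-1` A i))%E.

(* The time set is [0, +oo[: nothing is required of B at negative times. *)
Record standard_brownian_motion (B : R -> {RV P >-> R}) : Prop := {
  bm_start : {ae P, forall w, B 0 w = 0} ;
  bm_independent_increments : forall (n : nat) (t : nat -> R),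
    0 <= t 0%N -> (forall i, (i < n)%N -> t i <= t i.+1) ->
    mutually_independent (fun i : 'I_n => B (t i.+1) \- B (t i)) ;
  bm_gaussian_increments : forall s t : R, 0 <= s -> s < t ->
    forall A : set R, measurable A ->
      P ((B t \- B s) @^-1` A) = normal_prob 0 (Num.sqrt (t - s)) A ;
  bm_continuous_paths :
    {ae P, forall w, {within `[0, +oo[, continuous (fun t => B t w)}} }.

End Brownian.

Arguments mutually_independent {d T R} P {n} X.
Arguments standard_brownian_motion {d T R} P B.

(* Main.v *)
From HB Require Import structures.
Require Import Defs.
From mathcomp Require Import all_boot all_order all_algebra.
From mathcomp Require Import all_classical all_reals all_analysis.
From mathcomp Require Import measurable_realfun ess_sup_inf.
From mathcomp Require Import ring lra.

(** The graph K of a continuous function b on [0, 1] is removable as soon as it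
    is covered by finitely many boxes, of bases [t j, t j.+1] and half-heights
    c j, with an arbitrarily small sum of the c j ^+ 2 ([removable_of_cheap]).
    Indeed, let f be continuous with bounded weak derivatives g off K. The
    defect, the integral of f * 'D_v phi + g * phi, vanishes when phi vanishes
    near K, so only the part of phi cut off by the boxes matters. In the
    vertical direction the derivative of a cutoff costs 1 / c j, which is paid
    by the height of the box; since this derivative has mean zero in y and f is
    continuous, the defect of a box is o(1) times its basis ([vertical_piece]).
    Hence the vertical defect vanishes for every phi. In the horizontal
    direction the cutoff has two vertical sides; as the vertical cutoff is
    itself the derivative of a function of size c j, the vertical identity just
    obtained shows that the sides contribute only O(c j ^+ 2)
    ([horizontal_piece]), and the sum of these terms is small.

    It remains to cover a Brownian path B cheaply ([brownian_cheap]). Equal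
    time steps do not work, because the quadratic variation of B is positive:
    the steps must adapt to the path. Fix delta > 0. At a given time t and for
    a given scale l, the path remains within delta * sqrt l of B t during
    [t, t + l] with a probability bounded below independently of l
    ([small_ball]). For many scales separated by large ratios these events are
    almost independent, so with a probability close to 1 at least one scale l
    is quiet ([exists_scales]); covering [t, t + l] by one box then has cost
    delta ^+ 2 * l. If no scale is quiet, one jumps by the smallest scale eta,
    at a cost of order eta on average. Jumping in this way from 0 to beyond 1,
    the quiet jumps cost at most 3 * delta ^+ 2 in total ([cover_of_costs]),
    while the other ones have a small mean total cost, since they occur with a
    small probability; Markov's inequality concludes ([exists_costs]).

    All probabilistic estimates are made on dyadic grids, uniformly in the
    mesh, and transferred to the path by monotone limits and continuity. The
    maximal inequality that they require is replaced by an explicit polynomial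
    in the increments ([osc4]). *)

Set Implicit Arguments.
Unset Strict Implicit.
Unset Printing Implicit Defensive.

Import Order.TTheory GRing.Theory Num.Theory.
Import numFieldNormedType.Exports.

Local Open Scope classical_set_scope.
Local Open Scope ring_scope.

(** * Smooth functions and a smooth step *)

Section Ck.
Context {R : realType}.

(** Differentiability k + 1 times through directional derivatives in all
    directions; this form makes [Cinfty] literally the notion [smooth] of test
    functions ([smooth_Cinfty]), and gives its closure properties by induction
    on k. *)
Fixpoint Ck {V : normedModType R} (k : nat) (f : V -> R) : Prop :=
  (forall x, differentiable f x) /\
  match k with 0 => True | k'.+1 => forall v, Ck k' ('D_v f) end.

Definition Cinfty {V : normedModType R} (f : V -> R) := forall k, Ck k f.

Section general.
Context {V : normedModType R}.
Implicit Types f g : V -> R.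

Lemma Ck_differentiable k f : Ck k f -> forall x, differentiable f x.
Proof. by case: k => [|k] []. Qed.

Lemma CkS k f : Ck k.+1 f -> Ck k f.
Proof.
elim: k f => [|k IH] f; first by move=> [].
by move=> [df Hf]; split => // v; apply: IH; exact: Hf.
Qed.

Lemma CkS_derive k f v : Ck k.+1 f -> Ck k ('D_v f).
Proof. by move=> [_]; exact. Qed.

Lemma Ck_cst k (a : R) : Ck k (fun _ : V => a).
Proof.
elim: k a => [|k IH] a; split => //.
move=> v; rewrite (_ : 'D_v _ = fun=> 0); last by apply/funext => x; rewrite derive_cst.
exact: IH.
Qed.

Lemma CkD k f g : Ck k f -> Ck k g -> Ck k (fun x => f x + g x).
Proof.
elim: k f g => [|k IH] f g Cf Cg;
  have df := Ck_differentiable Cf; have dg := Ck_differentiable Cg; split => //.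
- by move=> x; apply: differentiableD.
- by move=> x; apply: differentiableD.
move=> v; rewrite (_ : 'D_v _ = fun x => 'D_v f x + 'D_v g x).
  by apply: IH; exact: CkS_derive.
by apply/funext => x; rewrite (@deriveD _ _ _ f g)//; exact: diff_derivable.
Qed.

Lemma CkM k f g : Ck k f -> Ck k g -> Ck k (fun x => f x * g x).
Proof.
elim: k f g => [|k IH] f g Cf Cg; split => //.
- by move=> x; apply: differentiableM; [exact: Ck_differentiable Cf x|exact: Ck_differentiable Cg x].
- by move=> x; apply: differentiableM; [exact: Ck_differentiable Cf x|exact: Ck_differentiable Cg x].
move=> v; rewrite (_ : 'D_v _ = fun x => f x * 'D_v g x + g x * 'D_v f x).
  apply: CkD; apply: IH; [exact: CkS|exact: CkS_derive|exact: CkS|exact: CkS_derive].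
apply/funext => x.
rewrite (@deriveM _ _ f g)//; apply: diff_derivable.
- exact: Ck_differentiable Cf x.
- exact: Ck_differentiable Cg x.
Qed.

Lemma CkV k f : (forall x, f x != 0) -> Ck k f -> Ck k (fun x => (f x)^-1).
Proof.
move=> f0; elim: k => [|k IH] Cf; split => //.
- by move=> x; apply: differentiableV => //; exact: Ck_differentiable Cf x.
- by move=> x; apply: differentiableV => //; exact: Ck_differentiable Cf x.
move=> v; rewrite (_ : 'D_v _ = fun x => (-1) * ((f x)^-1 * (f x)^-1) * 'D_v f x).
  by apply: CkM; [apply: CkM; [exact: Ck_cst|apply: CkM; apply: IH; exact: CkS]|exact: CkS_derive].
apply/funext => x; rewrite (@deriveV _ _ f)//; last exact/diff_derivable/(Ck_differentiable Cf).
by rewrite /= [LHS]/GRing.scale /= mulN1r -expr2 exprVn.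
Qed.

End general.

(** Directional derivatives of f composed with an affine map are directional
    derivatives of f composed with the same map, so the induction on k closes.
    *)
Lemma Ck_comp_affine {V W : normedModType R} k (A L : V -> W) (f : W -> R) :
  (forall x, differentiable A x) -> (forall x v, 'd A x v = L v) ->
  Ck k f -> Ck k (f \o A).
Proof.
move=> dA dAL; elim: k f => [|k IH] f Cf; split => //.
- by move=> x; apply: differentiable_comp => //; exact: Ck_differentiable Cf _.
- by move=> x; apply: differentiable_comp => //; exact: Ck_differentiable Cf _.
move=> v; rewrite (_ : 'D_v _ = ('D_(L v) f) \o A); first exact/IH/CkS_derive.
have df := Ck_differentiable Cf.
apply/funext => x /=.
rewrite deriveE; last exact: differentiable_comp.
by rewrite diff_comp//= dAL deriveE.
Qed.

Lemma Ck_affine1 k (a b : R) (f : R -> R) : Ck k f -> Ck k (fun x => f (a * x + b)).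
Proof.
have dA x : is_diff x (fun x : R => a * x + b) (fun x => a *: x).
  rewrite (_ : (fun x : R => a * x + b) = (a *: idfun) + cst b) //.
  apply: is_diff_eq; apply/funext => y.
  by rewrite /= /cst/= addr0.
apply: (@Ck_comp_affine _ _ k (fun x => a * x + b) (fun v => a *: v)).
  by move=> x; have [] := dA x.
by move=> x v; rewrite diff_val.
Qed.

Lemma Ck_fst k (f : R -> R) : Ck k f -> Ck k (fun z : R * R => f z.1).
Proof.
apply: (@Ck_comp_affine (R * R)%type _ k fst fst).
  by move=> x; apply: linear_differentiable; by move=> ?; exact: cvg_fst.
by move=> x v; rewrite (@diff_lin _ _ _ fst)//; by move=> ?; exact: cvg_fst.
Qed.

Lemma Ck_snd k (f : R -> R) : Ck k f -> Ck k (fun z : R * R => f z.2).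
Proof.
apply: (@Ck_comp_affine (R * R)%type _ k snd snd).
  by move=> x; apply: linear_differentiable; by move=> ?; exact: cvg_snd.
by move=> x v; rewrite (@diff_lin _ _ _ snd)//; by move=> ?; exact: cvg_snd.
Qed.

Lemma CkS_derive1 k (f g : R -> R) :
  (forall x : R, is_derive x (1 : R) f (g x)) -> Ck k g -> Ck k.+1 f.
Proof.
move=> fg Cg; have df x : differentiable f x by apply/derivable1_diffP; case: (fg x).
split => // v; rewrite (_ : 'D_v f = fun x => v * g x); last first.
  apply/funext => x; rewrite deriveE// deriv1E; last by case: (fg x).
  by rewrite derive1E derive_val.
by apply: CkM => //; exact: Ck_cst.
Qed.

Lemma smooth_Cinfty (phi : R * R -> R) : smooth phi <-> Cinfty phi.
Proof.
split=> [sphi k|Cphi vs].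
  elim: k phi sphi => [|k IH] phi sphi; split => //; try exact: (sphi [::]).
  move=> v; apply: IH => vs z.
  by have := sphi (rcons vs v) z; rewrite foldr_rcons.
elim/last_ind: vs phi Cphi => [|vs v IH] phi Cphi z /=.
  by have [] := Cphi 0%N.
rewrite foldr_rcons; apply: IH => k.
exact/CkS_derive/Cphi.
Qed.

(** The family is closed under differentiation up to linear combinations,
    which is why a whole family, and not only exp(-1/x), is introduced. *)
Definition flat (n : nat) (x : R) : R :=
  if 0 < x then x^-1 ^+ n * expR (- x^-1) else 0.

(** The exponential series gives exp(1/x) >= (1/x)^(n+2) / (n+2)!; a quadratic
    bound at 0 is what makes the derivative at 0 vanish. *)
Lemma flat_le n x : `|flat n x| <= n.+2`!%:R * x ^+ 2.
Proof.
rewrite /flat; case: ifPn => [x0|_]; last first.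
  by rewrite normr0 mulr_ge0// sqr_ge0.
have y0 : 0 < x^-1 by rewrite invr_gt0.
rewrite ger0_norm ?mulr_ge0 ?exprn_ge0 ?expR_ge0 ?(ltW y0)// expRN.
rewrite ler_pdivrMr ?expR_gt0//.
have := @expR_ge1Dxn R x^-1 n.+1 (ltW y0) => H.
have {}H : x^-1 ^+ n.+2 / n.+2`!%:R <= expR x^-1 by apply: le_trans H; rewrite lerDr.
have f0 : (0 < n.+2`!%:R :> R) by rewrite ltr0n fact_gt0.
rewrite ler_pdivrMr// in H.
have : x^-1 ^+ n = x ^+ 2 * x^-1 ^+ n.+2.
  by rewrite !exprS; field; rewrite gt_eqF.
move=> ->.
have -> : n.+2`!%:R * x ^+ 2 * expR x^-1 = x ^+ 2 * (expR x^-1 * n.+2`!%:R) by ring.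
by rewrite ler_wpM2l ?sqr_ge0.
Qed.

Lemma is_derive_flat n (x : R) : is_derive x (1 : R) (flat n) (- n%:R * flat n.+1 x + flat n.+2 x).
Proof.
have [x0|x0|->] := ltgtP x 0.
- rewrite /flat lt_gtF// mulr0 addr0.
  apply: (@near_eq_is_derive _ _ _ (cst 0) _ _ _ _ _ (@is_derive_cst R R R 0 x 1)).
  near=> y; rewrite ifF//; apply/negbTE; rewrite -leNgt.
  by apply/ltW; near: y; exact: lt_nbhsl.
- rewrite /flat x0.
  apply: (@near_eq_is_derive R R R (fun y : R => y^-1 ^+ n * expR (- y^-1))).
    near=> y; rewrite ifT//; near: y; exact: lt_nbhsr.
  have xn0 : x != 0 by rewrite gt_eqF.
  have dV : is_derive x 1 (fun y : R => y^-1) (- x^-1 ^+ 2).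
    apply: is_derive_eq (@is_deriveV R id x 1 1 xn0 (is_derive_id _ _)) _.
    by rewrite /= scaler1 exprVn.
  have dE : is_derive x 1 (fun y : R => expR (- y^-1)) (expR (- x^-1) * x^-1 ^+ 2).
    have h1 : is_derive x 1 (fun y : R => - y^-1) (x^-1 ^+ 2).
      by apply: is_derive_eq (is_deriveN dV) _; rewrite opprK.
    exact: (@is_derive1_comp _ expR (fun y => - y^-1) x (expR (- x^-1)) _ (is_derive_expR _) h1).
  have dX : is_derive x 1 (fun y : R => y^-1 ^+ n) (- n%:R * x^-1 ^+ n.+1).
    rewrite (_ : (fun y : R => y^-1 ^+ n) = (fun y : R => y^-1) ^+ n); last first.
      by apply/funext => y; rewrite exprfctE.
    apply: (is_derive_eq (is_deriveX n dV)).
    case: n => [|m]; first by rewrite mul0r scale0r oppr0 mul0r.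
    rewrite /= [LHS]/GRing.scale/= !exprS; ring.
  apply: is_derive_eq (is_deriveM dX dE) _.
  by rewrite /= /GRing.scale/= !exprS; ring.
rewrite {2 3}/flat ltxx mulr0 addr0.
have key : (fun h : R => h^-1 *: ((flat n \o shift 0) (h *: 1) - flat n 0)) @ 0^' --> 0.
  apply/cvgrPdist_le => /= e e0.
  near=> h; rewrite sub0r normrN addr0 [flat n 0]/flat ltxx subr0.
  rewrite [X in flat n X](_ : _ = h); last by rewrite /GRing.scale/= mulr1.
  have h0 : 0 < `|h| by rewrite normr_gt0; near: h; exact: nbhs_dnbhs_neq.
  rewrite normrZ normfV ler_pdivrMl//.
  apply: le_trans (flat_le n h) _.
  rewrite -[h ^+ 2]ger0_norm ?sqr_ge0// normrX expr2 mulrA mulrC ler_pM2l//.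
  have f0 : (0 < n.+2`!%:R :> R) by rewrite ltr0n fact_gt0.
  rewrite mulrC -ler_pdivlMr//.
  near: h; apply: nbhs_dnbhs.
  by apply: (@nbhs0_le R R (e / n.+2`!%:R)); rewrite divr_gt0.
apply: DeriveDef; first by apply/cvg_ex; exists 0.
exact: cvg_lim key.
Unshelve. all: by end_near. Qed.

Lemma Cinfty_flat n : Cinfty (flat n).
Proof.
move=> k; elim: k n => [|k IH] n.
  by split=> // x; apply/derivable1_diffP; have [] := is_derive_flat n x.
apply: (CkS_derive1 (is_derive_flat n)).
by apply: CkD => //; apply: CkM => //; exact: Ck_cst.
Qed.

Lemma flat_gt0 n x : 0 < x -> 0 < flat n x.
Proof.
by move=> x0; rewrite /flat x0 mulr_gt0 ?expR_gt0// exprn_gt0// invr_gt0.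
Qed.

Lemma flat_ge0 n x : 0 <= flat n x.
Proof.
have [x0|x0] := ltP 0 x; first exact/ltW/flat_gt0.
by rewrite /flat ltNge x0.
Qed.

Lemma flat0 n x : x <= 0 -> flat n x = 0.
Proof. by move=> x0; rewrite /flat ltNge x0. Qed.

Definition step (x : R) : R := flat 0 x * (flat 0 x + flat 0 (1 - x))^-1.

Lemma step_den_gt0 x : 0 < flat 0 x + flat 0 (1 - x).
Proof.
have [x0|x0] := ltP 0 x; first by rewrite ltr_pwDl// ?flat_gt0// flat_ge0.
by rewrite ltr_wpDl ?flat_ge0// flat_gt0//; lra.
Qed.

Lemma Cinfty_step : Cinfty step.
Proof.
move=> k; apply: CkM; first exact: Cinfty_flat.
apply: CkV; first by move=> x; rewrite gt_eqF// step_den_gt0.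
apply: CkD; first exact: Cinfty_flat.
have := @Ck_affine1 k (-1) 1 _ (Cinfty_flat 0 k).
by congr Ck; apply/funext => x; congr flat; ring.
Qed.

Lemma step0 x : x <= 0 -> step x = 0.
Proof. by move=> x0; rewrite /step flat0// mul0r. Qed.

Lemma step1 x : 1 <= x -> step x = 1.
Proof.
move=> x1; rewrite /step [flat 0 (1 - x)]flat0; last lra.
rewrite addr0 divff// gt_eqF// flat_gt0//; lra.
Qed.

End Ck.

(** * Measure and integration in the plane *)

Section PlaneIntegrals.
Context {R : realType}.
Local Notation mu := (plane_measure R).
Local Notation plane := (measurableTypeR R * measurableTypeR R)%type.

Lemma measurable_plane (D : set (R * R)) (f : R * R -> R) :
  measurable_fun D f <-> measurable_fun (D : set plane) (f : plane -> R).
Proof. by []. Qed.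

(** An open set is the countable union of the boxes with rational corners that
    it contains. *)
Lemma open_measurable_plane (U : set (R * R)) : open U -> measurable (U : set plane).
Proof.
move=> oU.
pose box (p : (rat * rat) * (rat * rat)) : set (R * R) :=
  `]ratr p.1.1, ratr p.1.2[%classic `*` `]ratr p.2.1, ratr p.2.2[%classic.
rewrite (_ : U = \bigcup_n (if unpickle n is Some p then
    if `[< box p `<=` U >] then box p else set0 else set0)).
  apply: bigcupT_measurable => n; case: unpickle => // p.
  by case: asboolP => // _; apply: measurableX; exact: measurable_itv.
apply/seteqP; split=> [z Uz|z [n _]]; last first.
  by case: unpickle => // p; case: asboolP => // pU /pU.
have [e /= e0 eU] : \forall e \near 0^'+, ball z e `<=` U.
  by have := oU z Uz; rewrite -nbhs_ballE => -[e /= e0 eU];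
     apply: (filterS _ (nbhs_right_le e0)) => d de; apply: subset_trans eU; exact: le_ball.
have {}eU : ball z (e / 2) `<=` U.
  apply: eU => /=; last by rewrite divr_gt0.
  by rewrite sub0r normrN gtr0_norm ?divr_gt0// ltr_pdivrMr// ltr_pMr// ltr1n.
have h x : exists p : rat * rat, x - e / 2 < ratr p.1 < x /\ x < ratr p.2 < x + e / 2.
  have e20 : 0 < e / 2 by rewrite divr_gt0.
  have [|p] := @rat_in_itvoo R (x - e / 2) x; first lra.
  have [|q] := @rat_in_itvoo R x (x + e / 2); first lra.
  by rewrite !in_itv/= => ? ?; exists (p, q).
have [p [/andP[p1 p2] /andP[p3 p4]]] := h z.1.
have [q [/andP[q1 q2] /andP[q3 q4]]] := h z.2.
exists (pickle (p, q)); first exact: I.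
rewrite pickleK; case: asboolP => [_|]; first by split; rewrite /= in_itv/= ?p2 ?p3 ?q2 ?q3.
move=> nU; exfalso; apply: nU => -[x y] [/=]; rewrite !in_itv/= => /andP[x1 x2] /andP[y1 y2].
apply: eU; split; rewrite /ball/= ltr_norml; apply/andP; split; lra.
Qed.

Lemma continuous_measurable_plane (f : R * R -> R) :
  continuous f -> measurable_fun (setT : set plane) f.
Proof.
move=> cf; apply: (measurability _ (measurable_realfun.RGenOInfty.measurableE R)).
move=> /= _ [_ [a ->]] <-; rewrite setTI; apply: open_measurable_plane.
by move/continuousP : cf; apply; exact: interval_open.
Qed.

Definition rect (a b c d : R) : set plane :=
  `[a, b]%classic `*` `[c, d]%classic.

Lemma measurable_rect a b c d : measurable (rect a b c d).
Proof. by apply: measurableX; exact: measurable_itv. Qed.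

Lemma measure_rect a b c d : a <= b -> c <= d ->
  mu (rect a b c d) = ((b - a) * (d - c))%:E.
Proof.
move=> ab cd; rewrite /rect product_measure1E; [|exact: measurable_itv..].
have h x y : x <= y -> (@lebesgue_measure R) `[x, y]%classic = (y - x)%:E.
  rewrite lebesgue_measure_itv/= lte_fin le_eqVlt => /predU1P[->|->]; last by rewrite EFinB.
  by rewrite ltxx subrr.
by rewrite [X in (X * _)%E](h a b ab) [X in (_ * X)%E](h c d cd).
Qed.

Lemma integrable_rect (h : plane -> R) (A a b c d : R) :
  measurable_fun (setT : set plane) h -> (forall z, `|h z| <= A) ->
  (forall z, ~ rect a b c d z -> h z = 0) -> a <= b -> c <= d ->
  mu.-integrable setT (EFin \o h).
Proof.
move=> mh hA h0 ab cd.
have -> : (EFin \o h) = ((EFin \o h) \_ (rect a b c d)).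
  apply/funext => z; rewrite patchE; case: ifPn => // /negP.
  by rewrite inE /= => /h0 ->.
have mrec := @measurable_rect a b c d.
apply/(integrable_mkcond _ mrec).
apply: measurable_bounded_integrable; first exact: measurable_rect.
- by rewrite [X in (X < _)%E]measure_rect// ltry.
- exact: measurable_funTS.
exists A; split; rewrite ?num_real// => x Ax z _.
by rewrite /= (le_trans (hA z))// ltW.
Qed.

Lemma le_Rintegral_rect (h : plane -> R) (A a b c d : R) :
  measurable_fun (setT : set plane) h -> (forall z, `|h z| <= A) ->
  (forall z, ~ rect a b c d z -> h z = 0) -> a <= b -> c <= d ->
  `| \int[mu]_z h z | <= A * ((b - a) * (d - c)).
Proof.
move=> mh hA h0 ab cd.
have ih := integrable_rect mh hA h0 ab cd.
rewrite (le_trans (le_normr_Rintegral _ ih))//.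
have mrec := @measurable_rect a b c d.
rewrite (_ : \int[mu]_z `|h z| = \int[mu]_(z in rect a b c d) `|h z|); last first.
  rewrite [RHS]Rintegral_mkcond; apply: eq_Rintegral => z _.
  rewrite patchE; case: ifPn => // /negP.
  by rewrite inE /= => /h0 ->; rewrite normr0.
have -> : A * ((b - a) * (d - c)) = \int[mu]_(z in rect a b c d) A.
  by rewrite Rintegral_cst// [X in fine X]measure_rect.
apply: le_Rintegral => //.
- by apply: (@integrable_norm _ _ _ _ _ h); exact: integrableS ih.
- apply: measurable_bounded_integrable => //.
  + by rewrite [X in (X < _)%E]measure_rect// ltry.
  + exact: bounded_cst.
Qed.

(** Only the first point is required to lie in K: the second one may leave the
    compact set. *)
Lemma Heine_compact {V : normedModType R} (K : set V) (f : V -> R) : compact K ->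
  (forall x, K x -> {for x, continuous f}) ->
  forall e, 0 < e -> exists2 d, 0 < d &
    forall x y, K x -> `|x - y| < d -> `|f x - f y| < e.
Proof.
move=> /compact_near_coveringP cK cf e e0.
have := cK R 0^'+ (fun d x => forall y, `|x - y| < d -> `|f x - f y| < e) _.
case.
  move=> x Kx.
  have e20 : 0 < e / 2 by rewrite divr_gt0.
  have := cf x Kx => /cvgrPdist_lt /(_ _ e20).
  rewrite -nbhs_ballE => -[d /= d0 dP].
  exists (ball x (d / 2), [set r | r < d / 2]) => /=.
    by split; [apply: nbhsx_ballx; rewrite divr_gt0|apply: nbhs_right_lt; rewrite divr_gt0].
  move=> [u r] [/= xu rd] y uy.
  have d2 : d = d / 2 + d / 2 by rewrite -splitr.
  have xu2 : `|f x - f u| < e / 2.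
    by apply: dP; apply: le_ball xu; rewrite ler_pdivrMr// ler_pMr// ler1n.
  have xy2 : `|f x - f y| < e / 2.
    apply: dP; rewrite -ball_normE/=.
    rewrite (_ : x - y = (x - u) + (u - y)); last by rewrite addrA subrK.
    rewrite d2 (le_lt_trans (ler_normD _ _))// ltrD//; last exact: lt_trans rd.
    by move: xu; rewrite -ball_normE.
  rewrite (_ : f u - f y = (f x - f y) - (f x - f u)); last by ring.
  by rewrite (le_lt_trans (ler_normB _ _))// [e]splitr ltrD.
move=> d /= d0 dP; exists (d / 2); first by rewrite divr_gt0.
move=> x y Kx xy; apply: (dP (d / 2)) => //=; last by rewrite divr_gt0.
by rewrite sub0r normrN gtr0_norm ?divr_gt0// ltr_pdivrMr// ltr_pMr// ltr1n.
Qed.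

End PlaneIntegrals.

(** * Test functions and the defect of integration by parts *)

Section TestFunctions.
Context {R : realType}.
Local Notation mu := (plane_measure R).
Local Notation plane := (measurableTypeR R * measurableTypeR R)%type.
Implicit Types (u k f g phi : R * R -> R).

Definition ccont u := continuous u /\ exists r : R, forall z, r < `|z| -> u z = 0.

(** Test functions of the whole plane, with compactness of the support
    replaced by an explicit radius. *)
Definition tfun phi := Cinfty phi /\ exists r : R, forall z, r < `|z| -> phi z = 0.

Lemma Cinfty_continuous {V : normedModType R} (f : V -> R) : Cinfty f -> continuous f.
Proof. by move=> Cf x; apply/differentiable_continuous; have [] := Cf 0%N. Qed.

Lemma Cinfty_derive {V : normedModType R} (f : V -> R) v : Cinfty f -> Cinfty ('D_v f).
Proof. by move=> Cf k; exact/CkS_derive/Cf. Qed.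

Lemma CinftyM {V : normedModType R} (f g : V -> R) :
  Cinfty f -> Cinfty g -> Cinfty (fun x => f x * g x).
Proof. by move=> Cf Cg k; exact: CkM. Qed.

Lemma CinftyD {V : normedModType R} (f g : V -> R) :
  Cinfty f -> Cinfty g -> Cinfty (fun x => f x + g x).
Proof. by move=> Cf Cg k; exact: CkD. Qed.

Lemma Cinfty_cst {V : normedModType R} (a : R) : Cinfty (fun _ : V => a).
Proof. by move=> k; exact: Ck_cst. Qed.

Lemma Cinfty_sum {V : normedModType R} n (f : nat -> V -> R) :
  (forall i, Cinfty (f i)) -> Cinfty (fun x => \sum_(0 <= i < n) f i x).
Proof.
move=> Cf; elim: n => [|n IH].
  rewrite (_ : (fun x : V => _) = fun=> 0); first exact: Cinfty_cst.
  by apply/funext => x; rewrite big_geq.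
rewrite (_ : (fun x : V => _) = (fun x => \sum_(0 <= i < n) f i x + f n x)).
  exact: CinftyD.
by apply/funext => x; rewrite big_nat_recr.
Qed.

Lemma tfunM phi k : tfun phi -> Cinfty k -> tfun (fun z => phi z * k z).
Proof.
move=> [Cphi [r phi0]] Ck; split; first exact: CinftyM.
by exists r => z rz; rewrite phi0// mul0r.
Qed.

Lemma tfun_ccont phi : tfun phi -> ccont phi.
Proof. by move=> [Cphi [r phi0]]; split; [exact: Cinfty_continuous|exists r]. Qed.

Lemma near_eq0_derive phi z v : (\forall y \near z, phi y = 0) -> 'D_v phi z = 0.
Proof.
move=> phi0; rewrite -[RHS](@derive_cst _ (R * R)%type R 0 z v).
by apply: near_eq_derive; near=> y; apply: (near phi0 y).
Unshelve. all: by end_near. Qed.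

Lemma tfun_derive_ccont phi v : tfun phi -> ccont ('D_v phi).
Proof.
move=> [Cphi [r phi0]]; split; first exact/Cinfty_continuous/Cinfty_derive.
exists r => z rz; apply: near_eq0_derive.
have : \forall y \near z, r < `|y|.
  by have /cvgr_gt := @norm_continuous R (R * R)%type z; apply.
by apply: filterS => y; exact: phi0.
Qed.

Lemma ccontM u f : ccont u -> continuous f -> ccont (fun z => f z * u z).
Proof.
move=> [cu [r u0]] cf; split; first by move=> z; apply: cvgM; [exact: cf|exact: cu].
by exists r => z rz; rewrite u0// mulr0.
Qed.

Lemma ccontD u f : ccont u -> ccont f -> ccont (fun z => u z + f z).
Proof.
move=> [cu [r u0]] [cf [s f0]]; split; first by move=> z; apply: cvgD; [exact: cu|exact: cf].
exists (Num.max r s) => z; rewrite gt_max => /andP[rz sz].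
by rewrite u0// f0// addr0.
Qed.

Lemma compact_square (r : R) : compact ((`[-r, r]%classic `*` `[-r, r]%classic) : set (R * R)).
Proof. by apply: compact_setX; exact: segment_compact. Qed.

Lemma le_norm_square (r : R) (z : R * R) :
  `|z| <= r -> (`[-r, r]%classic `*` `[-r, r]%classic) z.
Proof.
rewrite /Num.norm/= ge_max => /andP[z1 z2].
by split; rewrite /= in_itv/= -ler_norml.
Qed.

Lemma ccont_bounded u : ccont u -> exists2 A : R, 0 <= A & forall z, `|u z| <= A.
Proof.
move=> [cu [r u0]].
have /compact_bounded[M [_ MP]] : compact (u @` (`[-r, r]%classic `*` `[-r, r]%classic)).
  apply: continuous_compact; last exact: compact_square.
  exact: continuous_subspaceT.
exists (`|M| + 1) => [|z]; first by rewrite addr_ge0.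
have [zr|/u0 ->] := leP `|z| r; last by rewrite normr0 addr_ge0.
by apply: MP; [rewrite ltr_pwDr// ler_norm|exists z => //; exact: le_norm_square].
Qed.

(** Bounded, measurable and vanishing outside a square: a class of integrable
    functions stable under the operations below, so that no integrability
    condition has to be checked by hand. *)
Definition tame (h : plane -> R) := [/\ measurable_fun (setT : set plane) h,
  exists A : R, forall z, `|h z| <= A &
  exists r : R, forall z, ~ rect (-r) r (-r) r z -> h z = 0].

Lemma tame_integrable h : tame h -> mu.-integrable setT (EFin \o h).
Proof.
move=> [mh [A hA] [r hr]].
apply: (@integrable_rect _ h A (- `|r|) `|r| (- `|r|) `|r|) => //.
- move=> z zr; apply: hr => -[]; rewrite /= !in_itv/= -!ler_norml => z1 z2; apply: zr.
  by split; rewrite /= in_itv/= -ler_norml (le_trans _ (ler_norm r)).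
- by rewrite ge0_cp.
- by rewrite ge0_cp.
Qed.

Lemma tame_ccont u : ccont u -> tame u.
Proof.
move=> cu; split; first by case: cu => cu _; exact: continuous_measurable_plane.
- by have [A _ uA] := ccont_bounded cu; exists A.
have [_ [r u0]] := cu; exists r => z zr; apply: u0; rewrite ltNge; apply/negP => zr'.
exact/zr/le_norm_square.
Qed.

Lemma tameM g u : measurable_fun (setT : set plane) g -> (exists M : R, forall z, `|g z| <= M) ->
  tame u -> tame (fun z => g z * u z).
Proof.
move=> mg [M gM] [mu [A uA] [r ur]]; split; first exact: measurable_funM.
- by exists (M * A) => z; rewrite normrM ler_pM.
- by exists r => z /ur ->; rewrite mulr0.
Qed.

Lemma tameD u k : tame u -> tame k -> tame (fun z => u z + k z).
Proof.
move=> [mu [A uA] [r ur]] [mk [B kB] [s ks]]; split; first exact: measurable_funD.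
- by exists (A + B) => z; rewrite (le_trans (ler_normD _ _))// lerD.
exists (Num.max `|r| `|s|) => z zrs; rewrite ur ?ks ?addr0// => zr; apply: zrs.
  case: zr; rewrite /= !in_itv/= -!ler_norml => z1 z2.
  by split; rewrite /= in_itv/= -ler_norml le_max (le_trans _ (ler_norm s)) ?orbT.
case: zr; rewrite /= !in_itv/= -!ler_norml => z1 z2.
by split; rewrite /= in_itv/= -ler_norml le_max (le_trans _ (ler_norm r)).
Qed.

Lemma tameN u : tame u -> tame (fun z => - u z).
Proof.
move=> [mu [A uA] [r ur]]; split.
- exact: measurableT_comp.
- by exists A => z; rewrite normrN.
- by exists r => z /ur ->; rewrite oppr0.
Qed.

Lemma tameB u k : tame u -> tame k -> tame (fun z => u z - k z).
Proof. by move=> tu tk; exact: (tameD tu (tameN tk)). Qed.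

Lemma tame_RintegralD u k : tame u -> tame k ->
  \int[mu]_z (u z + k z) = \int[mu]_z u z + \int[mu]_z k z.
Proof. by move=> tu tk; rewrite RintegralD//; exact: tame_integrable. Qed.

Lemma tame_RintegralB u k : tame u -> tame k ->
  \int[mu]_z (u z - k z) = \int[mu]_z u z - \int[mu]_z k z.
Proof. by move=> tu tk; rewrite RintegralB//; exact: tame_integrable. Qed.

(** Vanishes for all test functions exactly when g is the weak derivative of f
    in direction v. *)
Definition defect v f g phi : R :=
  \int[mu]_z (f z * 'D_v phi z + g z * phi z).

Definition bounded_measurable g := measurable_fun (setT : set plane) g /\
  exists M : R, forall z, `|g z| <= M.

Lemma defect_tame v f g phi : continuous f -> bounded_measurable g -> tfun phi ->
  tame (fun z => f z * 'D_v phi z + g z * phi z).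
Proof.
move=> cf [mg gM] bphi; apply: tameD.
  apply/tame_ccont/ccontM => //; exact: tfun_derive_ccont.
by apply: tameM => //; exact/tame_ccont/tfun_ccont.
Qed.

Lemma defectD v f g phi psi : continuous f -> bounded_measurable g ->
  tfun phi -> tfun psi ->
  defect v f g (fun z => phi z + psi z) = defect v f g phi + defect v f g psi.
Proof.
move=> cf bg bphi bpsi; rewrite /defect -RintegralD//; last 2 first.
- exact/tame_integrable/defect_tame.
- exact/tame_integrable/defect_tame.
apply: eq_Rintegral => z _.
rewrite (@deriveD _ _ _ phi psi); last 2 first.
- by apply/diff_derivable; have [/(_ 0%N)[]] := bphi.
- by apply/diff_derivable; have [/(_ 0%N)[]] := bpsi.
by rewrite mulrDr mulrDr addrACA.
Qed.

Lemma tfunD phi psi : tfun phi -> tfun psi -> tfun (fun z => phi z + psi z).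
Proof.
move=> [Cf fr] [Cg gr]; split; first exact: CinftyD.
by have [] := ccontD (tfun_ccont (conj Cf fr)) (tfun_ccont (conj Cg gr)).
Qed.

Lemma tfun0 : tfun (fun=> 0).
Proof. by split; [exact: Cinfty_cst|exists 0]. Qed.

Lemma defect_sum v f g n (phi : nat -> R * R -> R) : continuous f -> bounded_measurable g ->
  (forall i, tfun (phi i)) ->
  tfun (fun z => \sum_(0 <= i < n) phi i z) /\
  defect v f g (fun z => \sum_(0 <= i < n) phi i z) =
  \sum_(0 <= i < n) defect v f g (phi i).
Proof.
move=> cf bg bphi; elim: n => [|n [bIH IH]].
  rewrite (_ : (fun z : R * R => _) = fun=> 0); last by apply/funext => x; rewrite big_geq.
  split; first exact: tfun0.
  rewrite big_geq// /defect; under eq_Rintegral do rewrite derive_cst !mulr0 addr0.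
  by rewrite Rintegral_cst// mul0r.
rewrite (_ : (fun z : R * R => _) = (fun z => \sum_(0 <= i < n) phi i z + phi n z)).
  by split; [exact: tfunD|rewrite defectD// IH big_nat_recr].
by apply/funext => z; rewrite big_nat_recr.
Qed.

End TestFunctions.

(** * Profiles for cutoff functions *)

Section Profiles.
Context {R : realType}.
Implicit Types (x y u w c m : R).

Lemma Cinfty_derive1 (h : R -> R) : Cinfty h -> Cinfty (derive1 h).
Proof.
move=> Ch; rewrite (_ : derive1 h = 'D_1 h); first exact: Cinfty_derive.
by apply/funext => x; rewrite derive1E.
Qed.

Lemma Cinfty_is_derive (h : R -> R) x : Cinfty h -> is_derive x (1 : R) h (derive1 h x).
Proof.
move=> Ch; rewrite derive1E; apply/derivableP/derivable1_diffP.
by have [] := Ch 0%N.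
Qed.

Lemma Cinfty_affine (a c : R) (h : R -> R) : Cinfty h -> Cinfty (fun x => h (a * x + c)).
Proof. by move=> Ch k; exact: Ck_affine1. Qed.

Lemma derive1_affine (a c : R) (h : R -> R) x : Cinfty h ->
  derive1 (fun x => h (a * x + c)) x = a * derive1 h (a * x + c).
Proof.
move=> Ch; rewrite derive1E.
have dA : is_derive x (1 : R) (fun x : R => a * x + c) a.
  rewrite (_ : (fun x : R => a * x + c) = (a *: id) + cst c) //.
  by apply: is_derive_eq; rewrite addr0 /GRing.scale/= mulr1.
have dh := Cinfty_is_derive (a * x + c) Ch.
have := @is_derive1_comp R h (fun x : R => a * x + c) x _ a dh dA.
by move=> [_ ->]; rewrite mulrC.
Qed.

Lemma derive1_near_cst (h : R -> R) x a : (\forall y \near x, h y = a) -> derive1 h x = 0.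
Proof.
move=> ha; rewrite derive1E -[RHS](@derive_cst R R R a x 1).
by apply: near_eq_derive; apply: filterS ha.
Qed.

Lemma step_ge0 x : 0 <= step x.
Proof. by rewrite /step mulr_ge0 ?flat_ge0// invr_ge0 ltW// step_den_gt0. Qed.

Lemma step_le1 x : step x <= 1.
Proof.
by rewrite /step ler_pdivrMr ?step_den_gt0// mul1r lerDl flat_ge0.
Qed.

Lemma cc_bounded (h : R -> R) (r : R) : continuous h -> (forall x, r < `|x| -> h x = 0) ->
  exists2 A : R, 0 <= A & forall x, `|h x| <= A.
Proof.
move=> ch h0.
have /compact_bounded[M [_ MP]] : compact (h @` `[-r, r]).
  apply: continuous_compact; last exact: segment_compact.
  exact: continuous_subspaceT.
exists (`|M| + 1) => [|z]; first by rewrite addr_ge0.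
have [zr|/h0 ->] := leP `|z| r; last by rewrite normr0 addr_ge0.
by apply: MP; [rewrite ltr_pwDr// ler_norm|exists z => //=; rewrite in_itv/= -ler_norml].
Qed.

Definition step' : R -> R := derive1 step.

Lemma Cinfty_step' : Cinfty step'.
Proof. exact/Cinfty_derive1/Cinfty_step. Qed.

Lemma step'0 x : x < 0 -> step' x = 0.
Proof.
move=> x0; apply: (@derive1_near_cst _ _ 0); near=> y; apply: step0.
by apply/ltW; near: y; exact: lt_nbhsl.
Unshelve. all: by end_near. Qed.

Lemma step'1 x : 1 < x -> step' x = 0.
Proof.
move=> x0; apply: (@derive1_near_cst _ _ 1); near=> y; apply: step1.
by apply/ltW; near: y; exact: lt_nbhsr.
Unshelve. all: by end_near. Qed.

Lemma step'_bounded : exists2 A : R, 0 <= A & forall x, `|step' x| <= A.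
Proof.
apply: (@cc_bounded _ 1); first exact/Cinfty_continuous/Cinfty_step'.
move=> x; rewrite lter_normr => /orP[|x1]; first exact: step'1.
by apply: step'0; lra.
Qed.

(** Equal to u for |u| < 3 and supported in |u| <= 4. Its derivative [ramp']
    is the vertical cutoff: it is 1 near 0, has compact support, and both it
    and [ramp''] are derivatives of compactly supported functions, hence have
    mean zero. *)
Definition ramp u := u * (step (u + 4) * step (4 - u)).
Definition ramp' : R -> R := derive1 ramp.
Definition ramp'' : R -> R := derive1 ramp'.

Lemma Cinfty_ramp : Cinfty ramp.
Proof.
move=> k; apply: CkM.
  have := @CkS_derive1 R k id (cst 1) (fun x => is_derive_id x 1).
  by move=> H; apply: CkS; apply: H; exact: Ck_cst.
apply: CkM.
  have := @Ck_affine1 R k 1 4 _ (Cinfty_step k).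
  by congr Ck; apply/funext => x; rewrite mul1r.
have := @Ck_affine1 R k (-1) 4 _ (Cinfty_step k).
by congr Ck; apply/funext => x; rewrite mulN1r addrC.
Qed.

Lemma Cinfty_ramp' : Cinfty ramp'.
Proof. exact/Cinfty_derive1/Cinfty_ramp. Qed.

Lemma Cinfty_ramp'' : Cinfty ramp''.
Proof. exact/Cinfty_derive1/Cinfty_ramp'. Qed.

Lemma ramp0 u : 4 < `|u| -> ramp u = 0.
Proof.
rewrite /ramp lter_normr => /orP[u4|u4].
  by rewrite [step (4 - u)]step0 ?mulr0//; lra.
by rewrite [step (u + 4)]step0 ?mul0r ?mulr0//; lra.
Qed.

Lemma near_abs_gt (a x : R) : a < `|x| -> \forall y \near x, a < `|y|.
Proof. by move=> ax; have /cvgr_gt := @norm_continuous R R x; apply. Qed.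

Lemma ramp'0 u : 4 < `|u| -> ramp' u = 0.
Proof.
move=> /near_abs_gt u4; apply: (@derive1_near_cst _ _ 0).
by apply: filterS u4 => y; exact: ramp0.
Qed.

Lemma ramp''0 u : 4 < `|u| -> ramp'' u = 0.
Proof.
move=> /near_abs_gt u4; apply: (@derive1_near_cst _ _ 0).
by apply: filterS u4 => y; exact: ramp'0.
Qed.

Lemma ramp'1 u : `|u| < 3 -> ramp' u = 1.
Proof.
move=> u3; rewrite /ramp' derive1E.
rewrite -[RHS](@derive_id R R u 1).
apply: near_eq_derive.
have : \forall y \near u, `|y| < 3.
  by have /cvgr_lt := @norm_continuous R R u; apply.
apply: filterS => y; rewrite ltr_norml => /andP[y1 y2].
by rewrite /ramp !step1 ?mulr1//; lra.
Qed.

Lemma ramp_bounded : exists2 A : R, 0 <= A &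
  forall u, [/\ `|ramp u| <= A, `|ramp' u| <= A & `|ramp'' u| <= A].
Proof.
have [A A0 hA] := @cc_bounded ramp 4 (Cinfty_continuous Cinfty_ramp) ramp0.
have [B B0 hB] := @cc_bounded ramp' 4 (Cinfty_continuous Cinfty_ramp') ramp'0.
have [C C0 hC] := @cc_bounded ramp'' 4 (Cinfty_continuous Cinfty_ramp'') ramp''0.
exists (A + B + C); first by rewrite !addr_ge0.
move=> u; split.
- by rewrite (le_trans (hA u))// -addrA lerDl addr_ge0.
- by rewrite (le_trans (hB u))// addrAC lerDr addr_ge0.
- by rewrite (le_trans (hC u))// lerDr addr_ge0.
Qed.

(** Fundamental theorem of calculus on a segment whose endpoints lie outside
    the support. *)
Lemma integral_derive1_cc (h : R -> R) (r : R) : Cinfty h ->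
  (forall x, r < `|x| -> h x = 0) ->
  (\int[@lebesgue_measure R]_x (derive1 h x)%:E = 0)%E.
Proof.
move=> Ch h0.
pose s : R := `|r| + 1.
have s0 : 0 < s by rewrite ltr_wpDl.
have rs x : s <= `|x| -> r < `|x|.
  by move=> sx; rewrite (le_lt_trans (ler_norm _))// (lt_le_trans _ sx)// ltrDl.
have dh x : is_derive x (1 : R) h (derive1 h x) by exact: Cinfty_is_derive.
rewrite (_ : (\int[_]_x _)%E = (\int[@lebesgue_measure R]_(x in `[(- s)%R, s]) (derive1 h x)%:E)%E); last first.
  rewrite [RHS]integral_mkcond; apply: eq_integral => x _.
  rewrite patchE; case: ifPn => // /negP; rewrite inE/= in_itv/= -ler_norml => /negP.
  rewrite -ltNge => sx; rewrite (@derive1_near_cst _ _ 0)//.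
  apply: filterS (near_abs_gt sx) => y sy; apply: h0.
  by apply: rs; exact: ltW.
rewrite (@continuous_FTC2 _ _ h).
- by rewrite !h0 ?sube0//; apply: rs; rewrite ?normrN gtr0_norm.
- lra.
- exact/continuous_subspaceT/Cinfty_continuous/Cinfty_derive1.
- split.
  + by move=> x _; case: (dh x).
  + apply: cvg_at_right_filter; exact: (Cinfty_continuous Ch).
  + apply: cvg_at_left_filter; exact: (Cinfty_continuous Ch).
- by move=> x _.
Qed.

End Profiles.

(** * Cutoff functions of boxes *)

Section Pieces.
Context {R : realType}.
Local Notation mu := (plane_measure R).
Local Notation plane := (measurableTypeR R * measurableTypeR R)%type.
Implicit Types (f g phi : R * R -> R) (x y w c m s t : R).

Lemma Cinfty_fst (h : R -> R) : Cinfty h -> Cinfty (fun z : R * R => h z.1).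
Proof. by move=> Ch k; exact: Ck_fst. Qed.

Lemma Cinfty_snd (h : R -> R) : Cinfty h -> Cinfty (fun z : R * R => h z.2).
Proof. by move=> Ch k; exact: Ck_snd. Qed.

Lemma derive_fst (h : R -> R) (v z : R * R) : Cinfty h ->
  'D_v (fun z : R * R => h z.1) z = v.1 * derive1 h z.1.
Proof.
move=> Ch; have dh y : differentiable h y by have [] := Ch 0%N.
have c1 : continuous (fst : R * R -> R) by move=> ?; exact: cvg_fst.
have d1 : differentiable (fst : R * R -> R) z by exact: linear_differentiable.
rewrite deriveE; last exact: (@differentiable_comp _ _ _ _ fst h).
rewrite (@diff_comp _ _ _ _ fst h)//= (@diff_lin _ _ _ fst)//.
by rewrite deriv1E; last exact/derivable1_diffP.
Qed.

Lemma derive_snd (h : R -> R) (v z : R * R) : Cinfty h ->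
  'D_v (fun z : R * R => h z.2) z = v.2 * derive1 h z.2.
Proof.
move=> Ch; have dh y : differentiable h y by have [] := Ch 0%N.
have c1 : continuous (snd : R * R -> R) by move=> ?; exact: cvg_snd.
have d1 : differentiable (snd : R * R -> R) z by exact: linear_differentiable.
rewrite deriveE; last exact: (@differentiable_comp _ _ _ _ snd h).
rewrite (@diff_comp _ _ _ _ snd h)//= (@diff_lin _ _ _ snd)//.
by rewrite deriv1E; last exact/derivable1_diffP.
Qed.

Lemma Cinfty_derivable {V : normedModType R} (h : V -> R) z v :
  Cinfty h -> derivable h z v.
Proof. by move=> Ch; apply/diff_derivable; have [] := Ch 0%N. Qed.

Lemma derive_box phi (h k : R -> R) (v z : R * R) :
  Cinfty phi -> Cinfty h -> Cinfty k ->
  'D_v (fun z : R * R => phi z * (h z.1 * k z.2)) z =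
  'D_v phi z * (h z.1 * k z.2) +
  phi z * (v.1 * (derive1 h z.1 * k z.2) + v.2 * (h z.1 * derive1 k z.2)).
Proof.
move=> Cphi Ch Ck.
have C1 := Cinfty_fst Ch; have C2 := Cinfty_snd Ck.
rewrite (@deriveM _ _ phi (fun z => h z.1 * k z.2)); [|exact: Cinfty_derivable|exact/Cinfty_derivable/CinftyM].
rewrite (@deriveM _ _ (fun z => h z.1) (fun z => k z.2)); [|exact: Cinfty_derivable|exact/Cinfty_derivable].
rewrite derive_fst// derive_snd// /GRing.scale/=.
ring.
Qed.

Lemma Cinfty_box (h k : R -> R) : Cinfty h -> Cinfty k ->
  Cinfty (fun z : R * R => h z.1 * k z.2).
Proof. by move=> Ch Ck; apply: CinftyM; [exact: Cinfty_fst|exact: Cinfty_snd]. Qed.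

(** The affine map is written in the form of [derive1_affine]. *)
Definition rescale (h : R -> R) m c y := h (c^-1 * y + - (c^-1 * m)).

Lemma Cinfty_rescale (h : R -> R) m c : Cinfty h -> Cinfty (rescale h m c).
Proof. exact: Cinfty_affine. Qed.

Lemma derive1_rescale (h : R -> R) m c y : Cinfty h ->
  derive1 (rescale h m c) y = c^-1 * rescale (derive1 h) m c y.
Proof. by move=> Ch; rewrite /rescale derive1_affine. Qed.

Lemma rescale_arg m c y : 0 < c -> `|c^-1 * y + - (c^-1 * m)| = `|y - m| / c.
Proof.
by move=> c0; rewrite -mulrBr normrM gtr0_norm ?invr_gt0// mulrC.
Qed.

Lemma rescale_supp (h : R -> R) m c y : 0 < c -> (forall u, 4 < `|u| -> h u = 0) ->
  ~ (`[m - 4 * c, m + 4 * c]%classic y) -> rescale h m c y = 0.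
Proof.
move=> c0 h0 yN; apply: h0; rewrite rescale_arg// ltr_pdivlMr//.
rewrite ltNge; apply/negP; rewrite ler_norml => /andP[y1 y2]; apply: yN.
by rewrite /= in_itv/=; apply/andP; split; lra.
Qed.

Lemma measurable_smooth (h : R * R -> R) : Cinfty h -> measurable_fun (setT : set plane) h.
Proof. by move=> /Cinfty_continuous /continuous_measurable_plane. Qed.

(** The product profile confines u to the box [a, b] x [c, d]. *)
Lemma le_Rintegral_box (u : plane -> R) (h k : R -> R) (A H K a b c d : R) :
  tame u -> (forall z, `|u z| <= A) -> Cinfty h -> Cinfty k ->
  (forall x, `|h x| <= H) -> (forall y, `|k y| <= K) ->
  (forall x, ~ `[a, b]%classic x -> h x = 0) ->
  (forall y, ~ `[c, d]%classic y -> k y = 0) ->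
  a <= b -> c <= d ->
  tame (fun z => u z * (h z.1 * k z.2)) /\
  `| \int[mu]_z (u z * (h z.1 * k z.2)) | <= A * (H * K) * ((b - a) * (d - c)).
Proof.
move=> [mu_ [A' uA'] [r ur]] uA Ch Ck hH kK h0 k0 ab cd.
have mhk : measurable_fun (setT : set plane) (fun z : plane => h z.1 * k z.2).
  by apply: measurable_smooth; exact: Cinfty_box.
have bnd (z : plane) : `|u z * (h z.1 * k z.2)| <= A * (H * K).
  by rewrite !normrM ler_pM// ?mulr_ge0// ler_pM.
split.
  split; first exact: measurable_funM.
  - by exists (A * (H * K)).
  - by exists r => z /ur ->; rewrite mul0r.
apply: le_Rintegral_rect => //; first exact: measurable_funM.
move=> z zN; have [x1|x1] := pselect (`[a, b]%classic z.1).
  by rewrite k0 ?mulr0// => y1; apply: zN.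
by rewrite h0// mul0r mulr0.
Qed.

(** Fubini: the inner integral in y vanishes. *)
Lemma Rintegral_mean0 (h k : R -> R) :
  tame (fun z : plane => h z.1 * k z.2) ->
  (\int[@lebesgue_measure R]_y (k y)%:E = 0)%E ->
  (@lebesgue_measure R).-integrable setT (EFin \o k) ->
  \int[mu]_z (h z.1 * k z.2) = 0.
Proof.
move=> /tame_integrable thk k0 ik.
rewrite /Rintegral.
have := integral12_prod_meas1 thk.
rewrite /fubini_F => <-.
rewrite [X in fine X](_ : _ = 0%E)//.
apply: integral0_eq => x _ /=.
under eq_integral do rewrite EFinM.
by rewrite integralZl// k0 mule0.
Qed.

End Pieces.

(** * The defect carried by one box *)

Lemma derive1_ramp' (R : realType) : derive1 (@ramp' R) = @ramp'' R.
Proof. by []. Qed.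

Lemma derive1_ramp (R : realType) : derive1 (@ramp R) = @ramp' R.
Proof. by []. Qed.

Lemma derive1_step (R : realType) : derive1 (@step R) = @step' R.
Proof. by []. Qed.

Local Opaque step step' ramp ramp' ramp''.

Section PieceEstimates.
Context {R : realType}.
Local Notation mu := (plane_measure R).
Local Notation plane := (measurableTypeR R * measurableTypeR R)%type.
Implicit Types (f g phi : R * R -> R) (x y w c m s t : R).

Lemma integrable_cc1 (k : R -> R) (r : R) : continuous k ->
  (forall x, r < `|x| -> k x = 0) ->
  (@lebesgue_measure R).-integrable setT (EFin \o k).
Proof.
move=> ck k0.
have -> : (EFin \o k) = ((EFin \o k) \_ `[- r, r]).
  apply/funext => z; rewrite patchE; case: ifPn => // /negP.
  rewrite inE /= in_itv/= -ler_norml => /negP; rewrite -ltNge => /k0.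
  by move=> ->.
have mI : measurable (`[- r, r]%classic : set (measurableTypeR R)) by exact: measurable_itv.
apply/(integrable_mkcond _ mI).
apply: continuous_compact_integrable; first exact: segment_compact.
exact: continuous_subspaceT.
Qed.

Lemma norm_gt_itvN (r : R) m c y : 0 < c -> `|m| + 4 * c < `|y| ->
  ~ `[m - 4 * c, m + 4 * c]%classic y.
Proof.
move=> c0 my; rewrite /= in_itv/= => /andP[y1 y2].
suff : `|y - m| <= 4 * c.
  move=> ym; have := ler_normD (y - m) m; rewrite subrK; lra.
by rewrite ler_norml; apply/andP; split; lra.
Qed.

Lemma norm_pair x y (r : R) : `|x| <= r -> `|y| <= r -> `|(x, y)| <= r.
Proof. by move=> xr yr; rewrite /Num.norm/= ge_max xr. Qed.

(** Vertical estimate for a box of width t - s and height of order c around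
    the height m: the defect is O((c + o) (t - s)), where o bounds the
    vertical oscillation of f * phi over the box. Differentiating the cutoff
    costs 1 / c, the height of the box pays for it, and the gain o comes from
    the mean zero of the differentiated cutoff. The constant C does not depend
    on the box. *)
Lemma vertical_piece f g phi : continuous f -> bounded_measurable g -> tfun phi ->
  exists2 C : R, 0 <= C & forall (chi : R -> R) s t m c (o : R),
    Cinfty chi -> (forall x, `|chi x| <= 1) ->
    (forall x, ~ `[s, t]%classic x -> chi x = 0) ->
    s <= t -> 0 < c -> 0 <= o ->
    (forall x y, `|y - m| <= 4 * c ->
       `|f (x, y) * phi (x, y) - f (x, m) * phi (x, m)| <= o) ->
    `|defect (0, 1) f g (fun z => phi z * (chi z.1 * rescale ramp' m c z.2))|
       <= C * (c + o) * (t - s).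
Proof.
move=> cf bg tphi.
have tame1 := defect_tame (0, 1) cf bg tphi.
have [_ [A0 hA0] _] := tame1.
pose A : R := `|A0|.
have A_ge0 : 0 <= A by exact: normr_ge0.
pose a (z : plane) := f z * 'D_(0, 1) phi z + g z * phi z.
have hA z : `|a z| <= A by rewrite (le_trans (hA0 z))// ler_norm.
pose F z := f z * phi z.
have ccF : ccont F by apply: ccontM => //; exact: tfun_ccont.
have [cF [rF F0]] := ccF.
have [B B0 hB] := @ramp_bounded R.
have hB1 u : `|@ramp' R u| <= B by have [] := hB u.
have hB2 u : `|@ramp'' R u| <= B by have [] := hB u.
exists (8 * (A + 1) * B) => [|chi s t m c o Cchi chi1 chi0 st c0 o0 Fo].
  by rewrite !mulr_ge0// addr_ge0.
have Cphi : Cinfty phi by case: tphi.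
pose P1 := rescale (@ramp' R) m c.
have CP1 : Cinfty P1 by exact/Cinfty_rescale/Cinfty_ramp'.
pose P2 : R -> R := derive1 P1.
have P2E y : P2 y = c^-1 * rescale (@ramp'' R) m c y.
  by rewrite /P2 (derive1_rescale m c y (@Cinfty_ramp' R)) derive1_ramp'.
have P1s y : ~ `[m - 4 * c, m + 4 * c]%classic y -> P1 y = 0.
  by apply: rescale_supp => // u; exact: ramp'0.
have P2s y : ~ `[m - 4 * c, m + 4 * c]%classic y -> P2 y = 0.
  by move=> yN; rewrite P2E (rescale_supp c0 (@ramp''0 R) yN) mulr0.
have hP2 y : `|P2 y| <= c^-1 * B.
  rewrite P2E normrM gtr0_norm ?invr_gt0//.
  by apply: ler_wpM2l; [rewrite invr_ge0 ltW|exact: hB2].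
have cP2 : continuous P2 by exact/Cinfty_continuous/Cinfty_derive1.
have m4 : m - 4 * c <= m + 4 * c by lra.
have [t1 b1] := le_Rintegral_box tame1 hA Cchi CP1 chi1 (fun y => hB1 _) chi0 P1s st m4.
(* The term F * chi * P2 is split by freezing F at height m: the frozen part
   integrates to 0 in y since P2 is a derivative, the remainder is o * B / c on
   a box of height 8 * c. *)
pose u2 (z : plane) := (F z - F (z.1, m)) * (chi z.1 * P2 z.2).
pose h3 x := F (x, m) * chi x.
have cpair : continuous (fun x : R => (x, m)).
  by move=> x; apply: (@cvg_pair _ _ _ (nbhs x) (nbhs x) (nbhs m) _ _ _ id (cst m)); [exact: cvg_id|exact: cvg_cst].
have cFm : continuous (fun x => F (x, m)).
  by move=> x; apply: (@continuous_comp _ _ _ (fun x : R => (x, m)) F); [exact: cpair|exact: cF].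
have cchi : continuous chi by exact: Cinfty_continuous.
have ch3 : continuous h3 by move=> x; apply: cvgM; [exact: cFm|exact: cchi].
have cfst : continuous (fst : R * R -> R) by move=> ?; exact: cvg_fst.
have csnd : continuous (snd : R * R -> R) by move=> ?; exact: cvg_snd.
have c1 (h : R -> R) : continuous h -> continuous (fun z : R * R => h z.1).
  by move=> ch z; apply: (@continuous_comp _ _ _ fst h); [exact: cfst|exact: ch].
have c2 (h : R -> R) : continuous h -> continuous (fun z : R * R => h z.2).
  by move=> ch z; apply: (@continuous_comp _ _ _ snd h); [exact: csnd|exact: ch].
have cu2 : continuous (u2 : R * R -> R).
  move=> z; apply: cvgM; first by apply: cvgB; [exact: cF|exact: (c1 _ cFm)].
  by apply: cvgM; [exact: (c1 _ cchi)|exact: (c2 _ cP2)].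
have rect0 (z : R * R) : `|s| + `|t| + `|m| + 4 * c < `|z| ->
    ~ `[s, t]%classic z.1 \/ ~ `[m - 4 * c, m + 4 * c]%classic z.2.
  rewrite ltNge => zN; apply/not_andP => -[z1 z2]; apply/negP: zN; apply/negPn.
  rewrite [z]surjective_pairing; apply: norm_pair.
    move: z1; rewrite /= in_itv/= => /andP[s1 s2].
    rewrite ler_norml; have := ler_norm t; have := normr_ge0 m.
    have := ler_norm (- s); rewrite normrN; have := normr_ge0 t; have := normr_ge0 s.
    by move=> *; apply/andP; split; lra.
  move: z2; rewrite /= in_itv/= => /andP[s1 s2].
  rewrite ler_norml; have := ler_norm m; have := normr_ge0 m.
  have := ler_norm (- m); rewrite normrN; have := normr_ge0 t; have := normr_ge0 s.
  by move=> *; apply/andP; split; lra.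
have t2 : tame u2.
  apply: tame_ccont; split => //; exists (`|s| + `|t| + `|m| + 4 * c) => z /rect0[z1|z2].
    by rewrite /u2 chi0// mul0r mulr0.
  by rewrite /u2 P2s// !mulr0.
have t3 : tame (fun z : plane => h3 z.1 * P2 z.2).
  apply: tame_ccont; split.
    by move=> z; apply: cvgM; [exact: (c1 _ ch3)|exact: (c2 _ cP2)].
  exists (`|s| + `|t| + `|m| + 4 * c) => z /rect0[z1|z2].
    by rewrite /h3 chi0// mulr0 mul0r.
  by rewrite P2s// !mulr0.
have P1r y : `|m| + 4 * c < `|y| -> P1 y = 0 by move=> /(norm_gt_itvN 0 c0) /P1s.
have P2r y : `|m| + 4 * c < `|y| -> P2 y = 0 by move=> /(norm_gt_itvN 0 c0) /P2s.
have i3 : \int[mu]_z (h3 z.1 * P2 z.2) = 0.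
  apply: Rintegral_mean0 => //; first exact: (integral_derive1_cc CP1 P1r).
  exact: integrable_cc1 cP2 P2r.
have b2 : `|\int[mu]_z u2 z| <= (o * (c^-1 * B)) * ((t - s) * ((m + 4 * c) - (m - 4 * c))).
  apply: le_Rintegral_rect => //; first by case: t2.
    move=> z; have [z2|z2] := pselect (`[m - 4 * c, m + 4 * c]%classic z.2); last first.
      by rewrite /u2 P2s// !mulr0 normr0 !mulr_ge0// invr_ge0 ltW.
    rewrite /u2 !normrM ler_pM//.
      rewrite [z in F z]surjective_pairing; apply: Fo.
      move: z2; rewrite /= in_itv/= => /andP[s1 s2].
      by rewrite ler_norml; apply/andP; split; lra.
    rewrite -[c^-1 * B]mul1r.
    exact: (ler_pM (normr_ge0 _) (normr_ge0 _) (chi1 _) (hP2 _)).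
  move=> z zN; have [x1|x1] := pselect (`[s, t]%classic z.1).
    by rewrite /u2 P2s ?mulr0// => y1; apply: zN.
  by rewrite /u2 chi0// mul0r mulr0.
rewrite (_ : defect _ _ _ _ = \int[mu]_z (a z * (chi z.1 * P1 z.2)) + \int[mu]_z u2 z); last first.
  rewrite -[RHS]addr0 -[X in _ = _ + X]i3 -(tame_RintegralD t1 t2) -(tame_RintegralD (tameD t1 t2) t3).
  apply: eq_Rintegral => z _; rewrite (derive_box (0, 1) z Cphi Cchi CP1) /u2 /h3 /F /=.
  by rewrite -/P1 -/P2; ring.
rewrite (le_trans (ler_normD _ _))//.
apply: le_trans (lerD b1 b2) _.
have c1c : c^-1 * c = 1 by rewrite mulVf// gt_eqF.
have -> : o * (c^-1 * B) * ((t - s) * (m + 4 * c - (m - 4 * c))) =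
   8 * B * o * (t - s) * (c^-1 * c) by ring.
rewrite c1c.
have A0' : 0 <= A by [].
rewrite -subr_ge0 (_ : _ - _ = 8 * B * (t - s) * (A * o + c)); last by ring.
by rewrite !mulr_ge0 ?subr_ge0// addr_ge0 ?mulr_ge0// ltW.
Qed.

(** As a difference of translates of one function, the windows of consecutive
    intervals telescope. *)
Definition window s t w x := rescale step s w x - rescale step t w x.

Lemma Cinfty_window s t w : Cinfty (window s t w).
Proof.
rewrite (_ : window s t w = fun x => rescale step s w x + (-1) * rescale step t w x); last first.
  by apply/funext => x; rewrite /window mulN1r.
apply: CinftyD; first exact/Cinfty_rescale/Cinfty_step.
by apply: CinftyM; [exact: Cinfty_cst|exact/Cinfty_rescale/Cinfty_step].
Qed.

Lemma window_bound s t w x : `|window s t w x| <= 1.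
Proof.
rewrite /window /rescale ler_norml.
have := @step_ge0 R (w^-1 * x + - (w^-1 * s)); have := @step_le1 R (w^-1 * x + - (w^-1 * s)).
have := @step_ge0 R (w^-1 * x + - (w^-1 * t)); have := @step_le1 R (w^-1 * x + - (w^-1 * t)).
by move=> *; apply/andP; split; lra.
Qed.

Lemma rescale_step0 s w x : 0 < w -> x <= s -> rescale step s w x = 0.
Proof.
move=> w0 xs; rewrite /rescale step0// -mulrBr.
by rewrite pmulr_rle0 ?invr_gt0// subr_le0.
Qed.

Lemma rescale_step1 s w x : 0 < w -> s + w <= x -> rescale step s w x = 1.
Proof.
move=> w0 xs; rewrite /rescale step1// -mulrBr mulrC.
by rewrite ler_pdivlMr// mul1r lerBrDl.
Qed.

Lemma window_supp s t w x : 0 < w -> s <= t ->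
  ~ `[s, t + w]%classic x -> window s t w x = 0.
Proof.
move=> w0 st; rewrite /= in_itv/= => /negP; rewrite negb_and -!ltNge /window.
by move=> /orP[xs|tx]; [rewrite !rescale_step0 ?subrr|rewrite !rescale_step1 ?subrr]; lra.
Qed.

(** Horizontal estimate for the same box: the defect is O(c (t + w - s) +
    c^2), the term c^2 coming from the two vertical sides of the box. Here the
    validity of the vertical identity across the graph is used. *)
Lemma horizontal_piece f g1 g2 phi : continuous f ->
  bounded_measurable g1 -> bounded_measurable g2 -> tfun phi ->
  (forall theta, tfun theta -> defect (0, 1) f g2 theta = 0) ->
  exists2 C : R, 0 <= C & forall s t w m c, 0 < w -> s <= t -> 0 < c ->
    `|defect (1, 0) f g1 (fun z => phi z * (window s t w z.1 * rescale ramp' m c z.2))|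
       <= C * (c * (t + w - s) + c ^+ 2).
Proof.
move=> cf bg1 bg2 tphi H2.
have tame1 := defect_tame (1, 0) cf bg1 tphi.
have tame2 := defect_tame (0, 1) cf bg2 tphi.
have [_ [A10 hA10] _] := tame1.
have [_ [A20 hA20] _] := tame2.
pose A1 : R := `|A10|; pose A2 : R := `|A20|.
have A1_ge0 : 0 <= A1 by exact: normr_ge0.
have A2_ge0 : 0 <= A2 by exact: normr_ge0.
pose a1 (z : plane) := f z * 'D_(1, 0) phi z + g1 z * phi z.
pose a2 (z : plane) := f z * 'D_(0, 1) phi z + g2 z * phi z.
have hA1 z : `|a1 z| <= A1 by rewrite (le_trans (hA10 z))// ler_norm.
have hA2 z : `|a2 z| <= A2 by rewrite (le_trans (hA20 z))// ler_norm.
pose F z := f z * phi z.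
have ccF : ccont F by apply: ccontM => //; exact: tfun_ccont.
have [AF AF0 hAF] := ccont_bounded ccF.
have [B B0 hB] := @ramp_bounded R.
have hB0 u : `|@ramp R u| <= B by have [] := hB u.
have hB1 u : `|@ramp' R u| <= B by have [] := hB u.
have [S S0 hS] := @step'_bounded R.
exists (8 * A1 * B + 16 * A2 * S * B) => [|s t w m c w0 st c0].
  by rewrite addr_ge0// !mulr_ge0.
have Cphi : Cinfty phi by case: tphi.
pose P1 := rescale (@ramp' R) m c.
have CP1 : Cinfty P1 by exact/Cinfty_rescale/Cinfty_ramp'.
pose P0 y := c * rescale (@ramp R) m c y.
have CP0 : Cinfty P0.
  by apply: CinftyM; [exact: Cinfty_cst|exact/Cinfty_rescale/Cinfty_ramp].
have dP0 : derive1 P0 = P1.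
  apply/funext => y; rewrite /P0 derive1E.
  have Cr : Cinfty (rescale (@ramp R) m c) by exact/Cinfty_rescale/Cinfty_ramp.
  rewrite (@deriveMl _ _ _ c y 1); last exact: Cinfty_derivable.
  rewrite -derive1E derive1_rescale ?derive1_ramp; last exact: Cinfty_ramp.
  by rewrite mulrA divff ?mul1r// gt_eqF.
have P1s y : ~ `[m - 4 * c, m + 4 * c]%classic y -> P1 y = 0.
  by apply: rescale_supp => // u; exact: ramp'0.
have P0s y : ~ `[m - 4 * c, m + 4 * c]%classic y -> P0 y = 0.
  by move=> yN; rewrite /P0 (rescale_supp c0 (@ramp0 R) yN) mulr0.
have hP0 y : `|P0 y| <= c * B.
  rewrite /P0 normrM gtr0_norm//; apply: ler_wpM2l; [exact: ltW|exact: hB0].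
have m4 : m - 4 * c <= m + 4 * c by lra.
have stw : s <= t + w by lra.
have [t1 b1] := le_Rintegral_box tame1 hA1 (Cinfty_window s t w) CP1
  (window_bound s t w) (fun y => hB1 _) (fun x => window_supp w0 st (x := x)) P1s stw m4.
(* The x-derivative k of one side of the window has size 1 / w on a strip of
   width w, so a direct bound would only give O(c). As the factor P1 is the
   y-derivative of P0 = O(c), the hypothesis on the vertical defect moves the
   derivative from P0 to the other factors, which gains one power of c. *)
have layer r : tame (fun z => F z * (derive1 (rescale step r w) z.1 * P1 z.2)) /\
    `|\int[mu]_z (F z * (derive1 (rescale step r w) z.1 * P1 z.2))| <= 8 * A2 * S * B * c ^+ 2.
  pose k := derive1 (rescale (@step R) r w).
  have Ck : Cinfty k by exact/Cinfty_derive1/Cinfty_rescale/Cinfty_step.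
  have kE x : k x = w^-1 * rescale step' r w x.
    by rewrite /k derive1_rescale ?derive1_step//; exact: Cinfty_step.
  have hk x : `|k x| <= w^-1 * S.
    rewrite kE normrM gtr0_norm ?invr_gt0//.
    by apply: ler_wpM2l; [rewrite invr_ge0 ltW|exact: hS].
  have ks x : ~ `[r, r + w]%classic x -> k x = 0.
    move=> xN; rewrite kE; suff -> : rescale step' r w x = 0 by rewrite mulr0.
    move: xN; rewrite /= in_itv/= => /negP; rewrite negb_and -!ltNge => /orP[xr|rx].
      by apply: step'0; rewrite -mulrBr pmulr_rlt0 ?invr_gt0// subr_lt0.
    by apply: step'1; rewrite -mulrBr mulrC ltr_pdivlMr// mul1r; lra.
  have rw : r <= r + w by lra.
  have tF := tame_ccont ccF.
  have [tF1 _] := le_Rintegral_box tF hAF Ck CP1 hk (fun y => hB1 _) ks P1s rw m4.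
  have [tF2 bF2] := le_Rintegral_box tame2 hA2 Ck CP0 hk hP0 ks P0s rw m4.
  split => //.
  have ttheta : tfun (fun z => phi z * (k z.1 * P0 z.2)).
    by apply: tfunM => //; exact: Cinfty_box.
  have := H2 _ ttheta.
  rewrite (_ : defect _ _ _ _ = \int[mu]_z (a2 z * (k z.1 * P0 z.2)) +
     \int[mu]_z (F z * (k z.1 * P1 z.2))); last first.
    rewrite -(tame_RintegralD tF2 tF1).
    apply: eq_Rintegral => z _; rewrite (derive_box (0, 1) z Cphi Ck CP0) dP0 /F /=.
    ring.
  move=> /eqP; rewrite addrC addr_eq0 => /eqP ->; rewrite normrN.
  apply: le_trans bF2 _.
  have w1w : w^-1 * w = 1 by rewrite mulVf// gt_eqF.
  rewrite (_ : _ * _ = 8 * A2 * S * B * c ^+ 2 * (w^-1 * w)); last by ring.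
  by rewrite w1w mulr1.
have [ts bs] := layer s.
have [tt bt] := layer t.
have dW x : derive1 (window s t w) x =
    derive1 (rescale step s w) x - derive1 (rescale step t w) x.
  rewrite !derive1E -deriveB//; apply: Cinfty_derivable; exact/Cinfty_rescale/Cinfty_step.
rewrite (_ : defect _ _ _ _ = \int[mu]_z (a1 z * (window s t w z.1 * P1 z.2)) +
   (\int[mu]_z (F z * (derive1 (rescale step s w) z.1 * P1 z.2)) -
    \int[mu]_z (F z * (derive1 (rescale step t w) z.1 * P1 z.2)))); last first.
  rewrite -(tame_RintegralB ts tt) -(tame_RintegralD t1 (tameB ts tt)).
  apply: eq_Rintegral => z _; rewrite (derive_box (1, 0) z Cphi (Cinfty_window s t w) CP1).
  by rewrite dW -/P1 /F /=; ring.
rewrite (le_trans (ler_normD _ _))//.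
rewrite (le_trans (lerD b1 (ler_normB _ _)))//.
rewrite (le_trans (lerD (lexx _) (lerD bs bt)))//.
rewrite -subr_ge0 (_ : _ - _ = 8 * A1 * B * c ^+ 2 + 16 * A2 * S * B * (c * (t + w - s))); last by ring.
have tws : 0 <= t + w - s by rewrite subr_ge0.
have c0' := ltW c0.
clear -A1_ge0 A2_ge0 B0 S0 c0' tws.
by rewrite addr_ge0 ?mulr_ge0 ?sqr_ge0.
Qed.

End PieceEstimates.

(** * A cheap cover of a graph makes the defect vanish *)

Section Vanishing.
Context {R : realType}.
Local Notation mu := (plane_measure R).
Local Notation plane := (measurableTypeR R * measurableTypeR R)%type.
Implicit Types (f g phi : R * R -> R) (b : R -> R) (x y w m s : R).

Lemma norm_pair_lt x y (r : R) : `|x| < r -> `|y| < r -> `|(x, y)| < r.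
Proof. by move=> xr yr; rewrite /Num.norm/= gt_max xr. Qed.

Definition graph01 b : set (R * R) := [set (t, b t) | t in `[0, 1]].

(** The uniform width makes such a phi a test function of the complement of K
    ([off_test_function]). *)
Definition off (K : set (R * R)) phi :=
  exists2 r : R, 0 < r & forall k z, K k -> `|k - z| < r -> phi z = 0.

(** The cover goes beyond the abscissa 1, so that the last window still equals
    1 above a neighbourhood of the graph ([piece_partition]). *)
Definition covers b n (t c : nat -> R) :=
  [/\ t 0%N = 0, forall j, (j < n)%N -> t j <= t j.+1, 1 < t n <= 3,
   forall j, (j < n)%N -> 0 < c j &
   forall j u, (j < n)%N -> t j <= u <= t j.+1 -> `|b u - b (t j)| <= c j].

(** The quantity to make small is the sum of the squared heights; a box of
    height c and basis c^2 has a cost equal to its basis, which is why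
    Brownian scaling is the critical case. *)
Definition cheap b := forall e : R, 0 < e -> exists n t c, covers b n t c /\
  \sum_(0 <= j < n) c j ^+ 2 <= e.

(** The cutoff of the box j. The windows are shifted to the left by 2 * w so
    that the first one equals 1 from the abscissa - w on, that is, on a
    neighbourhood of the graph. *)
Definition piece b (t c : nat -> R) w j (z : R * R) : R :=
  window (t j - 2 * w) (t j.+1 - 2 * w) w z.1 * rescale ramp' (b (t j)) (c j) z.2.

Lemma Cinfty_piece b t c w j : Cinfty (piece b t c w j).
Proof.
apply: Cinfty_box; first exact: Cinfty_window.
exact/Cinfty_rescale/Cinfty_ramp'.
Qed.

Lemma covers_range b n t c j : covers b n t c -> (j <= n)%N -> 0 <= t j <= 3.
Proof.
move=> [t0 tS /andP[_ tn3] _ _] jn.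
have mono i k : (i <= k <= n)%N -> t i <= t k.
  elim: k => [|k IH]; first by rewrite leqn0 => /andP[/eqP ->].
  rewrite leq_eqVlt ltnS => /andP[/predU1P[->//|ik] kn].
  by rewrite (le_trans (IH _)) ?ik ?tS// ltnW.
by rewrite -{1}t0 mono// (le_trans (mono j n _))// jn leqnn.
Qed.

Lemma pos_lower_bound n (c : nat -> R) : (forall j, (j < n)%N -> 0 < c j) ->
  exists2 r : R, 0 < r & forall j, (j < n)%N -> r <= c j.
Proof.
elim: n => [|n IH] c0; first by exists 1.
have [|r r0 rc] := IH; first by move=> j jn; apply: c0; exact: ltnW.
exists (Num.min r (c n)); first by rewrite lt_min r0 c0.
move=> j; rewrite ltnS leq_eqVlt ge_min => /predU1P[->|jn]; first by rewrite lexx orbT.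
by rewrite rc.
Qed.

(** The windows telescope to 1 above the graph, and the vertical factor of an
    active piece is 1 near the graph since the plateau of radius 3 * c j
    leaves room around the bound c j. *)
Lemma piece_partition b n t c : continuous b -> covers b n t c ->
  exists2 w1 : R, 0 < w1 & forall w, 0 < w -> w <= w1 -> exists2 r : R, 0 < r &
    forall k z, graph01 b k -> `|k - z| < r ->
      \sum_(0 <= j < n) piece b t c w j z = 1.
Proof.
move=> cb cov; have [t0 tS /andP[tn1 tn3] c0 bc] := cov.
have [cm cm0 cmc] := pos_lower_bound c0.
have [d d0 db] := Heine_compact (@segment_compact R 0 3) (fun x _ => cb x) cm0.
exists (Num.min (d / 3) ((t n - 1) / 3)).
  by rewrite lt_min !divr_gt0 ?subr_gt0.
move=> w w0; rewrite le_min => /andP[wd wt].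
exists (Num.min w cm); first by rewrite lt_min w0.
move=> _ [x y] [s /= s01 <-].
rewrite in_itv/= in s01; have /andP[s0 s1] := s01.
rewrite /Num.norm/= gt_max !lt_min => /andP[/andP[sw _] /andP[_ bcm]].
have {}sw : `|s - x| < w by [].
have {}bcm : `|b s - y| < cm by [].
move: sw; rewrite ltr_norml => /andP[sw1 sw2].
(* Near the graph the vertical factor of each active piece is identically 1, so
   the sum of the pieces telescopes. *)
transitivity (\sum_(0 <= j < n) window (t j - 2 * w) (t j.+1 - 2 * w) w x).
  apply: eq_big_nat => j /andP[_ jn]; rewrite /piece/=.
  have tj := tS j jn.
  have [xin|xout] := pselect (`[t j - 2 * w, t j.+1 - 2 * w + w]%classic x); last first.
    by rewrite window_supp ?mul0r//; lra.
  rewrite [rescale _ _ _ _](_ : _ = 1) ?mulr1//.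
  have cj := c0 j jn.
  rewrite /rescale ramp'1// rescale_arg// ltr_pdivrMr//.
  suff bs : `|b s - b (t j)| <= c j.
    have cmj := cmc j jn.
    rewrite (_ : y - b (t j) = (b s - b (t j)) - (b s - y)); last by ring.
    rewrite (le_lt_trans (ler_normB _ _))//.
    rewrite (_ : 3 * c j = c j + 2 * c j); last by ring.
    by rewrite ler_ltD// (lt_le_trans bcm)// (le_trans cmj)// ler_peMl ?ler1n// ltW.
  move: xin; rewrite /= in_itv/= => /andP[x1 x2].
  have [ts|st] := leP (t j) s.
    by apply: bc => //; rewrite ts/=; lra.
  rewrite distrC ltW// (lt_le_trans _ (cmc j jn))//; apply: db.
    by rewrite /= in_itv/=; apply: (covers_range cov); exact: ltnW.
  rewrite gtr0_norm ?subr_gt0//.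
  have : 3 * w <= d by rewrite mulrC -ler_pdivlMr.
  lra.
rewrite (_ : \sum_(_ <= _ < _) _ = - (\sum_(0 <= j < n)
    (rescale step (t j.+1 - 2 * w) w x - rescale step (t j - 2 * w) w x))); last first.
  rewrite -sumrN; apply: eq_bigr => j _; by rewrite opprB.
rewrite (telescope_sumr (fun j => rescale step (t j - 2 * w) w x))// opprB.
rewrite rescale_step1// ?rescale_step0 ?subr0//; last by rewrite t0; lra.
by move: wt; rewrite ler_pdivlMr//; lra.
Qed.

(** phi minus the sum of its pieces vanishes near the graph, so it does not
    contribute to the defect. *)
Lemma defect_pieces v f g phi b n t c : continuous f -> bounded_measurable g ->
  tfun phi -> continuous b -> covers b n t c ->
  (forall psi, tfun psi -> off (graph01 b) psi -> defect v f g psi = 0) ->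
  exists2 w1 : R, 0 < w1 & forall w, 0 < w -> w <= w1 ->
  defect v f g phi = \sum_(0 <= j < n) defect v f g (fun z => phi z * piece b t c w j z).
Proof.
move=> cf bg tphi cb cov H; have [w1 w10 wP] := piece_partition cb cov.
exists w1 => // w w0 ww1.
have tpj j : tfun (fun z => phi z * piece b t c w j z).
  by apply: tfunM => //; exact: Cinfty_piece.
have [ts <-] := defect_sum v n cf bg tpj.
pose eta z := \sum_(0 <= j < n) piece b t c w j z.
have Ceta : Cinfty eta by apply: Cinfty_sum => j; exact: Cinfty_piece.
have C1 : Cinfty (fun z => 1 + (-1) * eta z).
  by apply: CinftyD; [exact: Cinfty_cst|apply: CinftyM => //; exact: Cinfty_cst].
pose psi z := phi z * (1 + (-1) * eta z).
have tpsi : tfun psi by exact: tfunM.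
have /H dpsi : tfun psi by [].
have {}dpsi : defect v f g psi = 0.
  apply: dpsi; have [r r0 rP] := wP w w0 ww1; exists r => // k z Kk kz.
  by rewrite /psi /eta (rP k z Kk kz); ring.
have := defectD v cf bg ts tpsi; rewrite dpsi addr0 => <-; congr (defect v f g).
by apply/funext => z; rewrite -mulr_sumr -/(eta z) /psi; ring.
Qed.

Lemma sum_sq_max n (c : nat -> R) e j : (j < n)%N ->
  \sum_(0 <= j < n) c j ^+ 2 <= e ^+ 2 -> 0 <= e -> 0 <= c j -> c j <= e.
Proof.
move=> jn ce e0 cj0; rewrite -(@ler_pXn2r _ 2)//.
apply: le_trans ce; rewrite (big_cat_nat _ (n := j))//=; last exact: ltnW.
rewrite [X in _ + X]big_ltn// addrCA lerDl addr_ge0// sumr_ge0// => i _; exact: sqr_ge0.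
Qed.

Lemma eq0_of_small_norm (x : R) : (forall e : R, 0 < e -> e <= 1 -> `|x| <= e) -> x = 0.
Proof.
move=> h; apply/eqP; rewrite -normr_le0; apply/ler_addgt0Pr => e e0; rewrite add0r.
have [e1|/ltW e1] := leP e 1; first exact: h.
by rewrite (le_trans (h 1 _ _)).
Qed.

(** Summing [vertical_piece] over a cover whose boxes are all flatter than the
    modulus of continuity of f * phi: the total is O(e) times the total width,
    which is at most 4. *)
Lemma vertical_defect0 f g b : continuous f -> bounded_measurable g ->
  continuous b -> cheap b ->
  (forall psi, tfun psi -> off (graph01 b) psi -> defect (0, 1) f g psi = 0) ->
  forall phi, tfun phi -> defect (0, 1) f g phi = 0.
Proof.
move=> cf bg cb chb H phi tphi; apply: eq0_of_small_norm => e e0 e1.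
have [C C0 CP] := vertical_piece cf bg tphi.
have C1 : 0 < C + 1 by lra.
pose e' := e / (8 * (C + 1)).
have e'0 : 0 < e' by rewrite divr_gt0// mulr_gt0.
have ccF : ccont (fun z => f z * phi z) by apply: ccontM => //; exact: tfun_ccont.
have [d d0 dP] : exists2 d : R, 0 < d & forall x y y', `|y - y'| < d ->
    `|f (x, y) * phi (x, y) - f (x, y') * phi (x, y')| <= e'.
  have [cF [r F0]] := ccF.
  have [d d0 dP] := Heine_compact (@compact_square R (`|r| + 1)) (fun z _ => cF z) e'0.
  exists (Num.min d 1); first by rewrite lt_min d0/=.
  have key x y y' : `|y - y'| < Num.min d 1 -> `|(x, y)| <= `|r| + 1 ->
      `|f (x, y) * phi (x, y) - f (x, y') * phi (x, y')| <= e'.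
    rewrite lt_min => /andP[yd _] xyr; apply/ltW/dP; first exact: le_norm_square.
    rewrite (_ : (x, y) - (x, y') = (x - x, y - y'))// subrr.
    by apply: norm_pair_lt; rewrite ?normr0.
  move=> x y y' yy'; have [xy|xy] := leP `|(x, y)| (`|r| + 1); first exact: key.
  have [xy'|xy'] := leP `|(x, y')| (`|r| + 1).
    by rewrite distrC key// distrC.
  have rr : r < `|r| + 1 by rewrite (le_lt_trans (ler_norm r))// ltrDl.
  by rewrite !F0 ?subrr ?normr0 ?(ltW e'0)//; [exact: lt_trans xy'|exact: lt_trans xy].
(* The box j has half-height 4 * c j; d / 5 makes it fall below the modulus d. *)
pose e'' := Num.min e' (d / 5).
have e''0 : 0 < e'' by rewrite lt_min e'0 divr_gt0.
have [|n [t [c [cov sc]]]] := chb (e'' ^+ 2); first by rewrite exprn_gt0.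
have [t0 tS /andP[tn1 tn3] c0 bc] := cov.
have [w1 w10 wP] := defect_pieces cf bg tphi cb cov H.
(* The n windows overlap on strips of width w; n * w <= 1 keeps their total
   width below 3 + 1. *)
pose w := Num.min w1 (n.+1%:R^-1).
have w0 : 0 < w by rewrite lt_min w10 invr_gt0 ltr0n.
have nw : n%:R * w <= 1.
  rewrite (@le_trans _ _ (n%:R * n.+1%:R^-1))//.
    by rewrite ler_wpM2l// ge_min lexx orbT.
  by rewrite ler_pdivrMr ?ltr0n// mul1r ler_nat.
rewrite (wP w w0); last by rewrite ge_min lexx.
rewrite (le_trans (ler_norm_sum _ _ _))//.
apply: (@le_trans _ _ (\sum_(0 <= j < n) (C * (e' + e')) * (t j.+1 - t j + w))).
  rewrite big_nat [leRHS]big_nat; apply: ler_sum => j /andP[_ jn].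
  have ce : c j <= e'' by apply: sum_sq_max sc _ _ => //; apply/ltW => //; exact: c0.
  have := ce; rewrite le_min => /andP[ce' ced].
  have tj := tS j jn.
  have := CP (window (t j - 2 * w) (t j.+1 - 2 * w) w) (t j - 2 * w) (t j.+1 - 2 * w + w)
    (b (t j)) (c j) e' (Cinfty_window _ _ _) (window_bound _ _ _).
  move=> /(_ (fun x => window_supp w0 _ (x := x))) key.
  apply: le_trans (key _ _ (c0 j jn) (ltW e'0) _) _; [lra|lra| |].
    move=> x y ym; apply: dP; apply: le_lt_trans ym _.
    by move: ced; rewrite ler_pdivlMr//; have := c0 j jn; lra.
  rewrite (_ : t j.+1 - 2 * w + w - (t j - 2 * w) = t j.+1 - t j + w); last by ring.
  by rewrite ler_wpM2r ?ler_wpM2l ?lerD2r//; lra.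
rewrite -mulr_sumr big_split/= telescope_sumr// big_const_nat iter_addr addr0 subn0 t0 subr0.
rewrite -[w *+ n]mulr_natl.
apply: (@le_trans _ _ (C * (e' + e') * 4)).
  by rewrite ler_wpM2l ?mulr_ge0//; lra.
rewrite (_ : C * (e' + e') * 4 = 8 * C * e'); last by ring.
rewrite /e' mulrA ler_pdivrMr; last by rewrite mulr_gt0.
by rewrite mulrC ler_wpM2l ?(ltW e0)//; lra.
Qed.

(** Summing [horizontal_piece], the terms c j ^+ 2 add up to the cost of the
    cover; this is the place where covers of small cost are indispensable. *)
Lemma horizontal_defect0 f g1 g2 b : continuous f ->
  bounded_measurable g1 -> bounded_measurable g2 ->
  continuous b -> cheap b ->
  (forall phi, tfun phi -> defect (0, 1) f g2 phi = 0) ->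
  (forall psi, tfun psi -> off (graph01 b) psi -> defect (1, 0) f g1 psi = 0) ->
  forall phi, tfun phi -> defect (1, 0) f g1 phi = 0.
Proof.
move=> cf bg1 bg2 cb chb H2 H phi tphi; apply: eq0_of_small_norm => e e0 e1.
have [C C0 CP] := horizontal_piece cf bg1 bg2 tphi H2.
have C1 : 0 < C + 1 by lra.
pose e' := e / (5 * (C + 1)).
have e'0 : 0 < e' by rewrite divr_gt0// mulr_gt0.
have e'1 : e' <= 1.
  by rewrite ler_pdivrMr ?mulr_gt0// mul1r; lra.
have [|n [t [c [cov sc]]]] := chb (e' ^+ 2); first by rewrite exprn_gt0.
have [t0 tS /andP[tn1 tn3] c0 bc] := cov.
have [w1 w10 wP] := defect_pieces cf bg1 tphi cb cov H.
pose w := Num.min w1 (n.+1%:R^-1).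
have w0 : 0 < w by rewrite lt_min w10 invr_gt0 ltr0n.
have nw : n%:R * w <= 1.
  rewrite (@le_trans _ _ (n%:R * n.+1%:R^-1))//.
    by rewrite ler_wpM2l// ge_min lexx orbT.
  by rewrite ler_pdivrMr ?ltr0n// mul1r ler_nat.
rewrite (wP w w0); last by rewrite ge_min lexx.
rewrite (le_trans (ler_norm_sum _ _ _))//.
apply: (@le_trans _ _ (\sum_(0 <= j < n) C * (e' * (t j.+1 - t j + w) + c j ^+ 2))).
  rewrite big_nat [leRHS]big_nat; apply: ler_sum => j /andP[_ jn].
  have cj := c0 j jn.
  have ce : c j <= e' by apply: sum_sq_max sc _ _ => //; apply/ltW.
  have tj := tS j jn.
  have := CP (t j - 2 * w) (t j.+1 - 2 * w) w (b (t j)) (c j) w0 _ cj.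
  move=> /(_ _)/le_trans; apply; first lra.
  rewrite (_ : t j.+1 - 2 * w + w - (t j - 2 * w) = t j.+1 - t j + w); last by ring.
  by rewrite ler_wpM2l// lerD2r ler_wpM2r//; lra.
rewrite -mulr_sumr big_split/= -mulr_sumr big_split/=.
rewrite telescope_sumr// big_const_nat iter_addr addr0 subn0 t0 subr0.
rewrite -[w *+ n]mulr_natl.
apply: (@le_trans _ _ (C * (e' * 4 + e'))).
  apply: ler_wpM2l => //; apply: lerD.
    by apply: ler_wpM2l; [exact: ltW|lra].
  by rewrite (le_trans sc)// expr2 ger_pMr.
rewrite (_ : C * (e' * 4 + e') = 5 * C * e'); last by ring.
rewrite /e' mulrA ler_pdivrMr; last by rewrite mulr_gt0.
by rewrite mulrC ler_wpM2l ?(ltW e0)//; lra.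
Qed.

End Vanishing.

(** * Removability of cheaply covered graphs *)

Section Removability.
Context {R : realType}.
Local Notation mu := (plane_measure R).
Local Notation plane := (measurableTypeR R * measurableTypeR R)%type.
Implicit Types (f g phi : R * R -> R) (b : R -> R) (D K : set (R * R)).

Lemma plane_measure_setT_gt0 : (0 < mu setT)%E.
Proof.
have m1 := @measurable_rect R 0 1 0 1.
apply: (@lt_le_trans _ _ (mu (rect 0 1 0 1))).
  by rewrite [X in (_ < X)%E]measure_rect// lte_fin subr0 mulr1.
by apply: le_measure => //; rewrite inE.
Qed.

(** The norm is 0 by definition when the total mass is 0, a case excluded by
    the positive measure of the plane. *)
Lemma finite_normP (h : plane -> R) :
  finite_norm mu +oo h <-> exists M : R, {ae mu, forall z, `|h z| <= M}.
Proof.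
rewrite /finite_norm unlock /Lnorm plane_measure_setT_gt0; split.
  move=> hoo; have [M hM] : exists M : R, (ess_sup mu (abse \o (EFin \o h)) <= M%:E)%E.
    case: (ess_sup _ _) hoo => // [r _|_]; first by exists r.
    by exists 0; rewrite leNye.
  exists M; move/ess_supP : hM; apply: filterS => z /=.
  by rewrite lee_fin.
move=> [M hM]; apply: (@le_lt_trans _ _ M%:E); last by rewrite ltry.
by apply/ess_supP; apply: filterS hM => z /=; rewrite lee_fin.
Qed.

(** Truncation at the essential bound turns g, extended by 0 outside D, into
    an everywhere bounded function. *)
Lemma Linfty_rep D g : measurable (D : set plane) -> Linfty D g ->
  exists g', bounded_measurable g' /\ {ae mu, forall z, (g \_ D) z = g' z}.
Proof.
move=> mD [mg /finite_normP[M hM]].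
pose h : plane -> R := g \_ D.
have mh : measurable_fun (setT : set plane) h.
  by apply/(measurable_restrictT _ _).1.
exists (fun z => Num.max (- `|M|) (Num.min `|M| (h z))); split.
  split.
    by apply: measurable_maxr => //; apply: measurable_minr.
  exists `|M| => z; rewrite ler_norml le_max lexx /= ge_max ge_min lexx andbT.
  by rewrite ge0_cp.
apply: filterS hM => z hz; have {}hz : `|h z| <= `|M| by rewrite (le_trans hz)// ler_norm.
move: hz; rewrite ler_norml => /andP[h1 h2].
by rewrite (min_idPr h2) (max_idPr h1).
Qed.

Lemma bounded_Linfty g : bounded_measurable g -> Linfty setT g.
Proof.
move=> [mg [M gM]]; split; first exact/measurable_plane.
by apply/finite_normP; exists M; apply: aeW => z; rewrite patchE in_setT.
Qed.

Lemma off_test_function K phi : tfun phi -> off K phi -> test_function (setT `\` K) phi.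
Proof.
move=> [Cphi [r phi0]] [e e0 He]; split; first exact/smooth_Cinfty.
  apply: (subclosed_compact (@closed_closure _ _) (@compact_square R r)).
  have cl : closed ((`[-r, r]%classic `*` `[-r, r]%classic) : set (R * R)).
    by apply: compact_closed; [exact: norm_hausdorff|exact: compact_square].
  rewrite [X in _ `<=` X](_ : _ = closure (`[-r, r]%classic `*` `[-r, r]%classic)); last first.
    exact: (closure_id _).1 cl.
  apply: closureS => z /= /eqP pz.
  by apply: le_norm_square; rewrite leNgt; apply/negP => /phi0.
move=> z cz; split => // Kz.
have [y [/= /eqP py yz]] := cz _ (nbhsx_ballx z e e0).
by apply: py; apply: (He z) => //; move: yz; rewrite -ball_normE.
Qed.

Lemma test_function_tfun D phi : test_function D phi -> tfun phi.
Proof.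
move=> [/smooth_Cinfty Cphi /compact_bounded[M [_ MP]] _]; split => //.
exists (`|M| + 1) => z zM; apply/eqP; apply/negPn/negP => pz.
have : `|z| <= `|M| + 1.
  by apply: (MP (`|M| + 1)); [rewrite (le_lt_trans (ler_norm M))// ltrDl|exact: subset_closure].
by rewrite leNgt zM.
Qed.

Lemma ae_Rintegral (u k : plane -> R) : measurable_fun (setT : set plane) u ->
  measurable_fun (setT : set plane) k ->
  {ae mu, forall z, u z = k z} -> \int[mu]_z u z = \int[mu]_z k z.
Proof.
move=> mu_ mk uk; rewrite /Rintegral; congr fine; apply: ae_eq_integral => //.
- exact/measurable_EFinP.
- exact/measurable_EFinP.
- by apply: filterS uk => z uk _; rewrite uk.
Qed.

(** Since phi and its derivatives vanish on K, the two integrals over the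
    complement of K in the definition of a weak derivative are integrals over
    the plane. *)
Lemma defect_off K v f g g' phi : continuous f -> bounded_measurable g' ->
  measurable (K : set plane) ->
  {ae mu, forall z, (g \_ (setT `\` K)) z = g' z} ->
  measurable_fun (setT : set plane) (g \_ (setT `\` K)) ->
  weak_derivative (setT `\` K) v f g ->
  tfun phi -> off K phi -> defect v f g' phi = 0.
Proof.
move=> cf bg' mK gg' mg wd tphi offphi.
have tf1 : tame (fun z => f z * 'D_v phi z).
  by apply/tame_ccont/ccontM => //; exact: tfun_derive_ccont.
have tf2 : tame (fun z => g' z * phi z).
  by apply: tameM; [case: bg'|case: bg'|exact/tame_ccont/tfun_ccont].
rewrite /defect tame_RintegralD//.
have := wd _ (off_test_function tphi offphi).
have -> : \int[mu]_(z in setT `\` K) (f z * 'D_v phi z) = \int[mu]_z (f z * 'D_v phi z).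
  rewrite Rintegral_mkcond; apply: eq_Rintegral => z _; rewrite patchE.
  case: ifPn => //; rewrite notin_setE => zK.
  have Kz : K z by apply: contrapT => nK; apply: zK.
  rewrite near_eq0_derive ?mulr0//.
  have [r r0 rP] := offphi.
  by apply/nbhs_ballP; exists r => // y; rewrite -ball_normE; exact: rP.
have -> : \int[mu]_(z in setT `\` K) (g z * phi z) = \int[mu]_z (g' z * phi z).
  rewrite Rintegral_mkcond; transitivity (\int[mu]_z ((g \_ (setT `\` K)) z * phi z)).
    apply: eq_Rintegral => z _; rewrite !patchE; case: ifPn => // _.
    by rewrite mul0r.
  apply: ae_Rintegral.
  - apply: measurable_funM => //.
    by have /tfun_ccont/tame_ccont[] := tphi.
  - by case: tf2.
  - by apply: (@filterS _ _ (ae_filter_ringOfSetsType mu) _ _ _ gg') => z ->.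
by move=> ->; rewrite addNr.
Qed.

Lemma weak_derivative_of_defect v f g : continuous f -> bounded_measurable g ->
  (forall phi, tfun phi -> defect v f g phi = 0) -> weak_derivative setT v f g.
Proof.
move=> cf bg H phi /test_function_tfun tphi.
have tf1 : tame (fun z => f z * 'D_v phi z).
  by apply/tame_ccont/ccontM => //; exact: tfun_derive_ccont.
have tf2 : tame (fun z => g z * phi z).
  by apply: tameM; [case: bg|case: bg|exact/tame_ccont/tfun_ccont].
have := H _ tphi; rewrite /defect tame_RintegralD// => /eqP.
by rewrite addr_eq0 => /eqP.
Qed.

Lemma compact_graph01 b : continuous b -> compact (graph01 b).
Proof.
move=> cb; rewrite /graph01.
apply: continuous_compact; last exact: segment_compact.
apply: continuous_subspaceT => x.
by apply: (@cvg_pair _ _ _ (nbhs x) (nbhs x) (nbhs (b x)) _ _ _ id b); [exact: cvg_id|exact: cb].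
Qed.

Lemma measurable_graph01 b : continuous b -> measurable (graph01 b : set plane).
Proof.
move=> cb; rewrite -[X in measurable X]setCK; apply: measurableC.
apply: open_measurable_plane; rewrite openC.
by apply: compact_closed; [exact: norm_hausdorff|exact: compact_graph01].
Qed.

(** By Fubini, since vertical sections of a graph have at most one point. *)
Lemma measure_graph01 b : continuous b -> mu (graph01 b : set plane) = 0%E.
Proof.
move=> cb; rewrite /product_measure1/=.
apply: integral0_eq => x _ /=.
apply/eqP; rewrite -measure_le0.
apply: (@le_trans _ _ (@lebesgue_measure R [set b x])); last by rewrite lebesgue_measure_set1.
apply: le_measure; rewrite ?inE.
- exact: measurable_xsection (measurable_graph01 cb).
- exact: measurable_set1.
by move=> y; rewrite /xsection/= inE => -[t _ [<- <-]].
Qed.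

(** The weak derivatives of f off the graph, extended by 0 across it, are weak
    derivatives of f in the whole plane, as their defects vanish in both
    directions. *)
Theorem removable_of_cheap b : continuous b -> cheap b -> W1infty_removable (graph01 b).
Proof.
move=> cb chb; split => //; first exact: compact_graph01.
move=> f cf0; have cf : continuous f := (continuous_subspace_setT f).2 cf0.
move=> [[mf Nf] [g1 Lg1 wd1] [g2 Lg2 wd2]].
have mK := measurable_graph01 cb.
have mD : measurable ((setT `\` graph01 b) : set plane) by exact: measurableD.
have [h1 [bh1 gh1]] := Linfty_rep mD Lg1.
have [h2 [bh2 gh2]] := Linfty_rep mD Lg2.
have mres g : Linfty (setT `\` graph01 b) g ->
    measurable_fun (setT : set plane) (g \_ (setT `\` graph01 b)).
  by move=> [mg _]; apply/(measurable_restrictT _ _).1.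
have off1 psi := @defect_off _ _ _ _ _ psi cf bh1 mK gh1 (mres _ Lg1) wd1.
have off2 psi := @defect_off _ _ _ _ _ psi cf bh2 mK gh2 (mres _ Lg2) wd2.
have D2 := vertical_defect0 cf bh2 cb chb off2.
have D1 := horizontal_defect0 cf bh1 bh2 cb chb D2 off1.
split.
- split; first by have := continuous_measurable_plane cf.
  move/finite_normP : Nf => [M NM]; apply/finite_normP; exists M.
  have nK : {ae mu, forall z, ~ graph01 b z}.
    exists (graph01 b); split => //; first exact: measure_graph01.
    by move=> z /= /contrapT.
  apply: (@filterS2 _ _ (ae_filter_ringOfSetsType mu) _ _ _ _ nK NM) => z nKz; rewrite !patchE in_setT ifT//.
  by rewrite inE.
- by exists h1; [exact: bounded_Linfty|exact: weak_derivative_of_defect].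
- by exists h2; [exact: bounded_Linfty|exact: weak_derivative_of_defect].
Qed.

End Removability.

(** * Centred Gaussian laws *)

Section NormalFacts.
Context {R : realType}.
Local Notation mu := (@lebesgue_measure R).

(** The Radon-Nikodym derivative of the Gaussian law is its density almost
    everywhere. *)
Lemma ge0_integral_normal_prob (m s : R) (f : R -> \bar R) :
  measurable_fun (setT : set (measurableTypeR R)) f -> (forall x, 0 <= f x)%E ->
  (\int[normal_prob m s]_x f x = \int[mu]_x (f x * (normal_pdf m s x)%:E))%E.
Proof.
move=> mf f0.
have dom := @normal_prob_dominates R m s.
have := @Radon_Nikodym_SigmaFinite.change_of_variables _ _ R
  (normal_prob m s) mu dom f setT f0 measurableT mf.
move=> <-; apply: ae_eq_integral => //.
- apply: emeasurable_funM => //.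
  exact: measurable_int (Radon_Nikodym_SigmaFinite.f_integrable dom).
- apply: emeasurable_funM => //.
  exact: measurable_int (integrable_normal_pdf m s).
have : ae_eq mu setT (Radon_Nikodym_SigmaFinite.f (normal_prob m s) mu)
   (fun x => (normal_pdf m s x)%:E).
  apply: integral_ae_eq => //.
  - exact: Radon_Nikodym_SigmaFinite.f_integrable.
  - exact: measurable_int (integrable_normal_pdf m s).
  by move=> E _ mE; rewrite -Radon_Nikodym_SigmaFinite.f_integral.
by apply: filterS => x + _ => ->.
Qed.

Lemma expR_ge_sqr (v : R) : 0 <= v -> v ^+ 2 <= expR (3 * v).
Proof.
move=> v0; have v30 : 0 <= 3 * v by lra.
have := @expR_ge1Dxn R (3 * v) 1 v30.
have -> : (2`!%:R : R) = 2 by [].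
move=> H; apply: le_trans H; have := sqr_ge0 v => H.
rewrite exprMn; lra.
Qed.

(** The fourth power is absorbed by doubling the standard deviation: with v =
    x^2 / (8 s^2) the claim reads v^2 <= exp (3 v). *)
Lemma normal_pdf_moment4 (s x : R) : 0 < s ->
  x ^+ 4 * normal_pdf 0 s x <= 128 * s ^+ 4 * normal_pdf 0 (2 * s) x.
Proof.
move=> s0; have sn0 : s != 0 by rewrite gt_eqF.
have s2n0 : 2 * s != 0 by rewrite mulf_neq0.
rewrite !normal_pdfE// /normal_fun subr0.
have pk : normal_peak s = 2 * normal_peak (2 * s).
  rewrite /normal_peak (_ : (2 * s) ^+ 2 * pi *+ 2 = 2 ^+ 2 * (s ^+ 2 * pi *+ 2)); last by ring.
  rewrite sqrtrM ?sqr_ge0//.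
  by rewrite sqrtr_sqr ger0_norm// invfM mulrA divff// mul1r.
have p0 : 0 <= normal_peak (2 * s) by exact: normal_peak_ge0.
pose v := x ^+ 2 / (8 * s ^+ 2).
have s20 : 0 < 8 * s ^+ 2 by rewrite mulr_gt0// exprn_gt0.
have v0 : 0 <= v by rewrite divr_ge0 ?sqr_ge0 ?ltW.
have -> : - x ^+ 2 / ((2 * s) ^+ 2 *+ 2) = - v by rewrite /v; field; rewrite sn0.
have -> : - x ^+ 2 / (s ^+ 2 *+ 2) = - v - 3 * v by rewrite /v; field; rewrite sn0.
have -> : x ^+ 4 = 64 * s ^+ 4 * v ^+ 2 by rewrite /v; field; rewrite sn0.
rewrite expRB pk.
have e30 : 0 < expR (3 * v) by exact: expR_gt0.
have e0 : 0 < expR (- v) by exact: expR_gt0.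
have key : v ^+ 2 / expR (3 * v) <= 1 by rewrite ler_pdivrMr// mul1r; exact: expR_ge_sqr.
have -> : 64 * s ^+ 4 * v ^+ 2 * (2 * normal_peak (2 * s) * (expR (- v) / expR (3 * v)))
   = 128 * s ^+ 4 * (normal_peak (2 * s) * expR (- v)) * (v ^+ 2 / expR (3 * v)) by ring.
apply: ler_piMr => //.
by rewrite !mulr_ge0 ?exprn_ge0 ?(ltW s0)// ltW.
Qed.

Lemma normal_prob_moment4 (s : R) : 0 < s ->
  (\int[normal_prob 0 s]_x (x ^+ 4)%:E <= (128 * s ^+ 4)%:E)%E.
Proof.
move=> s0.
have x40 (x : R) : 0 <= x ^+ 4 by rewrite (exprM x 2 2) sqr_ge0.
have mx4 : measurable_fun (setT : set (measurableTypeR R)) (fun x : R => x ^+ 4).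
  exact: exprn_measurable.
rewrite ge0_integral_normal_prob; last 2 first.
- exact/measurable_EFinP.
- by move=> x; rewrite lee_fin.
have mpdf t := measurable_int _ (integrable_normal_pdf (0 : R) t).
have c0 : 0 <= 128 * s ^+ 4 by rewrite mulr_ge0// exprn_ge0// ltW.
apply: (@le_trans _ _ (\int[mu]_x ((128 * s ^+ 4)%:E * (normal_pdf 0 (2 * s) x)%:E))%E).
  apply: ge0_le_integral => //.
  - by move=> x _; rewrite mule_ge0 ?lee_fin// normal_pdf_ge0.
  - apply: emeasurable_funM; first exact/measurable_EFinP.
    exact: mpdf.
  - apply: emeasurable_funM; first exact: measurable_cst.
    exact: mpdf.
  - by move=> x _; rewrite -!EFinM lee_fin; exact: normal_pdf_moment4.
rewrite ge0_integralZl//.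
- by rewrite integral_normal_pdf mule1.
- by move=> x _; rewrite lee_fin normal_pdf_ge0.
Qed.

Lemma normal_prob_half (s : R) : 0 < s ->
  normal_prob 0 s [set x | 0 <= x] = (2^-1)%:E.
Proof.
move=> s0; have sn0 : s != 0 by rewrite gt_eqF.
(* The total mass 1 is twice the mass of the half-line by symmetry. *)
have := integral_normal_pdf (0 : R) s.
rewrite ge0_symfun_integralT.
- rewrite /normal_prob; set I := (\int[_]_(_ in _) _)%E => h.
  have I0 : (0 <= I)%E by apply: integral_ge0 => x _; rewrite lee_fin normal_pdf_ge0.
  case: I I0 h => [r| |]//= r0.
    by rewrite -EFinM => -[h]; congr EFin; apply: (@mulfI _ 2) => //; rewrite h divff.
  by rewrite mulry gtr0_sg// mul1e.
- by move=> x; exact: normal_pdf_ge0.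
- exact: continuous_normal_pdf.
- by move=> x /=; rewrite !normal_pdfE// /normal_fun !subr0 sqrrN.
Qed.

End NormalFacts.

(** * Independence of successive blocks of variables *)

Section Independence.
Context {d : measure_display} {T : measurableType d} {R : realType}.
Variable P : probability T R.

(** The events independent of F form a Dynkin system. *)
Lemma dynkin_indep (F : set T) : measurable F ->
  lambda_system setT [set E | measurable E /\ P (E `&` F) = (P E * P F)%E].
Proof.
move=> mF; apply/dynkin_lambda_system; split.
- by split => //; rewrite setTI probability_setT mul1e.
- move=> E [mE EF]; split; first exact: measurableC.
  have PE : P E \is a fin_num by exact: fin_num_measure.
  have PF : P F \is a fin_num by exact: fin_num_measure.
  rewrite probability_setC// muleBl// mul1e.
  rewrite setIC -setDE measureD//; last by rewrite (le_lt_trans (probability_le1 _ _)) ?ltry.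
  by congr (_ - _)%E; rewrite setIC; exact: EF.
- move=> E tE mE; split; first by apply: bigcup_measurable => k _; case: (mE k).
  rewrite setI_bigcupl measure_bigcup//=; last 2 first.
  - by move=> k _; apply: measurableI => //; case: (mE k).
  - by apply: trivIset_setIr.
  rewrite measure_bigcup//=; last by move=> k _; case: (mE k).
  under eq_eseriesr => k _ do rewrite (mE k).2 muleC.
  have -> : P F = (fine (P F))%:E by rewrite fineK// fin_num_measure.
  by rewrite nneseriesZl// muleC.
Qed.

Variable X : nat -> T -> R.
Hypothesis mX : forall i, measurable_fun setT (X i).
Hypothesis indX : forall n, mutually_independent P (fun i : 'I_n => X i).

(** A pi-system that generates [block_sigma]. *)
Definition cylinder (a b : nat) : set (set T) := [set E | exists A : nat -> set R,
  (forall i, measurable (A i)) /\ E = [set w | forall i, (a <= i < b)%N -> A i (X i w)]].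

Definition block_sigma (a b : nat) : set (set T) := <<s cylinder a b >>.

Lemma cyl_setI a b : setI_closed (cylinder a b).
Proof.
move=> _ _ [A [mA ->]] [B [mB ->]]; exists (fun i => A i `&` B i); split.
  by move=> i; exact: measurableI.
apply/seteqP; split => w /=.
  by move=> [Aw Bw] i iab; split; [exact: Aw|exact: Bw].
by move=> ABw; split => i iab; have [] := ABw i iab.
Qed.

Lemma cyl_bigcap b (A : nat -> set R) :
  [set w | forall i, (i < b)%N -> A i (X i w)] =
  \bigcap_(i in [set: 'I_b]) (X i @^-1` A i).
Proof.
apply/seteqP; split=> w /=; first by move=> Aw i _; exact: Aw.
by move=> Aw i ib; exact: (Aw (Ordinal ib)).
Qed.

Lemma cyl_prob0 b (A : nat -> set R) : (forall i, measurable (A i)) ->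
  P [set w | forall i, (i < b)%N -> A i (X i w)] =
  (\prod_(0 <= i < b) P (X i @^-1` A i))%E.
Proof.
move=> mA; rewrite cyl_bigcap big_mkord.
exact: (@indX b (fun i => A i) (fun i => mA i)).
Qed.

Lemma cyl_prob a b (A : nat -> set R) : (forall i, measurable (A i)) -> (a <= b)%N ->
  P [set w | forall i, (a <= i < b)%N -> A i (X i w)] =
  (\prod_(a <= i < b) P (X i @^-1` A i))%E.
Proof.
move=> mA ab; pose A' i := if (a <= i)%N then A i else setT.
rewrite (_ : [set w | _] = [set w | forall i, (i < b)%N -> A' i (X i w)]); last first.
  apply/seteqP; split=> w /= Aw i.
    by rewrite /A'; case: ifPn => // ai ib; apply: Aw; rewrite ai.
  by move=> /andP[ai ib]; have := Aw i ib; rewrite /A' ai.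
rewrite cyl_prob0; last by move=> i; rewrite /A'; case: ifPn.
rewrite (@big_cat_nat _ _ _ a)//= [X in (X * _)%E]big1_seq ?mul1e; last first.
  move=> i /andP[_]; rewrite mem_index_iota => /andP[_ ia].
  by rewrite /A' leqNgt ia preimage_setT probability_setT.
by apply: eq_big_nat => i /andP[ai _]; rewrite /A' ai.
Qed.

Lemma cyl_measurable a b : cylinder a b `<=` measurable.
Proof.
move=> _ [A [mA ->]].
rewrite (_ : [set w | _] = \bigcap_i (X i @^-1` (if (a <= i < b)%N then A i else setT))).
  apply: bigcapT_measurable => i; rewrite -[_ @^-1` _]setTI; apply: mX => //.
  by case: ifPn.
apply/seteqP; split=> w /= Aw i.
  by move=> _; case: ifPn => // iab; exact: Aw.
by move=> iab; have := Aw i Logic.I; rewrite iab.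
Qed.

Lemma sig_measurable a b : block_sigma a b `<=` measurable.
Proof.
apply: smallest_sub; first exact: sigma_algebra_measurable.
exact: cyl_measurable.
Qed.

Lemma cyl_indep a b c E F : (a <= b)%N -> (b <= c)%N -> cylinder a b E -> cylinder b c F ->
  P (E `&` F) = (P E * P F)%E.
Proof.
move=> ab bc [A [mA ->]] [B [mB ->]].
pose C i := if (i < b)%N then A i else B i.
have mC i : measurable (C i) by rewrite /C; case: ifPn.
rewrite (_ : _ `&` _ = [set w | forall i, (a <= i < c)%N -> C i (X i w)]); last first.
  apply/seteqP; split => w /=.
    move=> [Aw Bw] i /andP[ai ic]; rewrite /C; case: ifPn => ib.
      by apply: Aw; rewrite ai.
    by apply: Bw; rewrite leqNgt ib.
  move=> Cw; split=> i /andP[i1 i2].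
    by have := Cw i; rewrite /C i2; apply; rewrite i1 (leq_trans i2).
  by have := Cw i; rewrite /C [(i < b)%N]ltnNge i1/=; apply; rewrite (leq_trans ab).
rewrite !cyl_prob//; last exact: leq_trans bc.
rewrite (@big_cat_nat _ _ _ b)//=; congr (_ * _)%E.
  by apply: eq_big_nat => i /andP[_ ib]; rewrite /C ib.
by apply: eq_big_nat => i /andP[bi _]; rewrite /C ltnNge bi.
Qed.

(** Dynkin's argument applied twice, to pass from cylinders to the generated
    sigma-algebras on both sides. *)
Lemma sig_indep a b c E F : (a <= b)%N -> (b <= c)%N -> block_sigma a b E -> block_sigma b c F ->
  P (E `&` F) = (P E * P F)%E.
Proof.
move=> ab bc sE sF.
have step1 F' : cylinder b c F' -> P (E `&` F') = (P E * P F')%E.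
  move=> cF; have mF := cyl_measurable cF.
  have := @lambda_system_subset T (cylinder a b) (@cyl_setI a b) setT _ (dynkin_indep mF).
  move=> /(_ _ (fun _ _ _ _ => I)) H; apply: (H _ E sE).2.
  move=> E' cE; split; first exact: cyl_measurable cE.
  exact: cyl_indep cE cF.
have mE := sig_measurable sE.
have := @lambda_system_subset T (cylinder b c) (@cyl_setI b c) setT _ (dynkin_indep mE).
move=> /(_ _ (fun _ _ _ _ => I)) H; rewrite setIC muleC; apply: (H _ F sF).2.
move=> F' cF; split; first exact: cyl_measurable cF.
by rewrite setIC step1// muleC.
Qed.

Lemma cyl_sub a b a' b' : (a' <= a)%N -> (b <= b')%N -> cylinder a b `<=` cylinder a' b'.
Proof.
move=> aa bb _ [A [mA ->]].
exists (fun i => if (a <= i < b)%N then A i else setT); split.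
  by move=> i; case: ifPn.
apply/seteqP; split=> w /= Aw i.
  by move=> _; case: ifPn => // /Aw.
move=> /andP[i1 i2]; have := Aw i; rewrite i1 i2; apply.
by rewrite (leq_trans aa)//= (leq_trans i2).
Qed.

Lemma sig_sub a b a' b' : (a' <= a)%N -> (b <= b')%N -> block_sigma a b `<=` block_sigma a' b'.
Proof.
move=> aa bb; apply: smallest_sub; first exact: smallest_sigma_algebra.
by apply: (subset_trans (cyl_sub aa bb)); exact: sub_gen_smallest.
Qed.

Lemma sigC a b E : block_sigma a b E -> block_sigma a b (~` E).
Proof. exact: sigma_algebraC. Qed.

Lemma sigI a b E F : block_sigma a b E -> block_sigma a b F -> block_sigma a b (E `&` F).
Proof.
move=> sE sF.
exact: (@measurableI _ (g_sigma_algebraType (cylinder a b)) E F).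
Qed.

Lemma sigT a b : block_sigma a b setT.
Proof. exact: (@measurableT _ (g_sigma_algebraType (cylinder a b))). Qed.

Definition sigfun a b (f : T -> R) := forall A : set R, measurable A -> block_sigma a b (f @^-1` A).

Lemma sigfun_measurable a b (f : T -> R) : sigfun a b f <->
  measurable_fun (setT : set (g_sigma_algebraType (cylinder a b))) (f : g_sigma_algebraType (cylinder a b) -> R).
Proof.
split=> [sf _ A mA|mf A mA]; first by rewrite setTI; exact: sf.
by have := mf measurableT A mA; rewrite setTI.
Qed.

Lemma sigfunX a b i : (a <= i < b)%N -> sigfun a b (X i).
Proof.
move=> iab A mA; apply: sub_gen_smallest.
exists (fun j => if j == i then A else setT); split; first by move=> j; case: ifPn.
apply/seteqP; split => w /=.
  by move=> Aw j _; case: eqP => // ->.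
by move=> /(_ i iab); rewrite eqxx.
Qed.

Lemma sigfunD a b f g : sigfun a b f -> sigfun a b g -> sigfun a b (fun w => f w + g w).
Proof.
move=> /sigfun_measurable mf /sigfun_measurable mg; apply/sigfun_measurable.
exact: measurable_funD.
Qed.

Lemma sigfun0 a b : sigfun a b (fun=> 0).
Proof. by apply/sigfun_measurable; exact: measurable_cst. Qed.

Lemma sigfun_sum a b u v : (a <= u)%N -> (v <= b)%N ->
  sigfun a b (fun w => \sum_(u <= i < v) X i w).
Proof.
move=> au; elim: v => [|v IH] vb.
  rewrite (_ : (fun w => _) = fun=> 0); first exact: sigfun0.
  by apply/funext => w; rewrite big_geq.
have [uv|uv] := leqP u v; last first.
  rewrite (_ : (fun w => _) = fun=> 0); first exact: sigfun0.
  by apply/funext => w; rewrite big_geq.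
rewrite (_ : (fun w => _) = (fun w => \sum_(u <= i < v) X i w + X v w)).
  by apply: sigfunD; [apply: IH; exact: ltnW|apply: sigfunX; rewrite (leq_trans au)].
by apply/funext => w; rewrite big_nat_recr.
Qed.

End Independence.

(** * Oscillation of Brownian motion on dyadic grids *)

Lemma expr4_ge0 (R : realDomainType) (x : R) : 0 <= x ^+ 4.
Proof. by rewrite (exprM x 2 2) sqr_ge0. Qed.

(** A convexity inequality whose factor 2 in front of x^4 is what the
    recursion for [osc4] tolerates, as halving L divides the bound L^2 by 4.
    The second constant is hidden to keep it from being unfolded. *)
Lemma quartic_weight (R : realFieldType) :
  {D : R | 1 <= D & forall x y : R, (x + y) ^+ 4 <= 2 * x ^+ 4 + D * y ^+ 4}.
Proof.
(* (x + y)^2 <= (9/8) x^2 + 9 y^2, and the square of the right side is at most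
   (3/2) (9/8)^2 x^4 + 3 * 9^2 y^4 with (3/2) (9/8)^2 = 243 / 128 < 2. *)
exists 243 => [|x y]; first by rewrite ler1n.
have h1 : (x + y) ^+ 2 <= 9/8 * x ^+ 2 + 9 * y ^+ 2.
  rewrite -subr_ge0 (_ : _ - _ = (x - 8 * y) ^+ 2 / 8); last by field.
  by rewrite divr_ge0 ?sqr_ge0.
have h2 : ((x + y) ^+ 2) ^+ 2 <= (9/8 * x ^+ 2 + 9 * y ^+ 2) ^+ 2.
  rewrite ler_pXn2r// nnegrE ?sqr_ge0//.
  by rewrite addr_ge0// mulr_ge0 ?sqr_ge0// divr_ge0.
rewrite (exprM _ 2 2); apply: le_trans h2 _.
rewrite -subr_ge0 (_ : _ - _ = (9/8 * x ^+ 2 - 18 * y ^+ 2) ^+ 2 / 2 +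
   (2 - 243/128) * x ^+ 4); last by field.
apply: addr_ge0; first by apply: divr_ge0; [exact: sqr_ge0|lra].
by apply: mulr_ge0; [lra|exact: expr4_ge0].
Qed.

Definition quartic_const (R : realFieldType) : R := s2val (quartic_weight R).

Lemma quartic_const_ge1 (R : realFieldType) : 1 <= quartic_const R.
Proof. exact: s2valP (quartic_weight R). Qed.

Lemma quartic_const_ge0 (R : realFieldType) : 0 <= quartic_const R.
Proof. exact: le_trans (quartic_const_ge1 R). Qed.

Lemma expr4_addr_le (R : realFieldType) (x y : R) :
  (x + y) ^+ 4 <= 2 * x ^+ 4 + quartic_const R * y ^+ 4.
Proof. exact: s2valP' (quartic_weight R) x y. Qed.

Section BrownianEstimates.
Context {d : measure_display} {T : measurableType d} {R : realType}.
Variables (P : probability T R) (B : R -> {RV P >-> R}).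
Hypothesis hB : standard_brownian_motion P B.
Local Notation D := (quartic_const R).

Lemma measurable_gt (Y : T -> R) (e : R) : measurable_fun setT Y ->
  measurable [set w | e < Y w].
Proof.
move=> mY; rewrite (_ : [set w | _] = setT `&` Y @^-1` `]e, +oo[).
  by apply: mY => //; exact: measurable_itv.
by rewrite setTI; apply/seteqP; split=> w /=; rewrite in_itv/= andbT.
Qed.

Lemma ge0_emarkov (Y : T -> \bar R) (m e : R) : measurable_fun setT Y ->
  (forall w, 0 <= Y w)%E -> (\int[P]_w Y w <= m%:E)%E -> 0 < e ->
  measurable [set w | (e%:E < Y w)%E] /\
  (P [set w | (e%:E < Y w)%E] <= (m / e)%:E)%E.
Proof.
move=> mY Y0 Ym e0.
have mE : measurable [set w | (e%:E < Y w)%E].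
  by rewrite -[X in measurable X]setTI; exact: emeasurable_fun_o_infty.
split=> //; have := @le_integral_abse _ _ _ P setT measurableT Y e mY e0.
have -> : (\int[P]_x `|Y x| = \int[P]_w Y w)%E.
  by apply: eq_integral => w _; rewrite gee0_abs.
rewrite setTI => H.
apply: (@le_trans _ _ (P [set w | (e%:E <= `|Y w|)%E])).
  apply: le_measure; rewrite ?inE//.
    rewrite -[X in measurable X]setTI; apply: emeasurable_fun_c_infty => //.
    exact: measurableT_comp.
  by move=> w /= eY; rewrite gee0_abs// ltW.
by rewrite mulrC EFinM lee_pdivlMl// (le_trans H).
Qed.

Lemma ge0_markov (Y : T -> R) (m e : R) : measurable_fun setT Y ->
  (forall w, 0 <= Y w) -> (\int[P]_w (Y w)%:E <= m%:E)%E -> 0 < e ->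
  (P [set w | (e < Y w)%R] <= (m / e)%:E)%E.
Proof.
move=> mY Y0 Ym e0.
have mYE : measurable_fun setT (EFin \o Y) by exact/measurable_EFinP.
by have [] := @ge0_emarkov (EFin \o Y) m e mYE (fun w => Y0 w) Ym e0.
Qed.

Lemma measurable_BB s t : measurable_fun setT (fun w => B t w - B s w).
Proof. by apply: measurable_funB. Qed.

Lemma bm_law s t A : 0 <= s -> s < t -> measurable A ->
  P [set w | A (B t w - B s w)] = normal_prob 0 (Num.sqrt (t - s)) A.
Proof. by move=> s0 st mA; rewrite -(bm_gaussian_increments hB s0 st mA). Qed.

Lemma bm_moment4 s t : 0 <= s -> s <= t ->
  (\int[P]_w ((B t w - B s w) ^+ 4)%:E <= (128 * (t - s) ^+ 2)%:E)%E.
Proof.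
move=> s0; rewrite le_eqVlt => /predU1P[->|st].
  rewrite (_ : (\int[P]_w _)%E = 0%E).
    by rewrite lee_fin mulr_ge0 ?sqr_ge0.
  by apply: integral0_eq => w _; rewrite subrr expr0n.
have ts0 : 0 < t - s by rewrite subr_gt0.
have sq0 : 0 < Num.sqrt (t - s) by rewrite sqrtr_gt0.
have := normal_prob_moment4 sq0.
have -> : Num.sqrt (t - s) ^+ 4 = (t - s) ^+ 2 by rewrite (exprM _ 2 2) sqr_sqrtr// ltW.
apply: le_trans.
pose Z := fun w => B t w - B s w.
have mY : @measurable_fun _ _ T (measurableTypeR R) setT Z.
  exact: (measurable_BB s t).
pose mixin := isMeasurableFun.Build _ _ T (measurableTypeR R) _ mY.
pose Y : {mfun T >-> measurableTypeR R} := HB.pack Z mixin.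
have mx4 : measurable_fun (setT : set (measurableTypeR R)) (fun x : R => (x ^+ 4)%:E).
  by apply/measurable_EFinP; exact: exprn_measurable.
have := ge0_integral_pushforward mY P measurableT mx4 (fun x _ => _).
rewrite preimage_setT => H.
rewrite [leLHS](_ : _ = \int[pushforward P Y]_(y in (setT : set (measurableTypeR R))) (y ^+ 4)%:E)%E; last first.
  by apply: esym; apply: H => x; rewrite lee_fin expr4_ge0.
rewrite le_eqVlt; apply/orP; left; apply/eqP.
apply: (@eq_measure_integral _ _ R setT (normal_prob 0 (Num.sqrt (t - s))) (pushforward P Y)) => A mA _.
exact: (bm_gaussian_increments hB s0 st mA).
Qed.

Lemma bm_half_ge0 s t : 0 <= s -> s < t -> P [set w | 0 <= B t w - B s w] = (2^-1)%:E.
Proof.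
move=> s0 st; rewrite (@bm_law s t [set x | 0 <= x])//.
  by apply: normal_prob_half; rewrite sqrtr_gt0 subr_gt0.
by rewrite -set_itvcy; exact: measurable_itv.
Qed.

Lemma bm_half_lt0 s t : 0 <= s -> s < t -> P [set w | B t w - B s w < 0] = (2^-1)%:E.
Proof.
move=> s0 st; rewrite (_ : [set w | _] = ~` [set w | 0 <= B t w - B s w]).
  have mh : measurable [set w | 0 <= B t w - B s w].
    rewrite (_ : [set w | _] = setT `&` (fun w => B t w - B s w) @^-1` `[0, +oo[).
      by apply: measurable_BB => //; exact: measurable_itv.
    by rewrite setTI; apply/seteqP; split=> w /=; rewrite in_itv/= andbT.
  rewrite probability_setC// bm_half_ge0// -EFinB; congr EFin.
  by field.
by apply/seteqP; split=> w /=; [move=> h; apply/negP; rewrite -ltNge|move/negP; rewrite -ltNge].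
Qed.

(** A dyadic substitute for a maximal inequality: this polynomial in finitely
    many increments dominates the fourth power of the displacement of the path
    at all times of a dyadic grid of [t, t + L] ([osc4_bound]), and its mean
    stays of order L^2 when the grid is refined ([osc4_moment]). The first
    half is treated directly, the second one through the midpoint. *)
Fixpoint osc4 (k : nat) (t L : R) (w : T) : R :=
  match k with
  | 0 => (B (t + L) w - B t w) ^+ 4
  | k'.+1 => osc4 k' t (L / 2) w + 2 * osc4 k' (t + L / 2) (L / 2) w +
             D * (B (t + L / 2) w - B t w) ^+ 4
  end.

Lemma osc4_ge0 k t L w : 0 <= osc4 k t L w.
Proof.
elim: k t L => [|k IH] t L /=; first exact: expr4_ge0.
by rewrite !addr_ge0// mulr_ge0// ?expr4_ge0// quartic_const_ge0.
Qed.

Lemma measurable_osc4 k t L : measurable_fun setT (osc4 k t L).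
Proof.
elim: k t L => [|k IH] t L /=; first by apply: measurable_funX; exact: measurable_BB.
apply: measurable_funD; first apply: measurable_funD => //.
  by apply: measurable_funM.
by apply: measurable_funM => //; apply: measurable_funX; exact: measurable_BB.
Qed.

(** Monotonicity in the mesh allows passing to the limit. *)
Lemma osc4_mono1 k t L w : osc4 k t L w <= osc4 k.+1 t L w.
Proof.
elim: k t L => [|k IH] t L.
  rewrite /= (_ : B (t + L) w - B t w =
     (B (t + L / 2 + L / 2) w - B (t + L / 2) w) + (B (t + L / 2) w - B t w)); last first.
    by rewrite (_ : t + L / 2 + L / 2 = t + L); [ring|field].
  apply: le_trans (expr4_addr_le _ _) _.
  by rewrite -[leRHS]addrA lerDr expr4_ge0.
rewrite /= -/(osc4 k.+1 t (L / 2) w).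
apply: lerD => //; apply: lerD; first exact: IH.
by rewrite ler_wpM2l//; exact: IH.
Qed.

Lemma osc4_mono k l t L w : (k <= l)%N -> osc4 k t L w <= osc4 l t L w.
Proof.
move=> /subnK <-; elim: (l - k)%N => [//|m IH].
by rewrite addSn (le_trans IH)// osc4_mono1.
Qed.

Lemma osc4_bound k t L w i : (i <= 2 ^ k)%N ->
  (B (t + i%:R * (L / 2 ^+ k)) w - B t w) ^+ 4 <= osc4 k t L w.
Proof.
elim: k t L i => [|k IH] t L i ik.
  case: i ik => [|[|//]] _ /=.
    by rewrite mul0r addr0 subrr expr0n expr4_ge0.
  by rewrite expr0 mul1r divr1.
have [ik'|ki] := leqP i (2 ^ k).
  apply: (@le_trans _ _ (osc4 k t (L / 2) w)).
    rewrite (_ : L / 2 ^+ k.+1 = L / 2 / 2 ^+ k); last by rewrite exprS; field; rewrite expf_neq0.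
    exact: IH.
  by rewrite /= -addrA lerDl addr_ge0// mulr_ge0// ?osc4_ge0 ?expr4_ge0 ?quartic_const_ge0.
pose j := (i - 2 ^ k)%N.
have ij : i = (2 ^ k + j)%N by rewrite /j subnKC// ltnW.
have jk : (j <= 2 ^ k)%N by rewrite /j leq_subLR addnn -mul2n -expnS.
have -> : t + i%:R * (L / 2 ^+ k.+1) = t + L / 2 + j%:R * (L / 2 / 2 ^+ k).
  by rewrite ij natrD natrX exprS; field; rewrite expf_neq0.
rewrite /= (_ : B (t + L / 2 + j%:R * (L / 2 / 2 ^+ k)) w - B t w =
   (B (t + L / 2 + j%:R * (L / 2 / 2 ^+ k)) w - B (t + L / 2) w) +
   (B (t + L / 2) w - B t w)); last by ring.
apply: le_trans (expr4_addr_le _ _) _.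
rewrite lerD2r (@le_trans _ _ (2 * osc4 k (t + L / 2) (L / 2) w))//.
  by rewrite ler_wpM2l//; exact: IH.
by rewrite lerDr osc4_ge0.
Qed.

(** The two halves contribute (1 + 2) * (L / 2)^2 and the middle increment (L
    / 2)^2, so that the bound reproduces itself with the same constant. *)
Lemma osc4_moment k t L : 0 <= t -> 0 <= L ->
  (\int[P]_w (osc4 k t L w)%:E <= ((128 * D) * L ^+ 2)%:E)%E.
Proof.
elim: k t L => [|k IH] t L t0 L0.
  rewrite /= (le_trans (bm_moment4 _ _))// ?lerDl// lee_fin (addrC t) addrK.
  by rewrite ler_wpM2r ?sqr_ge0// -[leLHS]mulr1 ler_wpM2l// quartic_const_ge1.
have L20 : 0 <= L / 2 by rewrite divr_ge0.
rewrite /=.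
rewrite (_ : (fun w => _) = (fun w => (osc4 k t (L / 2) w)%:E +
    2%:E * (osc4 k (t + L / 2) (L / 2) w)%:E +
    D%:E * ((B (t + L / 2) w - B t w) ^+ 4)%:E)%E); last first.
  by apply/funext => w; rewrite 2!EFinD [in X in (_ + X + _)%E]EFinM [in X in (_ + _ + X)%E]EFinM.
have m4 k' t' L' : measurable_fun setT (fun w => (osc4 k' t' L' w)%:E).
  exact/measurable_EFinP/measurable_osc4.
have mB : measurable_fun setT (fun w => ((B (t + L / 2) w - B t w) ^+ 4)%:E).
  by apply/measurable_EFinP; apply: measurable_funX; exact: measurable_BB.
have o0 k' t' L' w : (0 <= (osc4 k' t' L' w)%:E)%E by rewrite lee_fin osc4_ge0.
have D0 := quartic_const_ge0 R.
have b0 w : (0 <= ((B (t + L / 2) w - B t w) ^+ 4)%:E)%E by rewrite lee_fin expr4_ge0.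
rewrite ge0_integralD//; last 4 first.
- by move=> w _; rewrite adde_ge0// mule_ge0.
- by apply: emeasurable_funD => //; apply: emeasurable_funM.
- by move=> w _; rewrite mule_ge0.
- by apply: emeasurable_funM.
rewrite ge0_integralD//; last 2 first.
- by move=> w _; rewrite mule_ge0.
- by apply: emeasurable_funM.
rewrite !ge0_integralZl//.
have b1 := IH t (L / 2) t0 L20.
have b2 := IH (t + L / 2) (L / 2) (addr_ge0 t0 L20) L20.
have tL : t <= t + L / 2 by rewrite lerDl.
have b3 := bm_moment4 t0 tL.
rewrite (addrC t) addrK -(addrC t) in b3.
apply: (@le_trans _ _ (((128 * D) * (L / 2) ^+ 2)%:E + 2%:E * ((128 * D) * (L / 2) ^+ 2)%:E +
   D%:E * (128 * (L / 2) ^+ 2)%:E)%E).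
  by apply: leeD; [apply: leeD|]; rewrite ?lee_wpmul2l.
rewrite -!EFinM -!EFinD lee_fin.
by rewrite le_eqVlt; apply/orP; left; apply/eqP; field.
Qed.

End BrownianEstimates.

(** * Small balls for the sampled path *)

Section SmallBall.
Context {d : measure_display} {T : measurableType d} {R : realType}.
Variables (P : probability T R) (B : R -> {RV P >-> R}).
Hypothesis hB : standard_brownian_motion P B.
Variable h : R.
Hypothesis h0 : 0 < h.
Local Notation C0 := (128 * quartic_const R).

Definition walk (i : nat) (w : T) : R := B (i%:R * h) w.
Definition incr (i : nat) (w : T) : R := walk i.+1 w - walk i w.
Local Notation S := walk.
Local Notation sg := (block_sigma incr).

Lemma measurable_incr i : measurable_fun setT (incr i).
Proof. exact: measurable_BB. Qed.

Lemma incr_indep n : mutually_independent P (fun i : 'I_n => incr i).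
Proof.
apply: (@bm_independent_increments _ _ _ _ _ hB n (fun i => i%:R * h)).
  by rewrite mul0r.
by move=> i _; rewrite ler_pM2r// ler_nat.
Qed.

Lemma walkB_sig a b u v : (a <= u)%N -> (u <= v)%N -> (v <= b)%N ->
  sigfun incr a b (fun w => S v w - S u w).
Proof.
move=> au uv vb; rewrite (_ : (fun w => _) = (fun w => \sum_(u <= i < v) incr i w)).
  exact: sigfun_sum.
by apply/funext => w; rewrite telescope_sumr.
Qed.

Definition tube (a M : nat) (c : R) : set T :=
  [set w | forall i, (i <= M)%N -> `|S (a + i) w - S a w| <= c].

Lemma sig_tube a M c : sg a (a + M) (tube a M c).
Proof.
pose F i := if (i <= M)%N then (fun w => S (a + i) w - S a w) @^-1` `[- c, c] else setT.
rewrite (_ : tube _ _ _ = \bigcap_i F i).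
  apply: (@bigcapT_measurable _ (g_sigma_algebraType (cylinder incr a (a + M)))) => i.
  rewrite /F; case: ifPn => iM; last exact: sigT.
  apply: (walkB_sig (leqnn a) (leq_addr i a)); first by rewrite leq_add2l.
  exact: measurable_itv.
apply/seteqP; split => w /= Hw i.
  move=> _; rewrite /F; case: ifPn => // iM /=.
  by rewrite in_itv/= -ler_norml; exact: Hw.
by move=> iM; have := Hw i Logic.I; rewrite /F iM /= in_itv/= -ler_norml.
Qed.

Lemma sig_ge0 a b u v : (a <= u)%N -> (u <= v)%N -> (v <= b)%N ->
  sg a b [set w | 0 <= S v w - S u w].
Proof.
move=> au uv vb; rewrite (_ : [set w | _] = (fun w => S v w - S u w) @^-1` `[0, +oo[).
  by apply: walkB_sig => //; exact: measurable_itv.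
by apply/seteqP; split=> w /=; rewrite in_itv/= andbT.
Qed.

Lemma sig_lt0 a b u v : (a <= u)%N -> (u <= v)%N -> (v <= b)%N ->
  sg a b [set w | S v w - S u w < 0].
Proof.
move=> au uv vb; rewrite (_ : [set w | _] = ~` [set w | 0 <= S v w - S u w]).
  by apply: sigC; exact: sig_ge0.
by apply/seteqP; split=> w /=; [move=> ?; apply/negP; rewrite -ltNge|move/negP; rewrite -ltNge].
Qed.

Lemma sig_le a b u v c : (a <= u)%N -> (u <= v)%N -> (v <= b)%N ->
  sg a b [set w | `|S v w - S u w| <= c].
Proof.
move=> au uv vb; rewrite (_ : [set w | _] = (fun w => S v w - S u w) @^-1` `[- c, c]).
  by apply: walkB_sig => //; exact: measurable_itv.
by apply/seteqP; split=> w /=; rewrite in_itv/= -ler_norml.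
Qed.

Lemma sg_measurable a b E : sg a b E -> measurable E.
Proof. exact: (sig_measurable measurable_incr). Qed.

Lemma measurable_tube a M c : measurable (tube a M c).
Proof. by apply: sg_measurable; exact: sig_tube. Qed.

Lemma tube_tail a M k c : (M <= 2 ^ k)%N -> 0 < c ->
  (P (~` tube a M c) <= (C0 * ((2 ^ k)%:R * h) ^+ 2 / c ^+ 4)%:E)%E.
Proof.
move=> Mk c0; set L := (2 ^ k)%:R * h.
have L0 : 0 <= L by rewrite mulr_ge0// ltW.
have ah : 0 <= a%:R * h by rewrite mulr_ge0// ltW.
have c4 : 0 < c ^+ 4 by rewrite exprn_gt0.
have H := ge0_markov (measurable_osc4 B k (a%:R * h) L)
  (osc4_ge0 B k (a%:R * h) L) (osc4_moment hB k ah L0) c4.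
apply: le_trans H.
apply: le_measure; rewrite ?inE.
- by apply: measurableC; exact: measurable_tube.
- exact: measurable_gt (measurable_osc4 B k (a%:R * h) L).
move=> w /= /existsNP[i /not_implyP[iM /negP]]; rewrite -ltNge => ci.
have := @osc4_bound _ _ _ P B k (a%:R * h) L w i (leq_trans iM Mk).
rewrite (_ : a%:R * h + _ = (a + i)%:R * h); last first.
  by rewrite /L natrX natrD; field; rewrite expf_neq0.
apply: lt_le_trans.
rewrite -[ltRHS](@ger0_norm _ (_ ^+ 4)) ?expr4_ge0// normrX.
by rewrite ltr_pXn2r// nnegrE// ltW.
Qed.

Lemma probI_ge (E F : set T) (x y : R) : measurable E -> measurable F ->
  (P (~` E) <= x%:E -> y%:E <= P F -> (y - x)%:E <= P (E `&` F))%E.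
Proof.
move=> mE mF Ex yF; rewrite EFinB leeBlDr//.
apply: (le_trans yF).
apply: (@le_trans _ _ (P (E `&` F) + P (~` E))%E); last by rewrite leeD2l.
apply: le_trans (measureU2 _ _ _) => //.
- apply: le_measure; rewrite ?inE//.
    by apply: measurableU; [exact: measurableI|exact: measurableC].
  by move=> w Fw; have [Ew|Ew] := pselect (E w); [left|right].
- exact: measurableI.
- exact: measurableC.
Qed.

Lemma walk_half_ge0 a M : (0 < M)%N ->
  P [set w | 0 <= S (a + M) w - S a w] = (2^-1)%:E.
Proof.
move=> M0; apply: bm_half_ge0 => //.
  by rewrite mulr_ge0// ltW.
by rewrite ltr_pM2r// ltr_nat -addn1 leq_add2l.
Qed.

Lemma walk_half_lt0 a M : (0 < M)%N ->
  P [set w | S (a + M) w - S a w < 0] = (2^-1)%:E.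
Proof.
move=> M0; apply: bm_half_lt0 => //.
  by rewrite mulr_ge0// ltW.
by rewrite ltr_pM2r// ltr_nat -addn1 leq_add2l.
Qed.

Definition steered (a M : nat) (c : R) : set T :=
  tube a M (2 * c) `&` [set w | `|S (a + M) w - S a w| <= c].

Lemma sig_steered a M c : sg a (a + M) (steered a M c).
Proof. by apply: sigI; [exact: sig_tube|apply: sig_le => //; exact: leq_addr]. Qed.

(** Displacements of opposite signs and size at most c compensate, so that the
    bound c at the end of the walk is kept by adding a block. *)
Lemma steered_concat a M b c w : 0 <= c -> steered a M c w ->
  tube (a + M) b c w ->
  (0 <= S (a + M) w - S a w /\ S (a + M + b) w - S (a + M) w < 0) \/
  (S (a + M) w - S a w < 0 /\ 0 <= S (a + M + b) w - S (a + M) w) ->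
  steered a (M + b) c w.
Proof.
move=> c0 [tM /= eM] tb Hs; split.
  move=> i iMb; have [iM|Mi] := leqP i M; first exact: tM.
  have -> : (a + i = a + M + (i - M))%N by rewrite -addnA subnKC// ltnW.
  have := tb (i - M)%N; rewrite leq_subLR => /(_ iMb) H.
  rewrite (_ : _ - _ = (S (a + M + (i - M))%N w - S (a + M)%N w) +
    (S (a + M)%N w - S a w)); last by ring.
  by rewrite (le_trans (ler_normD _ _))// mulrDl mul1r lerD.
have := tb b (leqnn b); rewrite /= addnA.
move: eM; rewrite !ler_norml => /andP[h1 h2] /andP[h3 h4].
apply/andP; case: Hs => -[h5 h6]; split; lra.
Qed.

(** Each block of b steps keeps the path steered with conditional probability
    at least 1 / 4, independently of the past: by symmetry of the increments
    each sign has probability 1 / 2, and leaving the tube during the block has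
    probability at most 1 / 4. *)
Lemma steered_prob b c N a M : 0 <= c -> (0 < b)%N ->
  (forall a M, (M <= b)%N -> (P (~` tube a M c) <= (4^-1)%:E)%E) ->
  (M <= N * b)%N -> ((4^-1 ^+ N)%:E <= P (steered a M c))%E.
Proof.
move=> c0 b0 tb; elim: N M => [|N IH] M MN.
  rewrite mul0n leqn0 in MN; move/eqP: MN => ->.
  rewrite (_ : steered _ _ _ = setT) ?probability_setT ?expr0//.
  apply/seteqP; split => // w _; split => /=.
    by move=> i; rewrite leqn0 => /eqP->; rewrite addn0 subrr normr0 mulr_ge0.
  by rewrite addn0 subrr normr0.
have m4 u v f : sg u v f -> measurable f by exact: sg_measurable.
have [Mb|bM] := leqP M b.
  have h1 := probI_ge (measurable_tube a M c) measurableT (tb a M Mb).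
  apply: (@le_trans _ _ (P (tube a M c `&` setT))).
    have /= := h1 1; rewrite probability_setT => /(_ (lexx _)).
    apply: le_trans; rewrite lee_fin exprS.
    apply: (@le_trans _ _ (4^-1)); last by lra.
    by rewrite ler_piMr// exprn_ile1//; lra.
  rewrite setIT; apply: le_measure; rewrite ?inE.
  - exact: measurable_tube.
  - by apply: m4; exact: sig_steered.
  - move=> w tw; split => /=; last exact: tw.
    by move=> i /tw /le_trans; apply; rewrite mulr_natl mulr2n lerDl.
pose M' := (M - b)%N.
have MM' : M = (M' + b)%N by rewrite subnK// ltnW.
have M'N : (M' <= N * b)%N by rewrite leq_subLR -mulSn.
have {IH}IH := IH _ M'N.
rewrite {}MM'.
pose G := steered a M' c.
pose U := tube (a + M') b c.
pose H1 := [set w | 0 <= S (a + M') w - S a w].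
pose H2 := [set w | S (a + M') w - S a w < 0].
pose K1 := [set w | 0 <= S (a + M' + b) w - S (a + M') w].
pose K2 := [set w | S (a + M' + b) w - S (a + M') w < 0].
(* Whatever the sign of the displacement after M' steps, with probability at
   least 1 / 4 the next block stays in the tube of radius c and moves against
   that sign. *)
have sG : sg a (a + M') G by exact: sig_steered.
have sH1 : sg a (a + M') H1 by apply: sig_ge0 => //; exact: leq_addr.
have sH2 : sg a (a + M') H2 by apply: sig_lt0 => //; exact: leq_addr.
have sU : sg (a + M') (a + M' + b) U by exact: sig_tube.
have sK1 : sg (a + M') (a + M' + b) K1 by apply: sig_ge0 => //; exact: leq_addr.
have sK2 : sg (a + M') (a + M' + b) K2 by apply: sig_lt0 => //; exact: leq_addr.
have q14 : (2^-1 - 4^-1 = 4^-1 :> R) by lra.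
have pK1 : ((4^-1)%:E <= P (U `&` K1))%E.
  rewrite -q14; apply: probI_ge; [exact: m4 sU|exact: m4 sK1|exact: tb|].
  by rewrite /K1 walk_half_ge0.
have pK2 : ((4^-1)%:E <= P (U `&` K2))%E.
  rewrite -q14; apply: probI_ge; [exact: m4 sU|exact: m4 sK2|exact: tb|].
  by rewrite /K2 walk_half_lt0.
have e1 : P ((G `&` H1) `&` (U `&` K2)) = (P (G `&` H1) * P (U `&` K2))%E.
  apply: (sig_indep measurable_incr incr_indep (leq_addr M' a) (leq_addr b _)).
    exact: sigI.
  exact: sigI.
have e2 : P ((G `&` H2) `&` (U `&` K1)) = (P (G `&` H2) * P (U `&` K1))%E.
  apply: (sig_indep measurable_incr incr_indep (leq_addr M' a) (leq_addr b _)).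
    exact: sigI.
  exact: sigI.
have mG := m4 _ _ _ sG.
have mH1 := m4 _ _ _ sH1.
have mH2 := m4 _ _ _ sH2.
have mU := m4 _ _ _ sU.
have mK1 := m4 _ _ _ sK1.
have mK2 := m4 _ _ _ sK2.
have mE1 : measurable ((G `&` H1) `&` (U `&` K2)).
  by apply: measurableI; exact: measurableI.
have mE2 : measurable ((G `&` H2) `&` (U `&` K1)).
  by apply: measurableI; exact: measurableI.
have eG : P G = (P (G `&` H1) + P (G `&` H2))%E.
  rewrite -measureU//.
  - rewrite -setIUr (_ : H1 `|` H2 = setT) ?setIT//.
    apply/seteqP; split => // w _; rewrite /H1 /H2 /=.
    by case: (leP 0 (S (a + M') w - S a w)) => ?; [left|right].
  - exact: measurableI.
  - exact: measurableI.
  - apply/seteqP; split => // w [[_ w1] [_ w2]].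
    by move: w1 w2; rewrite /H1 /H2 /= => w1 /(le_lt_trans w1); rewrite ltxx.
apply: (@le_trans _ _ (P (((G `&` H1) `&` (U `&` K2)) `|` ((G `&` H2) `&` (U `&` K1))))).
  have -> : P (((G `&` H1) `&` (U `&` K2)) `|` ((G `&` H2) `&` (U `&` K1))) =
      (P ((G `&` H1) `&` (U `&` K2)) + P ((G `&` H2) `&` (U `&` K1)))%E.
    rewrite measureU//.
    apply/seteqP; split => // w [[[_ w1] _] [[_ w2] _]].
    by move: w1 w2; rewrite /H1 /H2 /= => w1 /(le_lt_trans w1); rewrite ltxx.
  rewrite e1 e2.
  apply: (@le_trans _ _ (P (G `&` H1) * (4^-1)%:E + P (G `&` H2) * (4^-1)%:E)%E).
    rewrite -ge0_muleDl// -eG exprSr EFinM.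
    by apply: lee_wpmul2r => //; rewrite lee_fin; lra.
  by apply: leeD; apply: lee_wpmul2l.
apply: le_measure; rewrite ?inE.
- exact: measurableU.
- by apply: m4; exact: sig_steered.
- move=> w [[[Gw w1] [Uw w2]]|[[Gw w1] [Uw w2]]]; apply: steered_concat => //.
    by left.
  by right.
Qed.

(** A tube of radius 2 * c is followed for N blocks with a probability at
    least 4^-N that does not depend on the mesh h. *)
Lemma small_ball k c N a M : 0 < c -> C0 * ((2 ^ k)%:R * h) ^+ 2 / c ^+ 4 <= 4^-1 ->
  (M <= N * 2 ^ k)%N -> ((4^-1 ^+ N)%:E <= P (tube a M (2 * c)))%E.
Proof.
move=> c0 Cc MN.
apply: (@le_trans _ _ (P (steered a M c))).
  apply: (@steered_prob (2 ^ k)) => //; first exact: ltW.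
    by rewrite expn_gt0.
  by move=> a' M' M'k; apply: le_trans (tube_tail _ M'k c0) _; rewrite lee_fin.
apply: le_measure; rewrite ?inE.
- by apply: sg_measurable; exact: sig_steered.
- exact: measurable_tube.
- by move=> w [].
Qed.

End SmallBall.

(** * A quiet scale among many *)

Lemma pow_scale (R : realType) (n a : nat) : (a <= n)%N ->
  (2 ^ (n - a))%:R * 2 ^- n = 2 ^- a :> R.
Proof.
move=> an; rewrite natrX exprB// ?unitfE//.
by field; rewrite !expf_neq0.
Qed.

Section Levels.
Context {d : measure_display} {T : measurableType d} {R : realType}.
Variables (P : probability T R) (B : R -> {RV P >-> R}).
Hypothesis hB : standard_brownian_motion P B.
Local Notation C0 := (128 * quartic_const R).

Section Grid.
Variable h : R.
Hypothesis h0 : 0 < h.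
Local Notation sg := (block_sigma (incr B h)).

Lemma levels_indep (E : nat -> set T) (u : nat -> nat) (x : R) (m : nat) :
  (forall j, (j < m)%N -> (u j <= u j.+1)%N) ->
  (forall j, (j < m)%N -> sg (u j) (u j.+1) (E j)) ->
  (forall j, (j < m)%N -> P (E j) <= x%:E)%E ->
  (P [set w | forall j, (j < m)%N -> E j w] <= (x ^+ m)%:E)%E.
Proof.
move=> um sE Ex.
suff : sg 0 (u m) [set w | forall j, (j < m)%N -> E j w] /\
  (P [set w | forall j, (j < m)%N -> E j w] <= (x ^+ m)%:E)%E by case.
elim: m um sE Ex => [|m IH] um sE Ex.
  rewrite (_ : [set w | _] = setT); last by apply/seteqP; split.
  by rewrite expr0 probability_setT; split => //; exact: sigT.
have [] := IH _ _ _.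
- by move=> j jm; apply: um; exact: ltnW.
- by move=> j jm; apply: sE; exact: ltnW.
- by move=> j jm; apply: Ex; exact: ltnW.
set F := [set w | _] => sF PF.
have sEm : sg (u m) (u m.+1) (E m) by exact: sE.
have -> : [set w | forall j, (j < m.+1)%N -> E j w] = F `&` E m.
  apply/seteqP; split=> w /=.
    by move=> H; split=> [j jm|]; apply: H => //; exact: ltnW.
  move=> [Fw Ew] j; rewrite ltnS leq_eqVlt => /predU1P[->//|]; exact: Fw.
split.
  apply: sigI.
    by apply: sig_sub sF => //; exact: um.
  by apply: sig_sub sEm.
rewrite (sig_indep (measurable_incr B h) (incr_indep hB h0) (leq0n _) (um m (ltnSn m)) sF sEm).
rewrite exprSr EFinM; apply: lee_pmul => //; exact: Ex.
Qed.

End Grid.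

(** If the path escapes at all m scales, then either its displacement up to
    one of the times l (j + 1) exceeds half of the radius for the much longer
    time l j, an event of probability O(4^-rho), or its increments over the
    disjoint intervals from l (j + 1) to l j all leave a tube. The latter
    events are independent, and each has probability at most 1 - 4^-(2^nu) by
    the small ball estimate. *)
Lemma levels_prob (n m rho nu p : nat) (delta : R) :
  (rho * m + nu <= n)%N -> 0 < delta ->
  C0 * 256 / 4 ^+ nu / delta ^+ 4 <= 4^-1 ->
  (P [set w | forall j, (j < m)%N ->
       (~` tube B (2 ^- n) p (2 ^ (n - rho * j)) (delta * Num.sqrt (2 ^- (rho * j)))) w]
   <= (m%:R * (16 * C0 / 4 ^+ rho / delta ^+ 4) + (1 - 4^-1 ^+ (2 ^ nu)) ^+ m)%:E)%E.
Proof.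
move=> mn delta0 Cnu; set h : R := 2 ^- n.
have h0 : 0 < h by rewrite invr_gt0 exprn_gt0.
pose l j : R := 2 ^- (rho * j).
pose K j := (2 ^ (n - rho * j))%N.
have rmn : (rho * m <= n)%N by apply: leq_trans mn; exact: leq_addr.
have jn j : (j <= m)%N -> (rho * j <= n)%N.
  by move=> jm; apply: leq_trans rmn; rewrite leq_mul2l jm orbT.
have l0 j : 0 < l j by rewrite invr_gt0 exprn_gt0.
have sl0 j : 0 < Num.sqrt (l j) by rewrite sqrtr_gt0.
have sl4 j : Num.sqrt (l j) ^+ 4 = l j ^+ 2 by rewrite (exprM _ 2 2) sqr_sqrtr// ltW.
have Kl j : (j <= m)%N -> (K j)%:R * h = l j by move=> jm; rewrite /K /h /l pow_scale// jn.
have Kmono j : (K j.+1 <= K j)%N by rewrite leq_pexp2l// leq_sub2l// leq_mul2l leqnSn orbT.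
pose G j := tube B h p (K j.+1) (delta / 2 * Num.sqrt (l j)).
pose F j := tube B h (p + K j.+1)%N (K j - K j.+1) (delta / 2 * Num.sqrt (l j)).
have mG j : measurable (G j) by exact: measurable_tube.
have mF j : measurable (F j) by exact: measurable_tube.
have sub : [set w | forall j, (j < m)%N -> (~` tube B h p (K j) (delta * Num.sqrt (l j))) w]
   `<=` (\big[setU/set0]_(j < m) ~` G j) `|` [set w | forall j, (j < m)%N -> (~` F j) w].
  move=> w bw.
  have [[j jm Gj]|noG] := pselect (exists2 j, (j < m)%N & (~` G j) w).
    by left; rewrite -(bigcup_mkord m (fun j => ~` G j)); exists j.
  right => j jm Fj; apply: (bw j jm) => i iK.
  have Gj : G j w by apply: contrapT => ?; apply: noG; exists j.
  have half : delta / 2 * Num.sqrt (l j) + delta / 2 * Num.sqrt (l j) = delta * Num.sqrt (l j) by field.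
  have d2 : 0 <= delta / 2 * Num.sqrt (l j) by rewrite mulr_ge0 ?divr_ge0 ?ltW.
  have [iK1|K1i] := leqP i (K j.+1).
    by apply: (le_trans (Gj i iK1)); rewrite -half lerDl.
  rewrite -half (_ : walk _ _ _ _ - _ = (walk B h (p + i) w - walk B h (p + K j.+1) w) +
     (walk B h (p + K j.+1) w - walk B h p w)); last by ring.
  rewrite (le_trans (ler_normD _ _))// lerD//; last exact: Gj.
  have := Fj (i - K j.+1)%N; rewrite -addnA subnKC ?(ltnW K1i)//.
  by apply; rewrite leq_sub2r.
have mGU : measurable (\big[setU/set0]_(j < m) ~` G j).
  by apply: bigsetU_measurable => j _; exact: measurableC.
have mforall (E : nat -> set T) : (forall j, measurable (E j)) ->
    measurable [set w | forall j, (j < m)%N -> (E j) w].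
  move=> mE; rewrite (_ : [set w | _] = \bigcap_j (if (j < m)%N then E j else setT)).
    by apply: bigcapT_measurable => j; case: ifPn.
  apply/seteqP; split=> w /= H j.
    by move=> _; case: ifPn => // /H.
  by move=> jm; have := H j Logic.I; rewrite jm.
have mFI : measurable [set w | forall j, (j < m)%N -> (~` F j) w].
  by apply: mforall => j; exact: measurableC.
apply: (@le_trans _ _ (P ((\big[setU/set0]_(j < m) ~` G j) `|`
   [set w | forall j, (j < m)%N -> (~` F j) w]))).
  apply: le_measure sub; rewrite inE.
    by apply: mforall => j; apply: measurableC; exact: measurable_tube.
  exact: measurableU.
apply: (le_trans (measureU2 _ mGU mFI)).
rewrite EFinD; apply: leeD.
  have H : (P (\big[setU/set0]_(j < m) ~` G j) <= \sum_(j < m) P (~` G j))%E.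
    by apply: (@Boole_inequality _ _ _ P (fun j => ~` G j)) => j _; exact: measurableC.
  apply: (le_trans H).
  apply: (@le_trans _ _ (\sum_(j < m) (16 * C0 / 4 ^+ rho / delta ^+ 4)%:E)%E).
    apply: lee_sum => j _.
    have c0 : 0 < delta / 2 * Num.sqrt (l j) by rewrite mulr_gt0 ?divr_gt0.
    apply: le_trans (tube_tail hB h0 _ (leqnn (2 ^ (n - rho * j.+1))) c0) _.
    rewrite lee_fin pow_scale ?jn// exprMn sl4 le_eqVlt; apply/orP; left; apply/eqP.
    have -> : (2 : R) ^- (rho * j.+1) = l j / 2 ^+ rho.
      by rewrite /l mulnS exprD; field; rewrite !expf_neq0.
    have -> : (4 : R) ^+ rho = 2 ^+ rho * 2 ^+ rho by rewrite -exprMn; congr (_ ^+ _); ring.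
    by field; rewrite !expf_neq0 ?gt_eqF// (lt_le_trans (l0 j)).
  by rewrite sumEFin lee_fin sumr_const card_ord [leRHS]mulr_natl.
(* Time increases when the scale index decreases, so the levels are read from
   the finest to the coarsest. *)
pose u j := (p + K (m - j))%N.
have E0 : [set w | forall j, (j < m)%N -> (~` F j) w] =
   [set w | forall j, (j < m)%N -> (~` F (m - j.+1)%N) w].
  apply/seteqP; split=> w /= H j jm.
    by apply: (H (m - j.+1)%N); rewrite ltn_subrL (leq_trans _ jm).
  have := H (m - j.+1)%N; rewrite ltn_subrL (leq_trans _ jm)// => /(_ isT).
  by rewrite subnSK// subKn// ltnW.
rewrite E0; apply: (@levels_indep h h0 (fun j => ~` F (m - j.+1)%N) u).
- by move=> j jm; rewrite /u leq_add2l -(@subnSK j m)//; exact: Kmono.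
- move=> j jm; apply: sigC; rewrite /F /u -(@subnSK j m)//.
  rewrite [X in block_sigma _ _ X](_ : _ = (p + K (m - j.+1).+1 + (K (m - j.+1) - K (m - j.+1).+1))%N).
    exact: sig_tube.
  by rewrite -addnA subnKC.
move=> j jm; set i := (m - j.+1)%N.
have im : (i < m)%N by rewrite ltn_subrL (leq_trans _ jm).
rewrite probability_setC// EFinB; apply: leeB => //.
have kn : (nu <= n - rho * i)%N.
  rewrite leq_subRL; last by apply: jn; exact: ltnW.
  by apply: leq_trans mn; rewrite leq_add2r leq_mul2l (ltnW im) orbT.
rewrite /F (_ : delta / 2 * _ = 2 * (delta / 4 * Num.sqrt (l i))); last by field.
apply: (@small_ball _ _ _ P B hB h h0 (n - rho * i - nu)).
- by rewrite mulr_gt0// divr_gt0.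
- rewrite -subnDA pow_scale; last by rewrite -leq_subRL// jn// ltnW.
  apply: le_trans Cnu; rewrite exprMn sl4 le_eqVlt; apply/orP; left; apply/eqP.
  have -> : (2 : R) ^- (rho * i + nu) = l i / 2 ^+ nu.
    by rewrite /l exprD; field; rewrite !expf_neq0.
  have -> : (4 : R) ^+ nu = 2 ^+ nu * 2 ^+ nu by rewrite -exprMn; congr (_ ^+ _); ring.
  by field; rewrite !expf_neq0 ?gt_eqF// (lt_le_trans (l0 i)).
- by rewrite -expnD subnKC// leq_subr.
Qed.

End Levels.

(** * The cost of covering a Brownian path *)

Lemma exists_pow4_ge (R : realType) (x : R) : exists k, x <= 4 ^+ k.
Proof.
exists (Num.bound x); apply/ltW/(lt_le_trans (upper_nthrootP (leqnn _))).
by rewrite lerXn2r// ?nnegrE//; lra.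
Qed.

Lemma exists_pow_le (R : realType) (x q : R) : 0 <= x -> x < 1 -> 0 < q ->
  exists k, x ^+ k <= q.
Proof.
move=> x0 x1 q0.
have /cvg_expr/cvgrPdist_le/(_ q q0)[k _ /(_ k (leqnn k))] : `|x| < 1 by rewrite ger0_norm.
by rewrite sub0r normrN ger0_norm ?exprn_ge0// => ?; exists k.
Qed.

Section Costs.
Context {R : realType}.

Definition dyadic (b : R -> R) (t L : R) (Q : R -> Prop) : Prop :=
  forall n i, (i <= 2 ^ n)%N -> Q (b (t + i%:R * (L / 2 ^+ n)) - b t).

(** The cost e p is that of one step of the grid of mesh 2^-(rho m) from its
    point p, to be paid when none of the m scales is quiet there. The grid is
    that of [0, 2], to leave room for jumping beyond time 1. *)
Definition affordable (b : R -> R) (delta eps : R) (m rho : nat) : Prop :=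
  exists2 e : nat -> R,
   (forall p, 0 <= e p) /\ \sum_(p < 2 * 2 ^ (rho * m)) e p <= eps &
   forall p, (p < 2 * 2 ^ (rho * m))%N ->
   (exists2 j, (j < m)%N & dyadic b (p%:R * 2 ^- (rho * m)) (2 ^- (rho * j))
      (fun x => `|x| <= delta * Num.sqrt (2 ^- (rho * j)))) \/
   0 < e p /\ dyadic b (p%:R * 2 ^- (rho * m)) (2 ^- (rho * m)) (fun x => x ^+ 2 <= e p).

End Costs.

Section Limits.
Context {d : measure_display} {T : measurableType d} {R : realType}.
Variables (P : probability T R) (B : R -> {RV P >-> R}).
Hypothesis hB : standard_brownian_motion P B.
Local Notation C0 := (128 * quartic_const R).

Lemma C0_ge0 : 0 <= C0. Proof. by rewrite mulr_ge0// quartic_const_ge0. Qed.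

(** The number m of scales is chosen first, to make (1 - 4^-(2^nu))^m small,
    then the ratio 2^rho between successive scales. The bound does not depend
    on the mesh. *)
Lemma exists_scales (delta q : R) : 0 < delta -> 0 < q ->
  exists m rho nu, forall n p, (rho * m + nu <= n)%N ->
  (P [set w | forall j, (j < m)%N ->
       (~` tube B (2 ^- n) p (2 ^ (n - rho * j)) (delta * Num.sqrt (2 ^- (rho * j)))) w]
   <= q%:E)%E.
Proof.
move=> delta0 q0; have d4 : 0 < delta ^+ 4 by rewrite exprn_gt0.
have C00 := C0_ge0.
have [nu Cnu] := exists_pow4_ge (C0 * 256 / delta ^+ 4 * 4).
pose th : R := 4^-1 ^+ (2 ^ nu).
have th0 : 0 < th by rewrite exprn_gt0//; lra.
have th1 : th <= 1 by rewrite exprn_ile1//; lra.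
have q20 : 0 < q / 2 by rewrite divr_gt0.
have [|| m hm] := @exists_pow_le R (1 - th) (q / 2) _ _ q20; [lra|lra|].
have [rho hrho] := exists_pow4_ge (m%:R * (16 * C0 / delta ^+ 4) / (q / 2)).
exists m, rho, nu => n p np.
have p4 k : 0 < (4 : R) ^+ k by rewrite exprn_gt0.
apply: le_trans (levels_prob hB p np delta0 _) _.
  rewrite (_ : _ / _ = C0 * 256 / delta ^+ 4 * 4 / 4 ^+ nu * 4^-1); last first.
    by field; rewrite !gt_eqF.
  rewrite -[leRHS]mul1r; apply: ler_wpM2r; first by rewrite invr_ge0.
  by rewrite (ler_pdivrMr _ _ (p4 nu)) mul1r.
rewrite lee_fin [leRHS](splitr q); apply: lerD hm.
rewrite (_ : _ * _ = m%:R * (16 * C0 / delta ^+ 4) / 4 ^+ rho); last first.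
  by field; rewrite !gt_eqF.
by rewrite (ler_pdivrMr _ _ (p4 rho)) -ler_pdivrMl// mulrC.
Qed.

Definition far (n : nat) (t L c : R) : set T :=
  [set w | exists2 i, (i <= 2 ^ n)%N & c < `|B (t + i%:R * (L / 2 ^+ n)) w - B t w|].

Lemma far_mono n n' t L c : (n <= n')%N -> far n t L c `<=` far n' t L c.
Proof.
move=> /subnK <-; elim: (n' - n)%N => [//|k IH] w /IH[i ik ci].
exists (2 * i)%N; first by rewrite addSn expnS leq_mul2l.
rewrite (_ : (2 * i)%:R * _ = i%:R * (L / 2 ^+ (k + n)))//.
by rewrite addSn exprS natrM; field; rewrite expf_neq0.
Qed.

Section Escape.
Variables (delta : R) (m rho nu : nat).
Hypothesis delta0 : 0 < delta.
Local Notation l j := ((2 : R) ^- (rho * j)).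
Local Notation n0 := (rho * m + nu)%N.

Definition escape_at (n : nat) (t : R) : set T :=
  [set w | forall j, (j < m)%N -> far (n - rho * j) t (l j) (delta * Num.sqrt (l j)) w].

(** The limit of the events [escape_at], which increase when the mesh
    decreases; it concerns all dyadic times. *)
Definition escape (t : R) : set T := \bigcup_n escape_at (n + n0) t.

(** At a point of the grid, escape is the event of [exists_scales] for the
    sampled path. *)
Lemma escape_atE n k : (n0 <= n)%N ->
  escape_at n (k%:R * l m) = [set w | forall j, (j < m)%N ->
   (~` tube B (2 ^- n) (k * 2 ^ (n - rho * m)) (2 ^ (n - rho * j))
        (delta * Num.sqrt (l j))) w].
Proof.
move=> n0n.
have jn j : (j <= m)%N -> (rho * j <= n)%N.
  move=> jm; apply: leq_trans n0n; apply: leq_trans (leq_addr _ _).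
  by rewrite leq_mul2l jm orbT.
have e1 : (k * 2 ^ (n - rho * m))%:R * 2 ^- n = k%:R * l m.
  by rewrite natrM -mulrA pow_scale// jn.
have e2 j i : (j < m)%N -> (k * 2 ^ (n - rho * m) + i)%:R * 2 ^- n =
   k%:R * l m + i%:R * (l j / 2 ^+ (n - rho * j)).
  move=> jm; rewrite natrD mulrDl e1; congr (_ + _ * _).
  by rewrite -(pow_scale R (jn j (ltnW jm))) natrX mulrAC mulfV ?mul1r// expf_neq0.
apply/seteqP; split=> w /= H j jm.
  move=> tb; have [i ik] := H j jm; rewrite ltNge => /negP; apply.
  by have := tb i ik; rewrite /walk (e2 _ _ jm) e1.
apply: contrapT => nf; apply: (H j jm) => i ik.
rewrite /walk (e2 _ _ jm) e1 leNgt; apply/negP => ci.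
by apply: nf; exists i.
Qed.

Lemma measurable_escape_at n k : (n0 <= n)%N -> measurable (escape_at n (k%:R * l m)).
Proof.
move=> n0n; rewrite escape_atE//.
rewrite (_ : [set w | _] = \bigcap_j (if (j < m)%N then ~` tube B (2 ^- n) (k * 2 ^ (n - rho * m)) (2 ^ (n - rho * j)) (delta * Num.sqrt (l j)) else setT)).
  apply: bigcapT_measurable => j; case: ifPn => // _.
  by apply: measurableC; exact: measurable_tube.
apply/seteqP; split=> w /= H j.
  by move=> _; case: ifPn => // /H.
by move=> jm; have := H j Logic.I; rewrite jm.
Qed.

Lemma measurable_escape k : measurable (escape (k%:R * l m)).
Proof. by apply: bigcupT_measurable => n; apply: measurable_escape_at; exact: leq_addl. Qed.

Lemma escape_at_mono t : nondecreasing_seq (fun n => escape_at n t).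
Proof.
move=> n n' nn'; apply/subsetPset => w H j jm.
by apply: far_mono (H j jm); exact: leq_sub2r.
Qed.

Lemma escape_prob q k :
  (forall n p, (n0 <= n)%N ->
  (P [set w | forall j, (j < m)%N ->
       (~` tube B (2 ^- n) p (2 ^ (n - rho * j)) (delta * Num.sqrt (l j))) w] <= q%:E)%E) ->
  (P (escape (k%:R * l m)) <= q%:E)%E.
Proof.
move=> H; have := @nondecreasing_cvg_mu _ _ _ P (fun n => escape_at (n + n0) (k%:R * l m)).
move=> /(_ _ (measurable_escape k) _) cv.
apply: (cvge_to_le (cv _ _)).
- by move=> n; apply: measurable_escape_at; exact: leq_addl.
- by move=> n n' nn'; apply: escape_at_mono; rewrite leq_add2r.
- by apply: nearW => n /=; rewrite escape_atE ?leq_addl//; apply: H; exact: leq_addl.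
Qed.

(** If each scale had its own level of exit, a common finer level would
    witness escape. *)
Lemma not_escape t w : ~ escape t w -> exists2 j, (j < m)%N &
  dyadic (fun t => B t w) t (l j) (fun x => `|x| <= delta * Num.sqrt (l j)).
Proof.
move=> nE; apply: contrapT => H.
have farj j : exists n, (j < m)%N -> far n t (l j) (delta * Num.sqrt (l j)) w.
  have [jm|jm] := boolP (j < m)%N; last by exists 0%N.
  apply: contrapT => H2; apply: H; exists j => // n i ik.
  rewrite leNgt; apply/negP => ci; apply: H2; exists n => _.
  by exists i.
have [f hf] := choice farj.
apply: nE; exists (\sum_(j < m) f j)%N => // j jm.
apply: far_mono (hf j jm).
rewrite leq_subRL; last first.
  apply: leq_trans (leq_addl _ _); apply: leq_trans (leq_addr _ _).
  by rewrite leq_mul2l (ltnW jm) orbT.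
rewrite addnC leq_add//; first by rewrite (bigD1 (Ordinal jm))//= leq_addr.
by apply: leq_trans (leq_addr _ _); rewrite leq_mul2l (ltnW jm) orbT.
Qed.

End Escape.

Definition osc4_sup (t L : R) (w : T) : \bar R :=
  ereal_sup (range (fun n => (osc4 B n t L w)%:E)).

Lemma osc4_sup_cvg t L w : (osc4 B n t L w)%:E @[n --> \oo] --> osc4_sup t L w.
Proof.
by apply: ereal_nondecreasing_cvgn => n n' nn'; rewrite lee_fin; exact: osc4_mono.
Qed.

Lemma measurable_osc4_sup t L : measurable_fun setT (osc4_sup t L).
Proof.
apply: (@emeasurable_fun_cvg _ _ _ setT (fun n w => (osc4 B n t L w)%:E)) => [n|w _].
  by apply/measurable_EFinP; exact: measurable_osc4.
exact: osc4_sup_cvg.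
Qed.

Lemma osc4_le_sup n t L w : ((osc4 B n t L w)%:E <= osc4_sup t L w)%E.
Proof. by apply: ereal_sup_ubound; exists n. Qed.

Lemma osc4_sup_ge0 t L w : (0 <= osc4_sup t L w)%E.
Proof. by apply: le_trans (osc4_le_sup 0 t L w); rewrite lee_fin osc4_ge0. Qed.

(** Monotone convergence. *)
Lemma osc4_sup_moment t L : 0 <= t -> 0 <= L ->
  (\int[P]_w osc4_sup t L w <= (C0 * L ^+ 2)%:E)%E.
Proof.
move=> t0 L0.
have mono w : {homo (fun n => (osc4 B n t L w)%:E) : n n' / (n <= n')%N >-> (n <= n')%E}.
  by move=> n n' nn'; rewrite lee_fin; exact: osc4_mono.
have cv := @cvg_monotone_convergence _ _ _ P setT measurableT (fun n w => (osc4 B n t L w)%:E).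
have {}cv := cv (fun n => (measurable_EFinP _ _).2 (measurable_osc4 B n t L))
  (fun n w _ => osc4_ge0 B n t L w) (fun w _ => mono w).
have E : (\int[P]_w osc4_sup t L w = \int[P]_w limn (fun n => (osc4 B n t L w)%:E))%E.
  by apply: eq_integral => w _; apply: esym; apply: cvg_lim => //; exact: osc4_sup_cvg.
rewrite E; apply: (cvge_to_le cv); apply: nearW => n; exact: osc4_moment.
Qed.

(** Steps of the smallest length are taken only with a small probability, and
    their mean cost is then of the order of their length; hence the mean total
    cost is small. *)
Lemma exists_costs (delta eps kap : R) : 0 < delta -> 0 < eps -> 0 < kap ->
  exists m rho (W : set T), [/\ measurable W, (P W <= kap%:E)%E &
  forall w, ~ W w -> affordable (fun t => B t w) delta eps m rho].
Proof.
move=> delta0 eps0 kap0; have C00 := C0_ge0.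
have ek0 : 0 < eps * kap by rewrite mulr_gt0.
(* Markov's inequality is applied to the sum Z of the costs, whose mean is at
   most 2 * (lam * q + C0 / lam). The cost x^2 of an unquiet step of length eta
   is split as x^2 <= a + x^4 / a with a = lam * eta: the first term is paid
   only on an event of probability q, the second has mean C0 * eta / lam. *)
pose lam : R := (4 * C0 + 1) / (eps * kap).
have lam0 : 0 < lam by rewrite divr_gt0//; lra.
pose q : R := eps * kap / (4 * lam).
have q0 : 0 < q by rewrite divr_gt0// mulr_gt0.
have [m [rho [nu hq]]] := exists_scales delta0 q0.
pose eta : R := 2 ^- (rho * m).
have eta0 : 0 < eta by rewrite invr_gt0 exprn_gt0.
pose N := (2 * 2 ^ (rho * m))%N.
have Neta : N%:R * eta = 2.
  by rewrite /N natrM natrX /eta -mulrA mulfV ?mulr1// expf_neq0.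
pose a : R := lam * eta.
have a0 : 0 < a by rewrite mulr_gt0.
pose E p := escape delta m rho nu (p%:R * eta).
pose Y p := osc4_sup (p%:R * eta) eta.
have mE p : measurable (E p) by exact: measurable_escape.
have mY p : measurable_fun setT (Y p) by exact: measurable_osc4_sup.
pose Z1 p w := (a%:E * (\1_(E p) w)%:E)%E.
pose Z2 p w := ((a^-1)%:E * Y p w)%E.
have mZ1 p : measurable_fun setT (Z1 p).
  by apply: emeasurable_funM => //; apply/measurable_EFinP; exact: measurable_indic.
have mZ2 p : measurable_fun setT (Z2 p) by exact: emeasurable_funM.
have Z10 p w : (0 <= Z1 p w)%E by rewrite mule_ge0// lee_fin// ltW.
have Z20 p w : (0 <= Z2 p w)%E by rewrite mule_ge0 ?osc4_sup_ge0// lee_fin invr_ge0 ltW.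
pose Z w := (\sum_(p < N) (Z1 p w + Z2 p w))%E.
have mZ : measurable_fun setT Z.
  by apply: emeasurable_sum => p; exact: emeasurable_funD.
have Z0 w : (0 <= Z w)%E by apply: sume_ge0 => p _; exact: adde_ge0.
have IZ : (\int[P]_w Z w <= (eps * kap)%:E)%E.
  rewrite /Z ge0_integral_sum//; last 2 first.
  - by move=> p; exact: emeasurable_funD.
  - by move=> p w _; exact: adde_ge0.
  apply: (@le_trans _ _ (\sum_(p < N) (a * q + a^-1 * (C0 * eta ^+ 2))%:E)%E).
    apply: lee_sum => p _; rewrite ge0_integralD//.
    rewrite EFinD; apply: leeD.
      rewrite ge0_integralZl//; last 2 first.
      - by apply/measurable_EFinP; exact: measurable_indic.
      - by rewrite lee_fin ltW.
      have -> : (\int[P]_x (\1_(E p) x)%:E = P (E p))%E by rewrite integral_indic// setIT.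
      by rewrite (EFinM a q); apply: lee_wpmul2l; [rewrite lee_fin ltW|exact: escape_prob].
    rewrite ge0_integralZl//; last 2 first.
    - by move=> w _; exact: osc4_sup_ge0.
    - by rewrite lee_fin invr_ge0 ltW.
    rewrite (EFinM a^-1); apply: lee_wpmul2l; first by rewrite lee_fin invr_ge0 ltW.
    by apply: osc4_sup_moment; rewrite ?mulr_ge0// ltW.
  rewrite sumEFin lee_fin sumr_const card_ord -[leLHS]mulr_natl.
  rewrite (_ : N%:R * _ = (N%:R * eta) * (lam * q + C0 / lam)); last first.
    by rewrite /a; field; rewrite !gt_eqF.
  rewrite Neta.
  have -> : lam * q = eps * kap / 4 by rewrite /q; field; rewrite !gt_eqF.
  have : C0 / lam <= eps * kap / 4.
    rewrite ler_pdivrMr// /lam (_ : eps * kap / 4 * _ = C0 + 4^-1); last first.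
      by field; rewrite !gt_eqF.
    by rewrite lerDl.
  by move: ek0 => + H; lra.
have [mW PW] := ge0_emarkov mZ Z0 IZ eps0.
exists m, rho, [set w | (eps%:E < Z w)%E]; split => //.
  by rewrite (mulrC eps) mulfK ?gt_eqF in PW.
move=> w /= /negP; rewrite -leNgt => Zw.
pose e p := if w \in E p then a + a^-1 * fine (Y p w) else 0.
have Y0 p : 0 <= fine (Y p w) by rewrite fine_ge0// osc4_sup_ge0.
have ai0 : 0 <= a^-1 by rewrite invr_ge0 ltW.
have e0 p : 0 <= e p.
  rewrite /e; case: ifPn => // _.
  exact: addr_ge0 (ltW a0) (mulr_ge0 ai0 (Y0 p)).
have Zp p : (p < N)%N -> (Z1 p w + Z2 p w <= eps%:E)%E.
  move=> pN; apply: le_trans Zw; rewrite /Z (bigD1 (Ordinal pN))//=.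
  by rewrite leeDl// sume_ge0// => i _; exact: adde_ge0.
have Yfin p : (p < N)%N -> Y p w \is a fin_num.
  move=> pN; rewrite ge0_fin_numE ?osc4_sup_ge0//.
  have : (Z2 p w <= eps%:E)%E by apply: le_trans (Zp p pN); rewrite leeDr.
  rewrite /Z2 lee_pdivrMl// -EFinM => /le_lt_trans; apply.
  exact: ltry.
exists e; first split => //.
  rewrite -lee_fin -sumEFin; apply: le_trans Zw; apply: lee_sum => p _.
  rewrite /e /Z1 /Z2 indicE; case: ifPn => wE.
    by rewrite mule1 EFinD (EFinM a^-1) fineK// Yfin.
  by rewrite mule0 add0e; exact: (Z20 p w).
move=> p pN; have [wE|wE] := boolP (w \in E p); last first.
  by left; apply: (@not_escape delta m rho nu) => Ew; case/negP: wE; rewrite inE.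
right; rewrite /e wE; split.
  exact: ltr_pwDl a0 (mulr_ge0 ai0 (Y0 p)).
move=> n i ik; set x := _ - _.
have xY : x ^+ 4 <= fine (Y p w).
  rewrite -lee_fin fineK ?Yfin//; apply: le_trans (osc4_le_sup n _ _ _).
  by rewrite lee_fin; exact: osc4_bound.
have : x ^+ 2 <= a + a^-1 * x ^+ 4.
  rewrite -subr_ge0 (_ : _ - _ = ((x ^+ 2 - a) ^+ 2 + a * x ^+ 2) / a); last first.
    by field; rewrite gt_eqF.
  by rewrite divr_ge0 ?(ltW a0)// addr_ge0 ?sqr_ge0// mulr_ge0 ?sqr_ge0// ltW.
by move=> /le_trans; apply; rewrite lerD2l ler_wpM2l.
Qed.

End Limits.

(** * From costs to a cover *)

Section Greedy.
Context {R : realType}.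

Lemma ler_sum_nat_widen (f : nat -> R) (a b : nat) : (forall i, 0 <= f i) -> (a <= b)%N ->
  \sum_(0 <= i < a) f i <= \sum_(0 <= i < b) f i.
Proof.
move=> f0 ab; rewrite [leRHS](@big_cat_nat _ _ _ a)//= lerDl.
exact: sumr_ge0.
Qed.

Variables (N : nat) (s : nat -> nat).
Hypothesis s0 : forall p, (p < N)%N -> (0 < s p)%N.

Definition pos (i : nat) : nat := iter i (fun p => p + s p)%N 0%N.

Lemma pos_sum n : pos n = (\sum_(0 <= i < n) s (pos i))%N.
Proof.
elim: n => [|n IH]; first by rewrite big_geq.
by rewrite big_nat_recr//= -IH.
Qed.

Lemma greedy : exists2 n, (N <= pos n)%N & forall i, (i < n)%N -> (pos i < N)%N.
Proof.
have ex : exists n, (N <= pos n)%N.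
  apply: contrapT => /forallNP H.
  have H' i : (pos i < N)%N by rewrite ltnNge; apply/negP; exact: H.
  suff : (N <= pos N)%N by exact: H.
  elim: {1 2}N => [//|i IH] /=.
  by rewrite -addn1 leq_add// s0// H'.
exists (ex_minn ex); first by case: ex_minnP.
by case: ex_minnP => n _ min i; rewrite ltnNge => ni; rewrite ltnNge; apply: contra ni => /min.
Qed.

(** Distinct positions are visited, so each cost is paid at most once. *)
Lemma greedy_cost (e : nat -> R) n : (forall p, 0 <= e p) ->
  (forall i, (i < n)%N -> (pos i < N)%N) ->
  \sum_(0 <= i < n) e (pos i) <= \sum_(0 <= p < N) e p.
Proof.
move=> e0 posN; pose e' p := if (p < N)%N then e p else 0.
have e'0 p : 0 <= e' p by rewrite /e'; case: ifPn.
apply: (@le_trans _ _ (\sum_(0 <= p < pos n) e' p)); last first.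
  apply: (@le_trans _ _ (\sum_(0 <= p < maxn N (pos n)) e' p)).
    by apply: ler_sum_nat_widen => //; exact: leq_maxr.
  rewrite (@big_cat_nat _ _ _ N)//= ?leq_maxl//.
  rewrite [X in _ + X]big1_seq ?addr0; last first.
    move=> p /andP[_]; rewrite mem_index_iota => /andP[Np _].
    by rewrite /e' ltnNge Np.
  rewrite le_eqVlt; apply/orP; left; apply/eqP.
  by apply: eq_big_nat => p /andP[_ pN]; rewrite /e' pN.
elim: n posN => [|n IH] posN; first by rewrite !big_geq.
rewrite big_nat_recr//=.
apply: (@le_trans _ _ (\sum_(0 <= p < (pos n).+1) e' p)); last first.
  apply: ler_sum_nat_widen => //.
  by rewrite -addn1 leq_add2l s0// posN.
rewrite big_nat_recr//= lerD//.
  by apply: IH => i ni; apply: posN; exact: ltnW.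
by rewrite /e' posN.
Qed.

End Greedy.

Section PathCover.
Context {R : realType}.
Variable b : R -> R.
Hypothesis cb : continuous b.

(** Density of the dyadic times and continuity of the path. *)
Lemma dyadic_bound (t L c : R) : 0 < L ->
  dyadic b t L (fun x => `|x| <= c) ->
  forall u, t <= u <= t + L -> `|b u - b t| <= c.
Proof.
move=> L0 H u /andP[tu uL]; apply/ler_addgt0Pr => e e0.
have /cvgrPdist_lt/(_ e e0)/nbhs_ballP[r /= r0 Hr] := @cb u.
pose n := Num.bound (L / r).
have p0 : 0 < (2 : R) ^+ n by rewrite exprn_gt0.
have Lr : L / 2 ^+ n < r.
  have := upper_nthrootP (leqnn n); rewrite ltr_pdivrMr// => h.
  by rewrite ltr_pdivrMr// mulrC.
have h0 : 0 < L / 2 ^+ n by rewrite divr_gt0.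
have x0 : 0 <= (u - t) / (L / 2 ^+ n) by rewrite divr_ge0 ?subr_ge0// ltW.
have /andP[i1 i2] := truncn_itv x0.
set i := Num.truncn _ in i1 i2.
have ik : (i <= 2 ^ n)%N.
  rewrite -(ler_nat R) (le_trans i1)// ler_pdivrMr// natrX mulrC divfK ?gt_eqF//.
  by rewrite lerBlDl.
move: i1 i2; rewrite ler_pdivlMr// ltr_pdivrMr// -[i.+1%:R]natr1 mulrDl mul1r => i1 i2.
have := Hr (t + i%:R * (L / 2 ^+ n)).
rewrite /ball /= ger0_norm; last by rewrite subr_ge0 -lerBrDl.
have -> : u - (t + i%:R * (L / 2 ^+ n)) < r.
  by apply: le_lt_trans Lr; rewrite opprD addrA lerBlDl ltW.
move=> /(_ isT) /ltW; rewrite distrC => bu.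
rewrite (_ : b u - b t = (b (t + i%:R * (L / 2 ^+ n)) - b t) -
  (b (t + i%:R * (L / 2 ^+ n)) - b u)); last by ring.
by rewrite (le_trans (ler_normB _ _))// lerD// H.
Qed.

(** Starting from 0, jump over the quiet scale when there is one and by one
    step of the grid otherwise, until time 2 is passed. A quiet jump of length
    l costs delta^2 * l, hence at most 3 * delta^2 for all of them. *)
Lemma cover_of_costs (delta eps : R) (m rho : nat) :
  0 < delta -> affordable b delta eps m rho ->
  exists n t c, covers b n t c /\ \sum_(0 <= j < n) c j ^+ 2 <= 3 * delta ^+ 2 + eps.
Proof.
move=> delta0 [e [e0 esum] Hp].
pose K := (2 ^ (rho * m))%N.
pose N := (2 * K)%N.
pose eta : R := 2 ^- (rho * m).
have eta0 : 0 < eta by rewrite invr_gt0 exprn_gt0.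
have Keta : K%:R * eta = 1 by rewrite /K /eta natrX mulfV// expf_neq0.
(* sc.1 is the number of grid steps to jump, sc.2 the half-height of the box. *)
have step p : exists sc : nat * R, (p < N)%N ->
  [/\ (0 < sc.1 <= K)%N, 0 < sc.2, sc.2 ^+ 2 <= delta ^+ 2 * (sc.1%:R * eta) + e p &
   forall u, p%:R * eta <= u <= (p + sc.1)%:R * eta -> `|b u - b (p%:R * eta)| <= sc.2].
  have [pN|pN] := boolP (p < N)%N; last by exists (0%N, 0).
  have [[j jm Hj]|[ep Hj]] := Hp p pN.
    have l0 : 0 < (2 : R) ^- (rho * j) by rewrite invr_gt0 exprn_gt0.
    have jm' : (rho * j <= rho * m)%N by rewrite leq_mul2l (ltnW jm) orbT.
    exists ((2 ^ (rho * m - rho * j))%N, delta * Num.sqrt (2 ^- (rho * j))) => _ /=.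
    split.
    - by rewrite expn_gt0/= leq_pexp2l// leq_subr.
    - by rewrite mulr_gt0// sqrtr_gt0.
    - by rewrite pow_scale// exprMn sqr_sqrtr ?(ltW l0)// lerDl.
    - rewrite natrD mulrDl pow_scale//.
      exact: (dyadic_bound l0 Hj).
  exists (1%N, Num.sqrt (e p)) => _ /=; split.
  - by rewrite expn_gt0.
  - by rewrite sqrtr_gt0.
  - by rewrite sqr_sqrtr ?(ltW ep)// lerDr mul1r mulr_ge0 ?sqr_ge0// ltW.
  - rewrite natrD mulrDl mul1r; apply: dyadic_bound => // n i ik.
    by rewrite -sqrtr_sqr ler_sqrt ?Hj// ltW.
have [f Hf] := choice step.
pose s p := (f p).1.
have s0 p : (p < N)%N -> (0 < s p)%N by move=> /Hf[/andP[]].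
have [n Nn posN] := greedy s0.
pose t i : R := (pos s i)%:R * eta.
exists n, t, (fun i => (f (pos s i)).2).
have tS i : t i.+1 = (pos s i + s (pos s i))%:R * eta by [].
have n0 : (0 < n)%N.
  by case: (n) Nn => //=; rewrite leqn0 muln_eq0/= expn_eq0.
have tn3 : t n <= 3.
  have := posN n.-1; rewrite ltn_predL => /(_ n0) pN.
  have [/andP[_ sK] _ _ _] := Hf _ pN.
  have -> : (3 : R) = (3 * K)%:R * eta by rewrite natrM -mulrA Keta mulr1.
  rewrite ler_pM2r// ler_nat -[in leqLHS](prednK n0) /=.
  by rewrite (mulnDl 2 1) mul1n leq_add// ltnW.
split.
- split => //.
  + by rewrite /t /= mul0r.
  + by move=> i _; rewrite tS ler_pM2r// ler_nat leq_addr.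
  + rewrite tn3 andbT (@lt_le_trans _ _ 2)//; first lra.
    have -> : (2 : R) = (2 * K)%:R * eta by rewrite natrM -mulrA Keta mulr1.
    by rewrite ler_pM2r// ler_nat.
  + by move=> i ni; have [] := Hf _ (posN i ni).
  + by move=> i u ni; have [_ _ _ H] := Hf _ (posN i ni); exact: H.
apply: (@le_trans _ _ (\sum_(0 <= i < n) (delta ^+ 2 * eta * (s (pos s i))%:R + e (pos s i)))).
  rewrite !big_nat; apply: ler_sum => i /andP[_ ni].
  have [_ _ H _] := Hf _ (posN i ni).
  by rewrite -mulrA (mulrC eta).
rewrite big_split /=; apply: lerD; last first.
  by apply: le_trans (greedy_cost s0 e0 posN) _; rewrite big_mkord.
rewrite -mulr_sumr -natr_sum -pos_sum -mulrA (mulrC eta) [leRHS]mulrC.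
by apply: ler_wpM2l; [exact: sqr_ge0|exact: tn3].
Qed.

End PathCover.

(** * The graph of Brownian motion *)

Lemma continuous_extend0 (R : realType) (f : R -> R) :
  {within `[0, +oo[, continuous f} -> continuous (fun x : R => f (Num.max 0 x)).
Proof.
move=> /(@subspace_continuousP _ _ _ f) cf x.
have Hx : (`[0, +oo[%classic : set R) (Num.max 0 x) by rewrite /= in_itv/= andbT le_max lexx.
apply/cvgrPdist_lt => e e0.
have /cvgrPdist_lt/(_ e e0) := cf _ Hx.
rewrite near_withinE => /nbhs_ballP[r /= r0 Hr].
apply/nbhs_ballP; exists r => //= y xy; apply: Hr; last first.
  by rewrite in_itv/= andbT le_max lexx.
rewrite /ball /=; apply: le_lt_trans xy.
have [x0|x0] := leP 0 x; have [y0|y0] := leP 0 y.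
- exact: lexx.
- rewrite subr0 ger0_norm// (le_trans _ (ler_norm _))// lerBrDl; lra.
- by rewrite sub0r normrN ger0_norm// -normrN opprB (le_trans _ (ler_norm _))//; lra.
- by rewrite subrr normr0.
Qed.

Section Final.
Context {d : measure_display} {T : measurableType d} {R : realType}.
Variables (P : probability T R) (B : R -> {RV P >-> R}).
Hypothesis hB : standard_brownian_motion P B.

(** For each precision 1 / (i + 1) the exceptional events of [exists_costs]
    can be taken of probability 1 / (k + 1) for all k; their intersection is a
    null set. *)
Lemma brownian_cheap : {ae P, forall w, {within `[0, +oo[, continuous (fun t => B t w)} ->
  cheap (fun x => B (Num.max 0 x) w)}.
Proof.
have kap0 k : 0 < (k.+1%:R^-1 : R) by rewrite invr_gt0.
have eps0 i : 0 < (i.+1%:R^-1 / 2 : R) by rewrite divr_gt0.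
(* Chosen so that 3 * delta i ^+ 2 + (i + 1)^-1 / 2 = (i + 1)^-1. *)
pose delta i : R := Num.sqrt (i.+1%:R^-1 / 6).
have delta0 i : 0 < delta i by rewrite sqrtr_gt0 divr_gt0.
pose ok i w := exists m rho, affordable (fun t => B t w) (delta i) (i.+1%:R^-1 / 2) m rho.
have HW i k : exists W : set T, [/\ measurable W, (P W <= (k.+1%:R^-1)%:E)%E &
    forall w, ~ W w -> ok i w].
  have [m [rho [W [mW PW H]]]] := exists_costs hB (delta0 i) (eps0 i) (kap0 k).
  by exists W; split => // w /H; exists m, rho.
have aeok : {ae P, forall w, forall i, ok i w}.
  apply/ae_foralln => i.
  have [W HWi] := choice (HW i).
  exists (\bigcap_k W k); split.
  - by apply: bigcapT_measurable => k; have [] := HWi k.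
  - apply/eqP; rewrite eq_le measure_ge0 andbT; apply/lee_addgt0Pr => e e0.
    rewrite add0e.
    have [k ke] : exists k, k.+1%:R^-1 <= e.
      exists (Num.bound e^-1); rewrite -[leRHS]invrK lef_pV2 ?posrE ?invr_gt0//.
      have := archi_boundP (ltW (_ : 0 < e^-1)); rewrite invr_gt0 => /(_ e0) /ltW h.
      by rewrite (le_trans h)// ler_nat.
    have [mW PW _] := HWi k.
    apply: (@le_trans _ _ (P (W k))); last by rewrite (le_trans PW)// lee_fin.
    apply: le_measure; rewrite ?inE//.
      by apply: bigcapT_measurable => k'; have [] := HWi k'.
    by move=> w; apply.
  - move=> w nok k _; apply: contrapT => nW; apply: nok.
    by have [_ _] := HWi k; apply.
apply: filterS aeok => w okw cw e e0.
have [i ie] : exists i, i.+1%:R^-1 <= e.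
  exists (Num.bound e^-1); rewrite -[leRHS]invrK lef_pV2 ?posrE ?invr_gt0//.
  have := archi_boundP (ltW (_ : 0 < e^-1)); rewrite invr_gt0 => /(_ e0) /ltW h.
  by rewrite (le_trans h)// ler_nat.
have [m [rho [c csum H]]] := okw i.
have pos_ge0 p (x : R) : 0 <= x -> 0 <= p%:R * x by move=> x0; rewrite mulr_ge0.
have l0 j : 0 <= (2 : R) ^- j by rewrite invr_ge0 exprn_ge0.
have extend p j Q : dyadic (fun t => B t w) (p%:R * 2 ^- (rho * m)) (2 ^- j) Q ->
    dyadic (fun t => B (Num.max 0 t) w) (p%:R * 2 ^- (rho * m)) (2 ^- j) Q.
  move=> HQ n k kn; have t0 := pos_ge0 p _ (l0 (rho * m)%N).
  have u0 : 0 <= p%:R * 2 ^- (rho * m) + k%:R * (2 ^- j / 2 ^+ n) :> R.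
    by apply: addr_ge0 => //; apply: pos_ge0; rewrite divr_ge0// exprn_ge0.
  by rewrite (max_idPr t0) (max_idPr u0); exact: HQ.
have aff : affordable (fun t => B (Num.max 0 t) w) (delta i) (i.+1%:R^-1 / 2) m rho.
  exists c => // p pN; case: (H p pN) => [[j jm Hj]|[cp Hj]].
    by left; exists j => //; exact: extend.
  by right; split => //; exact: extend.
have [n [t [c' [cov cost]]]] := cover_of_costs (continuous_extend0 cw) (delta0 i) aff.
exists n, t, c'; split=> //; apply: (le_trans cost); apply: le_trans ie.
rewrite sqr_sqrtr; last by rewrite divr_ge0.
rewrite le_eqVlt; apply/orP; left; apply/eqP; field.
by rewrite -[1 + _](natrD R 1) pnatr_eq0.
Qed.

End Final.

Theorem theorem1p2 (R : realType) (d : measure_display) (T : measurableType d)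
    (P : probability T R) (B : R -> {RV P >-> R}) :
  standard_brownian_motion P B ->
  {ae P, forall w, W1infty_removable [set (t, B t w) | t in `[0, 1]]}.
Proof.
move=> hB; apply: filterS2 (bm_continuous_paths hB) (brownian_cheap hB) => w cw chw.
have -> : [set (t, B t w) | t in `[0, 1]] = graph01 (fun x => B (Num.max 0 x) w).
  rewrite /graph01; apply/seteqP; split => _ [t t01 <-]; exists t => //;
    by move: t01; rewrite /= in_itv/= => /andP[/max_idPr -> _].
exact: removable_of_cheap (continuous_extend0 cw) (chw cw).
Qed.
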